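(* Let $v\colon[0,T]\times\mathbb{R}^d\to\mathbb{R}^d$ and $w\colon[0,T]\times\mathbb{R}^d\to\mathbb{R}$ be Borel maps, and let $\mu\in\mathcal{C}([0,T];\mathscr{M}_+(\mathbb{R}^d))$ satisfy $$\int_0^T\Big[\sup_B|v_t|+\mathrm{Lip}(v_t,B)+\sup_B|w_t|+\mathrm{Lip}(w_t,B)\Big]\,\mathrm{d}t<\infty\qquad\text{for every }B\Subset\mathbb{R}^d,$$ $$\partial_t\mu+\mathrm{div}(v\mu)=w\mu\quad\text{in }\mathcal{D}'((0,T)\times\mathbb{R}^d),\qquad\int_0^T\int_{\mathbb{R}^d}\big[|v_t|+|w_t|\big]\,\mathrm{d}\mu_t\,\mathrm{d}t<\infty.$$ Then, for every $s,t\in[0,T]$, $$(X_{s\to t})_\sharp\big(W_{s\to t}\,\mu_s|_{E_{s\to t}}\big)=\mu_t|_{E_{t\to s}}.$$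
   Context: $d\ge1$ is an integer and $T\in(0,\infty)$. $\mathscr{M}_+(\mathbb{R}^d)$ is the set of non-negative finite Borel measures on $\mathbb{R}^d$ with the narrow topology (convergence against bounded continuous functions); $\mathcal{C}([0,T];\mathscr{M}_+(\mathbb{R}^d))$ is the set of narrowly continuous curves. $v_t=v(t,\cdot)$, $w_t=w(t,\cdot)$. $\mathrm{Lip}(f,B)=\sup\{|f(x)-f(y)|/|x-y|:x,y\in B,\ x\ne y\}$; $B\Subset\mathbb{R}^d$ means that $B$ has compact closure in $\mathbb{R}^d$. $\mu|_B$ is the restriction of $\mu$ to $B$ and $F_\sharp$ denotes push-forward. The equation in $\mathcal{D}'((0,T)\times\mathbb{R}^d)$ means $\int_0^T\int_{\mathbb{R}^d}\big[\partial_t\zeta_t+\langle\nabla\zeta_t,v_t\rangle+\zeta_tw_t\big]\,\mathrm{d}\mu_t\,\mathrm{d}t=0$ for every $\zeta\in\mathcal{C}_c^\infty((0,T)\times\mathbb{R}^d)$. Flow: for every $(t,x)\in[0,T]\times\mathbb{R}^d$ there is a unique maximal (absolutely continuous) solution of $X'(r)=v_r(X(r))$, $X(t)=x$, defined on a relatively open subinterval $I(t,x)$ of $[0,T]$ containing $t$; its value at $r\in I(t,x)$ is denoted $X_{t\to r}(x)$. For $\tau\in I(s,x)$ set $W_{s\to\tau}(x)=\exp\big(\int_s^\tau w_r(X_{s\to r}(x))\,\mathrm{d}r\big)\in(0,\infty)$. For $a,b\in[0,T]$ set $E_{a\to b}=\{x\in\mathbb{R}^d:b\in I(a,x)\}$,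 which is an open set. *)

(* Defs.v *)
From HB Require Import structures.
From mathcomp Require Import all_boot all_order all_algebra.
From mathcomp Require Import all_classical all_reals all_analysis.
Import Order.TTheory GRing.Theory Num.Theory.
Import numFieldNormedType.Exports.

Set Implicit Arguments.
Unset Strict Implicit.
Unset Printing Implicit Defensive.

Local Open Scope classical_set_scope.
Local Open Scope ring_scope.

Section borel_rV.
Variables (R : realType) (d : nat).

Definition borel_rV : set (set 'rV[R]_d) := <<s @open 'rV[R]_d >>.

HB.instance Definition _ := @isMeasurable.Build (sigma_display (@open 'rV[R]_d))
  'rV[R]_d borel_rV (@sigma_algebra0 _ setT _) (@sigma_algebraC _ _)
  (@sigma_algebra_bigcup _ setT _).

End borel_rV.

Section norms.
Variable R : realType.

(* The norm `|x| of the library on 'rV[R]_d is the maximum norm. *)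
Definition enorm d (x : 'rV[R]_d) : R := Num.sqrt (\sum_i x 0 i ^+ 2).

(* 0 is added to both suprema so that they are 0, and not -oo, when they range
   over the empty set. *)
Definition sup_on (V W : Type) (N : W -> R) (f : V -> W) (B : set V) : \bar R :=
  ereal_sup ([set 0%E] `|` [set (N (f x))%:E | x in B]).

Definition Lip d (W : zmodType) (N : W -> R) (f : 'rV[R]_d -> W)
    (B : set 'rV[R]_d) : \bar R :=
  ereal_sup ([set 0%E] `|`
    [set z | exists x y, [/\ B x, B y, x != y &
                             z = (N (f x - f y) / enorm (x - y))%:E]]).

End norms.

Section flow.
Variables (R : realType) (d : nat).
Local Notation V := 'rV[R]_d.

Definition abs_continuous (a b : R) (X : R -> V) : Prop :=
  forall e : R, 0 < e -> exists2 delta : R, 0 < delta &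
    forall (n : nat) (l r : 'I_n -> R),
      (forall i, [/\ a <= l i, l i <= r i & r i <= b]) ->
      (forall i j, i != j -> r i <= l j \/ r j <= l i) ->
      \sum_i (r i - l i) < delta ->
      \sum_i enorm (X (r i) - X (l i)) < e.

Definition relatively_open_subinterval (T : R) (J : set R) : Prop :=
  is_interval J /\ exists2 U : set R, open U & J = U `&` `[0, T].

(* X is a total function of which only the values on J matter. Absolute
   continuity is required on the compact subintervals of J, since a maximal
   solution may blow up at an end of J that is not in J. *)
Definition is_solution (v : R -> V -> V) (T s : R) (x : V)
    (J : set R) (X : R -> V) : Prop :=
  [/\ relatively_open_subinterval T J, J s, X s = x,
      forall a b, J a -> J b -> abs_continuous a b X &
      {ae @lebesgue_measure R, forall r : R, J r ->
        is_derive r 1 X (v r (X r))}].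

Definition is_maximal_solution (v : R -> V -> V) (T s : R) (x : V)
    (J : set R) (X : R -> V) : Prop :=
  is_solution v T s x J X /\
  forall J' X', is_solution v T s x J' X' ->
    J `<=` J' -> (forall r, J r -> X' r = X r) -> J' = J.

(* Under the assumptions on v the maximal solution exists and is unique (on its
   interval); the default value (set0, constant x) is then never used. *)
Definition maximal_solution (v : R -> V -> V) (T s : R) (x : V) :
    set R * (R -> V) :=
  xget (set0, fun=> x) [set JX | is_maximal_solution v T s x JX.1 JX.2].

(* I(s, x) *)
Definition flow_itv v T s x : set R := (maximal_solution v T s x).1.

(* X_{s -> t}(x) *)
Definition flow v T s t x : V := (maximal_solution v T s x).2 t.

(* E_{a -> b} *)
Definition flow_dom v T a b : set V := [set x | flow_itv v T a x b].

Definition oriented_int (a b : R) (f : R -> R) : R :=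
  if a <= b then \int[lebesgue_measure]_(r in `[a, b]) f r
  else - \int[lebesgue_measure]_(r in `[b, a]) f r.

(* W_{s -> t}(x) *)
Definition flow_weight (v : R -> V -> V) (w : R -> V -> R) T s t (x : V) : R :=
  expR (oriented_int s t (fun r => w r (flow v T s r x))).

End flow.

Section continuity_equation.
Variables (R : realType) (d : nat).
Local Notation V := 'rV[R]_d.

Definition narrowly_continuous (T : R)
    (mu : R -> {finite_measure set V -> \bar R}) : Prop :=
  forall phi : V -> R, continuous phi ->
    (exists M : R, forall x, `|phi x| <= M) ->
    {within `[0, T], continuous (fun t => \int[mu t]_x phi x)}.

(* All derivatives along fixed directions are used, which for continuous
   derivatives is the same as all partial derivatives. *)
Fixpoint Ck (U : normedModType R) (k : nat) (f : U -> R) : Prop :=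
  continuous f /\
  if k is k'.+1 then
    forall u : U, (forall p, derivable f p u) /\ Ck k' (fun p => 'D_u f p)
  else True.

Definition smooth (U : normedModType R) (f : U -> R) : Prop :=
  forall k, Ck k f.

(* C_c^oo((0, T) x R^d), each function being extended by 0 to R x R^d. *)
Definition is_test_function (T : R) (zeta : R * V -> R) : Prop :=
  [/\ smooth zeta,
      compact (closure [set p | zeta p != 0]) &
      closure [set p | zeta p != 0] `<=` `]0, T[ `*` setT].

Definition time_derivative (zeta : R * V -> R) (t : R) (x : V) : R :=
  'D_((1, 0) : R * V) zeta (t, x).

Definition space_gradient (zeta : R * V -> R) (t : R) (x : V) : V :=
  \row_i 'D_((0, delta_mx 0 i) : R * V) zeta (t, x).

Definition dot (x y : V) : R := \sum_i x 0 i * y 0 i.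

Definition solves_continuity_equation (T : R) (v : R -> V -> V)
    (w : R -> V -> R) (mu : R -> {finite_measure set V -> \bar R}) : Prop :=
  forall zeta, is_test_function T zeta ->
    (\int[@lebesgue_measure R]_(t in `]0%R, T[) \int[mu t]_x
      (time_derivative zeta t x + dot (space_gradient zeta t x) (v t x)
       + zeta (t, x) * w t x)%:E = 0)%E.

End continuity_equation.

Section measures.
Variables (R : realType) (dp : measure_display) (S : measurableType dp).

Definition restricted (m : set S -> \bar R) (D : set S) : set S -> \bar R :=
  fun A => m (A `&` D).

Definition weighted_restricted (m : {measure set S -> \bar R}) (f : S -> R)
    (D : set S) : set S -> \bar R :=
  fun A => (\int[m]_(x in A `&` D) (f x)%:E)%E.

End measures.

(* Main.v *)
Require Import Defs.
From HB Require Import structures.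
From mathcomp Require Import all_boot all_order all_algebra.
From mathcomp Require Import all_classical all_reals all_analysis.
From mathcomp Require Import measurable_realfun.
From mathcomp Require Import ring lra.
Import Order.TTheory GRing.Theory Num.Theory.
Import numFieldNormedType.Exports.

Set Implicit Arguments.
Unset Strict Implicit.
Unset Printing Implicit Defensive.

Local Open Scope classical_set_scope.
Local Open Scope ring_scope.

(** The reason is conservation along characteristics. Fix a time t and a
    function phi, and let
      psi_r(x) = phi(X_{r->t}(x)) W_{r->t}(x)
    be phi carried back to time r. Formally psi solves the dual equation
    d/dr psi + <v, grad psi> + w psi = 0, so that the integral of psi_r against
    mu_r does not depend on r; comparing r = s with r = t gives
      \int phi(X_{s->t}) W_{s->t} d(mu_s) = \int phi d(mu_t),
    the claim tested on phi. Since v is merely integrable in time and Lipschitz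
    in space, psi is not an admissible test function, and the argument is
    carried out by estimates of increments instead.

    Space is localised first. It is enough to treat functions phi that vanish
    at the points whose path from t to s leaves the ball of radius n. For these
    the field may be clamped outside of a slightly larger ball; it then has a
    global flow, obtained by Picard iteration ([gflow]). The maximal solution
    is identified with the flows of the clamped fields in
    [maximal_solution_trunc], and E_{t->s} is the union of the sets of good
    points as n grows.

    Time is measured by a primitive m of an integrable function L that bounds
    the field and its Lipschitz constant. If the increments of a function
    are at most K (m b - m a)^2 + k (m b - m a) over all intervals, they are at
    most k (m b - m a), however large K is ([sum_quadratic_errors]).

    The equation is extended from smooth products to functions h of x with
    Lipschitz gradient in [weak_c11], by smooth approximation and cutoffs in
    time. It implies that the integral of a Lipschitz function against mu_r
    varies by at most a multiple of the increment of m ([lipc_increment]), so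
    that over one time step mu_r may be frozen at the cost of a quadratic error
    ([one_step_estimate]).

    Finally psi_r is replaced by its average M psi_r over cubes of side eps,
    which has a Lipschitz gradient ([mollifier_exists]). Over one time step the
    flow translates the points of such a cube by nearly the same vector, so
    that averaging commutes with it up to a multiple of eps (m b - m a) and a
    quadratic error ([psi_short_time]). Hence the integral of M psi_r against
    mu_r has increments at most K_eps (m b - m a)^2 + C eps (m b - m a).
    Subdividing and then letting eps tend to 0 shows that the integral of psi_r
    does not increase; the same for - phi gives [transport_identity]. Lipschitz
    functions increasing to indicators of open sets and Dynkin's lemma turn it
    into an identity of measures ([transport_level]), and n tends to infinity in
    [transport_of_measures]. *)

(** * Increments with quadratic errors *)

Section quad.
Context {R : realType}.
Implicit Types (m g : R -> R) (a b : R).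

(** Cut the interval into N pieces on each of which m grows by the same
    amount, which is possible by the intermediate value theorem. The
    quadratic terms then add up to K (m b - m a)^2 / N, which vanishes as N
    grows. Estimates in time are brought to this form where no derivative in
    time is available. *)
Lemma sum_quadratic_errors m g a b (K k : R) : a <= b ->
  continuous m -> {homo m : x y / x <= y} -> 0 <= K ->
  (forall x y, a <= x -> x <= y -> y <= b ->
     g y - g x <= K * (m y - m x) ^+ 2 + k * (m y - m x)) ->
  g b - g a <= k * (m b - m a).
Proof.
move=> ab cm hm K0 H; set M := m b - m a.
have M0 : 0 <= M by rewrite subr_ge0 hm.
have step n : forall i, (i <= n.+1)%N -> exists x, [/\ a <= x, x <= b,
   m x = m a + i%:R / n.+1%:R * M &
   g x - g a <= i%:R * (K * (M / n.+1%:R) ^+ 2 + k * (M / n.+1%:R))].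
  elim=> [|i IH] iN.
    by exists a; rewrite lexx ab !mul0r addr0 subrr.
  have [x [ax xb mx gx]] := IH (ltnW iN).
  have n0 : (0 : R) < n.+1%:R by rewrite ltr0n.
  have vE : m a + i.+1%:R / n.+1%:R * M = m x + M / n.+1%:R.
    by rewrite mx -natr1; field; rewrite lt0r_neq0.
  have vb : m x + M / n.+1%:R <= m b.
    rewrite -vE -lerBrDl -/M ler_piMl// ler_pdivrMr// mul1r ler_nat//.
  have Mn0 : 0 <= M / n.+1%:R by rewrite divr_ge0// ltW.
  have mxb : m x <= m b by exact: hm.
  have [||y yxb my] := @IVT R m x b (m x + M / n.+1%:R) xb.
  - exact: continuous_subspaceT.
  - by rewrite min_l// max_r// vb lerDl Mn0.
  move: yxb; rewrite in_itv/= => /andP[xy yb].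
  exists y; split=> //; first exact: le_trans xy.
    by rewrite vE.
  have := H _ _ ax xy yb; rewrite my (addrC (m x)) addrK => gy.
  have -> : g y - g a = (g x - g a) + (g y - g x) by ring.
  by rewrite -(natr1 i) [leRHS]mulrDl mul1r lerD.
apply/ler_addgt0Pr => e e0.
have [n nK] : exists n : nat, K * M ^+ 2 / n.+1%:R <= e.
  have [n] := ltr_add_invr (divr_gt0 e0 (ltr_wpDl (mulr_ge0 K0 (sqr_ge0 M)) ltr01)).
  rewrite add0r => nn; exists n; rewrite ler_pdivrMr ?ltr0n//.
  move: nn; rewrite ltr_pdivlMr; last by rewrite ltr_wpDl// mulr_ge0// sqr_ge0.
  rewrite mulrC ltr_pdivrMr ?ltr0n// => nn; apply: ltW; apply: le_lt_trans nn.
  by rewrite lerDl.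
have [x [ax xb mx gx]] := step n _ (leqnn _).
have n0 : n.+1%:R != 0 :> R by rewrite pnatr_eq0.
have mxb : m x = m b by rewrite mx divff// mul1r /M; lra.
have := H _ _ ax xb (lexx b); rewrite mxb subrr expr0n/= !mulr0 addr0 => gbx.
have E : n.+1%:R * (K * (M / n.+1%:R) ^+ 2 + k * (M / n.+1%:R)) =
   K * M ^+ 2 / n.+1%:R + k * M by field.
rewrite E in gx; move: nK gx; move: (_ / _) (k * M) => u w; lra.
Qed.
End quad.

(** * Primitives of integrable functions *)

Section ae.
Context d {T : measurableType d} {R : realType} (mu : {measure set T -> \bar R}).

Lemma ae_impl (P Q : T -> Prop) : (forall x, P x -> Q x) ->
  {ae mu, forall x, P x} -> {ae mu, forall x, Q x}.
Proof.
move=> PQ [N [mN N0 sN]]; exists N; split=> // x nQ; apply: sN => Px.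
exact: nQ (PQ x Px).
Qed.

Lemma ae_andP (P Q : T -> Prop) : {ae mu, forall x, P x} ->
  {ae mu, forall x, Q x} -> {ae mu, forall x, P x /\ Q x}.
Proof.
move=> [N [mN N0 sN]] [M [mM M0 sM]]; exists (N `|` M); split.
- exact: measurableU.
- by rewrite measureU0.
- move=> x /= /not_andP[nP|nQ]; [left; exact: sN|right; exact: sM].
Qed.

Lemma ae_all (P : T -> Prop) : (forall x, P x) -> {ae mu, forall x, P x}.
Proof.
by move=> H; exists set0; split => // x /= nP; exact/nP/H.
Qed.

End ae.

(** The integral starts from -oo, so that each increment of prim g is an
    integral of g and no base point has to be carried along. *)
HB.lock Definition prim (R : realType) (g : R -> R) (r : R) : R :=
  \int[@lebesgue_measure R]_(q in `]-oo, r]) g q.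

Section prim.
Context {R : realType}.
Local Notation leb := (@lebesgue_measure R).
Implicit Types (f g h : R -> R) (a b r : R).

Definition L1 g : Prop := leb.-integrable setT (EFin \o g).

Lemma L1_meas g : L1 g -> measurable_fun setT g.
Proof. by move/integrableP => [/measurable_EFinP]. Qed.

Lemma L1S g (D : set R) : measurable D -> L1 g -> leb.-integrable D (EFin \o g).
Proof. by move=> mD ig; apply: integrableS ig. Qed.

Lemma L1D f g : L1 f -> L1 g -> L1 (fun q => f q + g q).
Proof. by move=> If Ig; exact: (integrableD _ If Ig). Qed.

Lemma L1Z k g : L1 g -> L1 (fun q => k * g q).
Proof. by move=> Ig; exact: (integrableZl _ _ Ig). Qed.

Lemma L1B f g : L1 f -> L1 g -> L1 (fun q => f q - g q).
Proof. by move=> If Ig; exact: (integrableB _ If Ig). Qed.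

Lemma L1_dom f g : measurable_fun setT f -> L1 g ->
  (forall q, `|f q| <= g q) -> L1 f.
Proof.
move=> mf Ig fg; apply: le_integrable Ig => //; first exact/measurable_EFinP.
move=> q _ /=; rewrite lee_fin; apply: le_trans (fg q) _; exact: ler_norm.
Qed.

Lemma primB g a b : L1 g -> a <= b ->
  prim g b - prim g a = \int[leb]_(q in `]a, b]) g q.
Proof.
move=> Ig ab; rewrite prim.unlock Rintegral_itvB//.
exact: L1S Ig.
Qed.

Lemma prim_le g h a b : L1 g -> L1 h -> a <= b ->
  (forall q, a < q -> q <= b -> g q <= h q) ->
  prim g b - prim g a <= prim h b - prim h a.
Proof.
move=> Ig Ih ab gh; rewrite !primB//; apply: le_Rintegral => //; try exact: L1S.
by move=> q /=; rewrite in_itv/= => /andP[]; exact: gh.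
Qed.

Lemma primD f g a : L1 f -> L1 g ->
  prim (fun q => f q + g q) a = prim f a + prim g a.
Proof. by move=> If Ig; rewrite prim.unlock; apply: RintegralD => //; exact: L1S. Qed.

Lemma primDB f g a : L1 f -> L1 g ->
  prim (fun q => f q - g q) a = prim f a - prim g a.
Proof. by move=> If Ig; rewrite prim.unlock; apply: RintegralB => //; exact: L1S. Qed.

Lemma primZ k g a : L1 g -> prim (fun q => k * g q) a = k * prim g a.
Proof. by move=> Ig; rewrite prim.unlock; apply: RintegralZl => //; exact: L1S. Qed.

Lemma prim_norm_le g h a b : L1 g -> L1 h -> a <= b ->
  (forall q, a < q -> q <= b -> `|g q| <= h q) ->
  `|prim g b - prim g a| <= prim h b - prim h a.
Proof.
move=> Ig Ih ab gh; rewrite ler_norml; apply/andP; split.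
  rewrite lerNl.
  have := @prim_le (fun q => -1 * g q) h a b (L1Z _ Ig) Ih ab.
  rewrite !primZ// => H.
  suff : -1 * prim g b - -1 * prim g a <= prim h b - prim h a by lra.
  apply: H => q aq qb.
  by rewrite mulN1r (le_trans _ (gh q aq qb))// -normrN ler_norm.
by apply: prim_le => // q aq qb; rewrite (le_trans (ler_norm _))// gh.
Qed.

Lemma prim_nd h : L1 h -> (forall q, 0 <= h q) -> {homo prim h : a b / a <= b}.
Proof.
move=> Ih h0 a b ab; rewrite -subr_ge0 primB//; exact: Rintegral_ge0.
Qed.

(** Trajectories are followed forwards and backwards in time, so that the
    two ends come in either order. *)
Definition btw (a b q : R) := (a <= q <= b) || (b <= q <= a).

Lemma btwC a b q : btw a b q = btw b a q. Proof. by rewrite /btw orbC. Qed.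

Lemma btwE a b q : btw a b q = (Num.min a b <= q <= Num.max a b).
Proof.
by rewrite /btw; have [ab|ba] := leP a b; apply/idP/idP => [/orP[]/andP[h1 h2]|->];
  rewrite ?orbT//; apply/andP; split; lra.
Qed.

Lemma prim_norm_btw g h a b : L1 g -> L1 h -> (forall q, 0 <= h q) ->
  (forall q, btw a b q -> `|g q| <= h q) ->
  `|prim g b - prim g a| <= `|prim h b - prim h a|.
Proof.
move=> Ig Ih h0; wlog ab : a b / a <= b => [hw H|].
  have [ab|/ltW ba] := leP a b; first exact: hw.
  by rewrite distrC [leRHS]distrC; apply: hw => // q; rewrite btwC; exact: H.
move=> H; rewrite [leRHS]ger0_norm ?subr_ge0 ?prim_nd//.
by apply: prim_norm_le => // q aq qb; apply: H; rewrite /btw (ltW aq) qb.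
Qed.

Lemma prim_ae_eq f g a b : L1 f -> L1 g ->
  {ae leb, forall q, btw a b q -> f q = g q} ->
  prim f b - prim f a = prim g b - prim g a.
Proof.
move=> If Ig; wlog ab : a b / a <= b => [hw H|].
  have [ab|/ltW ba] := leP a b; first exact: hw.
  rewrite -opprB -[RHS]opprB; congr (- _); apply: hw => //.
  by apply: ae_impl H => q; rewrite btwC.
move=> H; rewrite !primB// /Rintegral; congr fine.
apply: ae_eq_integral => //.
- by apply: (measurable_int leb); exact: L1S.
- by apply: (measurable_int leb); exact: L1S.
- apply: (ae_impl _ H) => q {}H /=; rewrite in_itv/= => /andP[aq qb].
  by rewrite H// /btw (ltW aq) qb.
Qed.

Lemma prim_eq f g a b : L1 f -> L1 g ->
  (forall q, btw a b q -> f q = g q) ->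
  prim f b - prim f a = prim g b - prim g a.
Proof.
by move=> If Ig H; apply: prim_ae_eq => //; apply: ae_all.
Qed.

Lemma L1_uac g e : L1 g -> 0 < e -> exists2 delta : R, 0 < delta &
  forall A, measurable A -> (leb A < delta%:E)%E ->
    \int[leb]_(q in A) `|g q| < e.
Proof.
move=> Ig e0; have [dl [d0 H]] := integral_normr_continuous Ig e0.
by exists dl.
Qed.

Lemma prim_continuous g : L1 g -> continuous (prim g).
Proof.
move=> Ig x; apply/cvgrPdist_lt => e e0.
have [dl d0 H] := L1_uac Ig e0.
have key a b : a <= b -> b - a < dl -> `|prim g b - prim g a| < e.
  move=> ab bad; rewrite primB//; apply: le_lt_trans (H `]a, b]%classic _ _) => //.
    apply: le_normr_Rintegral => //; exact: L1S.
  by rewrite /= lebesgue_measure_itv/=; case: ifP => _; rewrite lte_fin.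
apply/nbhs_ballP; exists dl => //= y; rewrite /ball/= => xydl.
have [xy|/ltW yx] := leP x y.
  by rewrite distrC; apply: key => //; rewrite (le_lt_trans (ler_norm _))// distrC.
by apply: key => //; rewrite (le_lt_trans (ler_norm _)).
Qed.

Lemma prim_ae_is_derive g : L1 g ->
  {ae leb, forall x : R, is_derive x 1 (prim g) (g x)}.
Proof.
move=> Ig; rewrite prim.unlock; have := @FTC1Ny R g.
case=> //.
- move=> y; exact: L1S Ig.
- split; [by apply: L1_meas|exact: openT|move=> K _ cK].
  have mK : measurable K by apply: closed_measurable; exact: compact_closed.
  have /integrableP[_] := L1S mK Ig; exact: le_lt_trans.
- move=> N [mN N0 sN]; exists N; split => // x nx; apply: sN => /= -[dx gx].
  apply: nx; rewrite derive1E in gx; rewrite /mkset -gx; exact/derivableP.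
Qed.

Lemma prim_is_derive_continuous (g : R -> R) : L1 g -> continuous g ->
  forall x : R, is_derive x 1 (prim g) (g x).
Proof.
move=> Ig cg x; have xu : x < x + 1 by rewrite ltrDl.
have := @continuous_FTC1 R g -oo%O x (x + 1) xu (L1S (measurable_itv _) Ig) (ltNyr _) (cg x).
by rewrite prim.unlock derive1E => -[dd vd]; apply: DeriveDef.
Qed.

Lemma prim_antiderivative (g F : R -> R) x y : L1 g -> continuous g ->
  (forall t : R, is_derive t 1 F (g t)) -> x < y ->
  prim g y - prim g x = F y - F x.
Proof.
move=> Ig cg dF xy.
have cF : continuous F.
  by move=> t; apply: differentiable_continuous; apply/derivable1_diffP; have [] := dF t.
rewrite primB ?ltW// /Rintegral.
rewrite integral_itv_obnd_cbnd; last first.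
  by apply: measurable_int (L1S _ Ig); exact: measurable_itv.
rewrite (@continuous_FTC2 _ g F)//.
- exact: continuous_subspaceT.
- split; first by move=> t _; have [] := dF t.
    by apply: cvg_at_right_filter; exact: cF.
  by apply: cvg_at_left_filter; exact: cF.
- by move=> t _; rewrite derive1E; have [_ ->] := dF t.
Qed.

End prim.

(** * Absolutely continuous functions *)

Lemma Rintegral_EFin d (T : measurableType d) (R : realType)
    (mu : {measure set T -> \bar R}) (D : set T) (f : T -> R) :
  measurable D -> mu.-integrable D (EFin \o f) ->
  (\int[mu]_(x in D) f x)%:E = (\int[mu]_(x in D) (f x)%:E)%E.
Proof.
by move=> mD If; rewrite /Rintegral fineK//; exact: integrable_fin_num If.
Qed.

Lemma is_derive_local (R : realType) (W : normedModType R) (Z : R -> W) (c : R)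
    (l : W) (e : R) : is_derive c 1 Z l -> 0 < e ->
  exists2 eta : R, 0 < eta & forall y, `|y - c| < eta ->
    `|Z y - Z c - (y - c) *: l| <= e * `|y - c|.
Proof.
case=> dZ <- e0; move/cvgrPdist_le : (dZ) => /(_ e e0).
rewrite near_withinE => /nbhs_ballP[eta /= eta0 H]; exists eta => // y yc.
have [->|ync] := eqVneq y c; first by rewrite !subrr scale0r subr0 !normr0 mulr0.
have yc0 : y - c != 0 by rewrite subr_eq0.
have := H (y - c); rewrite /ball/= sub0r normrN => /(_ yc yc0).
rewrite [(y - c)%R *: 1]mulr1 subrK.
have yc1 : 0 < `|y - c| by rewrite normr_gt0.
rewrite -(ler_pM2l yc1) -normrZ scalerBr scalerA divff// scale1r.
by rewrite -normrN opprB (mulrC e).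
Qed.

Section absolute_continuity.
Context {R : realType}.
Local Notation leb := (@lebesgue_measure R).
Implicit Types (g h Z : R -> R) (a b : R).

Definition ac_on a b Z : Prop := forall e : R, 0 < e ->
  exists2 dl : R, 0 < dl & forall n (l r : 'I_n -> R),
    (forall i, [/\ a <= l i, l i <= r i & r i <= b]) ->
    (forall i j, i != j -> r i <= l j \/ r j <= l i) ->
    \sum_i (r i - l i) < dl -> \sum_i `|Z (r i) - Z (l i)| < e.

Lemma prim_uac h e : L1 h -> 0 < e ->
  exists2 dl : R, 0 < dl & forall n (l r : 'I_n -> R),
    (forall i, l i <= r i) ->
    (forall i j, i != j -> r i <= l j \/ r j <= l i) ->
    \sum_i (r i - l i) < dl -> \sum_i (prim h (r i) - prim h (l i)) < e.
Proof.
move=> Ih e0; have [dl d0 H] := L1_uac Ih e0.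
exists dl => // n l r lr dj sd.
pose F i := `]l i, r i]%classic : set (measurableTypeR R).
have mF i : measurable (F i) by exact: measurable_itv.
have tF : trivIset setT F.
  apply/trivIsetP => i j _ _ ij; apply/seteqP; split=> // x [].
  rewrite /F /= !in_itv/= => /andP[lx xr] /andP[lx' xr'].
  by have [h1|h1] := dj i j ij; lra.
pose D := \big[setU/set0]_(i <- index_enum 'I_n) F i.
have mD : measurable D by apply: bigsetU_measurable.
have IF i : leb.-integrable (F i) (EFin \o h) by exact: L1S (mF i) Ih.
have ID : leb.-integrable D (EFin \o h) by exact: L1S mD Ih.
have -> : \sum_i (prim h (r i) - prim h (l i)) = \int[leb]_(x in D) h x.
  apply: EFin_inj; rewrite Rintegral_EFin//.
  rewrite integral_bigsetU_EFin//; last 3 first.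
  - exact: index_enum_uniq.
  - by apply: sub_trivIset tF.
  - exact: measurable_int ID.
  rewrite -sumEFin; apply: eq_bigr => i _.
  by rewrite (primB Ih (lr i)) (Rintegral_EFin (mF i) (IF i)).
apply: le_lt_trans (H D mD _).
  by rewrite (le_trans (ler_norm _))//; apply: le_normr_Rintegral.
have -> : D = \big[setU/set0]_(i < n) F i by [].
rewrite measure_bigsetU_ord//.
rewrite (eq_bigr (fun i => (r i - l i)%:E)); last first.
  move=> i _; rewrite /F /= lebesgue_measure_itv/= lte_fin.
  by case: ltP => // h1; congr EFin; have := lr i; lra.
by rewrite sumEFin lte_fin.
Qed.

(** The supremum of the points that can be reached from a can be overtaken
    by the local hypothesis unless it is b. This compactness principle
    serves here in place of a covering theorem of Vitali type. *)
Lemma cousin (P : R -> R -> Prop) a b : a <= b ->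
  (forall x y z, x <= y -> y <= z -> P x y -> P y z -> P x z) ->
  (forall c, a <= c -> c <= b -> exists2 eta : R, 0 < eta &
     forall x y, c - eta < x -> x <= c -> c <= y -> y < c + eta ->
       a <= x -> y <= b -> P x y) ->
  P a b.
Proof.
move=> ab Ptr Ploc.
pose S := [set c | [/\ a <= c, c <= b & P a c]].
have Sa : S a.
  split=> //; have [eta e0 He] := Ploc a (lexx _) ab.
  by apply: He => //; lra.
have hS : has_sup S by split; [exists a|exists b => c []].
have aS : a <= sup S by apply: ub_le_sup => //; exact: hS.2.
have Sb : sup S <= b by apply: ge_sup; [exact: hS.1|move=> c []].
have [eta e0 He] := Ploc _ aS Sb.
have [c0 [ac0 c0b Pc0] c0S] := sup_adherent e0 hS.
have c0S' : c0 <= sup S by apply: ub_le_sup => //; exact: hS.2.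
pose y := Num.min b (sup S + eta / 2).
have yb : y <= b by rewrite ge_min lexx.
have Sy : sup S <= y by rewrite le_min Sb lerDl divr_ge0// ltW.
have Pay : P a y.
  apply: (Ptr a c0 y) => //; first exact: le_trans Sy.
  apply: He => //; rewrite /y gt_min; apply/orP; right; lra.
have Sy' : y <= sup S.
  by apply: ub_le_sup; [exact: hS.2|split=> //; exact: le_trans aS Sy].
move: Sy' Pay; rewrite /y; case: (leP b (sup S + eta / 2)) => //; lra.
Qed.

(** At a point where the derivative is 0, Z moves by at most e times the
    length on short intervals. The other points form a null set, contained
    in an open set O whose measure is below the delta of absolute
    continuity, so that Z moves by at most e in total over disjoint
    intervals inside O. Cousin's lemma chains intervals of the two kinds
    from a to b. *)
Lemma ac_zero_derive_constant Z a b : a <= b -> ac_on a b Z ->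
  {ae leb, forall r : R, a < r -> r < b -> is_derive r 1 Z 0} -> Z b = Z a.
Proof.
move=> ab acZ [N [mN N0 sN]].
suff H e : 0 < e -> `|Z b - Z a| <= e * (b - a) + e.
  apply/eqP; rewrite -subr_eq0 -normr_le0; apply/ler_addgt0Pr => e e0.
  have b0 : 0 < b - a + 1 by lra.
  have := H (e / (b - a + 1)) (divr_gt0 e0 b0); rewrite add0r.
  by congr (_ <= _); field; rewrite gt_eqF.
move=> e0; have [dl d0 acd] := acZ e e0.
(* the ends are put into the exceptional set because nothing is known of
   the derivative there *)
pose N1 := N `|` [set a; b].
have mN1 : measurable N1 by apply: measurableU => //; apply: measurableU.
have N10 : leb N1 = 0%E.
  have s0 x : leb [set x] = 0%E by exact: lebesgue_measure_set1.
  have s2 : leb [set a; b] = 0%E.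
    by rewrite measureU0//; exact: s0.
  have m2 : measurable ([set a; b] : set (measurableTypeR R)) by apply: measurableU.
  by rewrite /N1; apply: etrans N0; exact: measureU0.
have [|O [oO NO Od]] := lebesgue_regularity_outer mN1 _ d0.
  by change (leb N1 < +oo)%E; rewrite N10.
have mO : measurable O by exact: open_measurable.
have {}Od : (leb O < dl%:E)%E.
  have OE : (O `\` N1) `|` N1 = O by rewrite setUC setDUK.
  have -> : leb O = leb (O `\` N1); last by [].
  by rewrite -[in LHS]OE; apply: measureU0 => //; exact: measurableD.
(* s lists the intervals inside O that are used on the way from x to y *)
pose P x y := exists s : seq (R * R), [/\
  all (fun p => [&& x <= p.1, p.1 <= p.2 & p.2 <= y]) s,
  pairwise (fun p q : R * R => p.2 <= q.1) s,
  ((\sum_(p <- s) (p.2 - p.1))%:E <= leb (O `&` `]x, y]))%E &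
  `|Z y - Z x| <= e * (y - x) + \sum_(p <- s) `|Z p.2 - Z p.1|].
have Paddd x y z : x <= y -> y <= z -> P x y -> P y z -> P x z.
  move=> xy yz [s [sa sp sO sZ]] [t [ta tp tO tZ]]; exists (s ++ t); split.
  - rewrite all_cat; apply/andP; split.
      by apply: sub_all sa => p /and3P[h1 h2 h3]; apply/and3P; split=> //; lra.
    by apply: sub_all ta => p /and3P[h1 h2 h3]; apply/and3P; split=> //; lra.
  - rewrite pairwise_cat sp tp !andbT; apply/allrelP => p q ps qt.
    move/allP : sa => /(_ _ ps)/and3P[_ _ h1].
    by move/allP : ta => /(_ _ qt)/and3P[h2 _ _]; exact: le_trans h2.
  - rewrite big_cat/= EFinD (@itv_bndbnd_setU _ _ (BRight x) (BRight y) (BRight z))//.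
    rewrite setIUr measureU//; last 3 first.
    + exact: measurableI.
    + exact: measurableI.
    + apply/seteqP; split=> // u [[_ /=] + [_ /=]].
      by rewrite !in_itv/= => /andP[h1 h2] /andP[h3 h4]; lra.
    exact: leeD.
  - rewrite big_cat/=.
    have -> : Z z - Z x = (Z y - Z x) + (Z z - Z y) by ring.
    apply: le_trans (ler_normD _ _) _; apply: le_trans (lerD sZ tZ) _.
    by rewrite le_eqVlt; apply/orP; left; apply/eqP; ring.
have Pgood x y : x <= y -> `|Z y - Z x| <= e * (y - x) -> P x y.
  by move=> xy H; exists [::]; split=> //; rewrite big_nil ?addr0// measure_ge0.
have Pbad x y : x <= y -> `]x, y] `<=` O -> P x y.
  move=> xy sO; exists [:: (x, y)]; split=> //=.
  - by rewrite !lexx xy.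
  - rewrite big_seq1/= setIidr// lebesgue_measure_itv/= lte_fin.
    by case: ltP => // h1; rewrite lee_fin; lra.
  - by rewrite big_seq1 lerDr mulr_ge0 ?(ltW e0) ?subr_ge0.
have : P a b.
  apply: cousin => // c ac cb.
  have [cN|cN] := pselect (N1 c).
    have : nbhs c O by apply: open_nbhs_nbhs; split=> //; exact: NO.
    move=> /nbhs_ballP[eta /= eta0 sO]; exists eta => // x y cx xc cy yc _ _.
    apply: Pbad; first exact: le_trans cy.
    move=> z /=; rewrite in_itv/= => /andP[xz zy]; apply: sO.
    by rewrite /ball/= ltr_norml; apply/andP; split; lra.
  have [ac' cb'] : a < c /\ c < b.
    split; rewrite lt_neqAle ?ac ?cb andbT; apply/eqP => E; apply: cN; right.
      by left.
    by right.
  have Dc : is_derive c 1 Z 0.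
    have nN : ~ N c by move=> h; apply: cN; left.
    by have := contra_not (sN c) nN => /= /contrapT; apply.
  have [eta eta0 Hc] := is_derive_local Dc e0.
  exists eta => // x y cx xc cy yc _ _; apply: Pgood; first exact: le_trans cy.
  have Hx : `|Z x - Z c| <= e * (c - x).
    have /Hc : `|x - c| < eta by rewrite ltr_norml; apply/andP; split; lra.
    by rewrite scaler0 subr0 (ler0_norm (_ : x - c <= 0)) ?opprB//; lra.
  have Hy : `|Z y - Z c| <= e * (y - c).
    have /Hc : `|y - c| < eta by rewrite ltr_norml; apply/andP; split; lra.
    by rewrite scaler0 subr0 (ger0_norm (_ : 0 <= y - c))//; lra.
  have -> : Z y - Z x = (Z y - Z c) - (Z x - Z c) by ring.
  apply: le_trans (ler_normB _ _) _; apply: le_trans (lerD Hy Hx) _; lra.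
move=> [s [sa sp sO sZ]]; apply: (le_trans sZ); rewrite lerD2l.
pose dp : R * R := (a, a).
rewrite (big_nth dp) big_mkord; apply/ltW.
apply: (acd _ (fun i => (nth dp s i).1) (fun i => (nth dp s i).2)).
- by move=> i; move/allP : sa => /(_ _ (mem_nth dp (ltn_ord i)))/and3P[].
- move=> i j; rewrite neq_ltn => /orP[ij|ji]; [left|right].
    by move/(pairwiseP dp) : sp; apply; rewrite ?inE.
  by move/(pairwiseP dp) : sp; apply; rewrite ?inE.
- have -> : \sum_(i < size s) ((nth dp s i).2 - (nth dp s i).1) =
    \sum_(p <- s) (p.2 - p.1) by rewrite (big_nth dp) big_mkord.
  rewrite -lte_fin; apply: (le_lt_trans sO); apply: le_lt_trans Od.
  by apply: le_measure; rewrite ?inE//; exact: measurableI.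
Qed.
End absolute_continuity.

(** * Primitives of vector-valued functions *)

Section rowvec.
Context {R : realType} {d : nat}.
Local Notation V := 'rV[R]_d.

Lemma rV_norm_le (x : V) (c : R) : 0 <= c -> (forall i, `|x 0 i| <= c) -> `|x| <= c.
Proof.
move=> c0 H; rewrite [leLHS]/Num.norm /= mx_normrE; apply/bigmax_leP; split=> //.
by move=> [i j] _ /=; rewrite ord1; exact: H.
Qed.

Lemma rV_coord_le (x : V) i : `|x 0 i| <= `|x|.
Proof.
rewrite [leRHS]/Num.norm /= mx_normrE.
by apply/bigmax_geP; right; exists (ord0, i).
Qed.

Lemma continuous_measurable_rV (f : V -> R) : continuous f -> measurable_fun setT f.
Proof.
move=> cf; apply: (measurability (@RGenOInfty.G R)) => //.
  exact: RGenOInfty.measurableE.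
move=> _ [_ [x ->] <-]; rewrite setTI; apply: sub_sigma_algebra.
by apply: open_comp => // *; exact: cf.
Qed.

Lemma measurable_coord i : measurable_fun setT (fun x : V => x 0 i).
Proof. by apply: continuous_measurable_rV; exact: coord_continuous. Qed.

Lemma continuous_measurable_to_rV (X : R -> V) : continuous X ->
  measurable_fun setT X.
Proof.
move=> cX; apply: (measurability (@open V)) => //.
move=> _ [U oU <-]; rewrite setTI; apply: open_measurable.
by apply: open_comp => // *; exact: cX.
Qed.

Lemma continuous_measurable_rV_rV (X : V -> V) : continuous X ->
  measurable_fun setT X.
Proof.
move=> cX; apply: (measurability (@open V)) => //.
move=> _ [U oU <-]; rewrite setTI; apply: sub_sigma_algebra.
by apply: open_comp => // *; exact: cX.
Qed.

Definition vL1 (g : R -> V) := forall i, L1 (fun q => g q 0 i).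
Definition vprim (g : R -> V) (r : R) : V := \row_i prim (fun q => g q 0 i) r.

Lemma vprim_norm (g : R -> V) (h : R -> R) a b : vL1 g -> L1 h ->
  (forall q, 0 <= h q) -> (forall q, btw a b q -> `|g q| <= h q) ->
  `|vprim g b - vprim g a| <= `|prim h b - prim h a|.
Proof.
move=> Ig Ih h0 gh; apply: rV_norm_le => // i; rewrite !mxE.
by apply: prim_norm_btw => // q abq; apply: le_trans (gh q abq); exact: rV_coord_le.
Qed.

Lemma vprimB (g h : R -> V) r : vL1 g -> vL1 h ->
  vprim (fun q => g q - h q) r = vprim g r - vprim h r.
Proof.
move=> Ig Ih; apply/rowP => i; rewrite !mxE -primDB//.
by congr prim; apply/funext => q; rewrite !mxE.
Qed.

Lemma vprim_eq (g h : R -> V) a b : vL1 g -> vL1 h ->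
  (forall q, btw a b q -> g q = h q) ->
  vprim g b - vprim g a = vprim h b - vprim h a.
Proof.
move=> Ig Ih gh; apply/rowP => i; rewrite !mxE; apply: prim_eq => // q abq.
by rewrite gh.
Qed.

Lemma vL1_dom (g : R -> V) (h : R -> R) : measurable_fun setT g -> L1 h ->
  (forall q, `|g q| <= h q) -> vL1 g.
Proof.
move=> mg Ih gh i; apply: (L1_dom _ Ih).
  exact: (measurableT_comp (measurable_coord i) mg).
by move=> q; apply: le_trans (gh q); exact: rV_coord_le.
Qed.

Lemma vL1B (g h : R -> V) : vL1 g -> vL1 h -> vL1 (fun q => g q - h q).
Proof.
move=> Ig Ih i; have := L1B (Ig i) (Ih i); rewrite /L1; congr (_.-integrable _ _).
by apply/funext => q /=; rewrite !mxE.
Qed.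

(** The rate is kept along with the limit: it shows that the limit of the
    Picard iterates solves the integral equation. *)
Lemma geometric_cauchy_scalar (u : nat -> R) (C : R) :
  (forall n, `|u n.+1 - u n| <= C * 2^-1 ^+ n) ->
  exists l, forall n, `|u n - l| <= 2 * C * 2^-1 ^+ n.
Proof.
move=> H.
have C0 : 0 <= C.
  by have := H 0%N; rewrite expr0 mulr1; apply: le_trans; exact: normr_ge0.
have D n k : `|u (n + k)%N - u n| <= 2 * C * 2^-1 ^+ n * (1 - 2^-1 ^+ k).
  elim: k => [|k IH]; first by rewrite addn0 !subrr normr0 mulr0.
  have -> : u (n + k.+1)%N - u n = (u (n + k).+1 - u (n + k)%N) + (u (n + k)%N - u n).
    by rewrite addnS addrA subrK.
  apply: le_trans (ler_normD _ _) _; apply: le_trans (lerD (H _) IH) _.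
  by rewrite exprD exprS le_eqVlt; apply/orP; left; apply/eqP; field.
have D' n k : `|u (n + k)%N - u n| <= 2 * C * 2^-1 ^+ n.
  apply: le_trans (D n k) _; rewrite ler_piMr ?mulr_ge0 ?exprn_ge0//.
have cs : cvgn (series (fun n => u n.+1 - u n)).
  apply: (@normed_cvg R R^o); apply: (@series_le_cvg _ _ (geometric C 2^-1)) => //.
  - by move=> n /=; exact: normr_ge0.
  - by move=> n; rewrite /geometric/= mulr_ge0// exprn_ge0.
  - by apply: is_cvg_geometric_series; rewrite ger0_norm ?invf_lt1 ?ltr1n ?invr_ge0.
have uE : u = (fun n => u 0%N + series (fun n => u n.+1 - u n) n).
  apply/funext => n; rewrite seriesEnat/= telescope_sumr//.
  by rewrite addrC subrK.
have cu : cvgn u.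
  rewrite uE; apply: is_cvgD; [exact: is_cvg_cst|exact: cs].
have /cvg_ex[l ul] := cu.
exists l => n.
have cvn : `|u n - u (n + k)%N| @[k --> \oo] --> `|u n - l|.
  apply: cvg_norm; apply: cvgB; first exact: cvg_cst.
  have ul' : u (x + n)%N @[x --> \oo] --> (l : R).
    by rewrite (cvg_shiftn n u (nbhs (l : R))).
  by under eq_fun do rewrite addnC.
rewrite -(cvg_lim _ cvn)//; apply: limr_le; first by apply/cvg_ex; eexists; exact: cvn.
by apply: nearW => k; rewrite distrC.
Qed.

Lemma geometric_cauchy (u : nat -> V) (C : R) :
  (forall n, `|u n.+1 - u n| <= C * 2^-1 ^+ n) ->
  exists l, forall n, `|u n - l| <= 2 * C * 2^-1 ^+ n.
Proof.
move=> H.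
have C0 : 0 <= C.
  by have := H 0%N; rewrite expr0 mulr1; apply: le_trans; exact: normr_ge0.
have Hi i : exists l : R, forall n, `|u n 0 i - l| <= 2 * C * 2^-1 ^+ n.
  apply: geometric_cauchy_scalar => n; apply: le_trans (H n).
  by have := rV_coord_le (u n.+1 - u n) i; rewrite !mxE.
have [l Hl] := choice Hi.
exists (\row_i l i) => n; apply: rV_norm_le; first by rewrite !mulr_ge0 ?exprn_ge0.
by move=> i; rewrite !mxE.
Qed.
End rowvec.

(** * The exponential weight *)

(** The weight of Bielecki's norm, in which the Picard map is a contraction
    on the whole line at once. *)
HB.lock Definition weight (R : realType) (L : R -> R) (s r : R) : R :=
  expR (2 * `|prim L r - prim L s|).

Section weight.
Context {R : realType}.
Variable L : R -> R.
Hypotheses (IL : L1 L) (L0 : forall q, 0 <= L q).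
Local Notation m := (prim L).

Local Notation weight := (weight L).

Lemma weightE s r : weight s r = expR (2 * `|m r - m s|).
Proof. by rewrite weight.unlock. Qed.

Lemma weight_ge1 s r : 1 <= weight s r.
Proof. by rewrite weightE -expR0 ler_expR mulr_ge0. Qed.

Lemma weight_ge0 s r : 0 <= weight s r.
Proof. by rewrite weightE expR_ge0. Qed.

Lemma prim_le_mass a b : `|m b - m a| <= \int[@lebesgue_measure R]_q L q.
Proof.
wlog ab : a b / a <= b => [hw|].
  by have [|/ltW] := leP a b; [exact: hw|rewrite distrC; exact: hw].
rewrite ger0_norm ?subr_ge0 ?prim_nd// primB//.
rewrite Rintegral_mkcond; apply: le_Rintegral => //.
- have := @integrable_mkcond _ _ _ (@lebesgue_measure R) `]a, b]%classic (EFin \o L) (measurable_itv _).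
  by move=> H; have := H.1 (L1S (measurable_itv `]a, b]) IL); rewrite restrict_EFin.
- by move=> x _; rewrite /patch; case: ifP.
Qed.

Lemma continuous_weight s : continuous (weight s).
Proof.
rewrite weight.unlock => r; apply: continuous_comp; last exact: continuous_expR.
apply: cvgM; first exact: cvg_cst.
apply: cvg_norm; apply: cvgB; [exact: prim_continuous|exact: cvg_cst].
Qed.

Lemma measurable_weight s : measurable_fun setT (weight s).
Proof. by apply: continuous_measurable_fun; exact: continuous_weight. Qed.

Lemma L1_weighted s : L1 (fun q => L q * weight s q).
Proof.
pose M := \int[@lebesgue_measure R]_q L q.
apply: (@L1_dom _ _ (fun q => expR (2 * M) * L q)).
- by apply: measurable_funM; [exact: L1_meas|exact: measurable_weight].
- exact: L1Z.
- move=> q; rewrite ger0_norm ?mulr_ge0 ?weight_ge0// mulrC ler_wpM2r//.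
  by rewrite weightE ler_expR ler_pM2l// prim_le_mass.
Qed.

(** Since the primitive of L is only absolutely continuous, the chain rule
    is replaced by an inequality up to quadratic errors on short intervals. *)
Lemma prim_comparison (phi Phi : R -> R) (K a b : R) : a <= b -> 0 <= K ->
  L1 (fun q => L q * phi q) ->
  (forall x y, a <= x -> x <= y -> y <= b -> exists2 C,
     (forall q, x <= q -> q <= y -> phi q <= C) &
     C * (m y - m x) <= Phi y - Phi x + K * (m y - m x) ^+ 2) ->
  prim (fun q => L q * phi q) b - prim (fun q => L q * phi q) a <= Phi b - Phi a.
Proof.
move=> ab K0 I1 H.
have := @sum_quadratic_errors R m (fun q => prim (fun q => L q * phi q) q - Phi q)
  a b K 0 ab (prim_continuous IL) (prim_nd IL L0) K0.
rewrite mul0r => H1; have {H1} : prim (fun q => L q * phi q) b - Phi b -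
    (prim (fun q => L q * phi q) a - Phi a) <= 0.
  apply: H1 => x y ax xy yb; have [C C1 C2] := H x y ax xy yb.
  have h1 : prim (fun q => L q * phi q) y - prim (fun q => L q * phi q) x
      <= C * (m y - m x).
    rewrite mulrBr -!primZ//; apply: prim_le => //; first exact: L1Z.
    by move=> q xq qy; rewrite mulrC ler_wpM2r// C1// ltW.
  move: h1 C2; rewrite mul0r addr0; move: (_ ^+ 2) => D.
  by clear; move: (prim _ x) (prim _ y) => p p'; lra.
by clear; move: (prim _ a) (prim _ b) => p p'; lra.
Qed.

(** On an interval over which the primitive of L grows by u, the weight goes
    from C exp(-2u) at one end to C at the other. *)
Lemma exp_convexity (C u : R) : 0 <= C -> 0 <= u ->
  C * u <= (C - C * expR (- (2 * u))) / 2 + 2 * C * u ^+ 2.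
Proof.
move=> C0 u0; have := expR_ge1Dx (- (2 * u)); have := expR_ge1Dx (2 * u).
have := expRxMexpNx_1 (2 * u); have := expR_ge0 (- (2 * u)).
move: (expR (2 * u)) (expR (- (2 * u))) => a b b0 ab a1 b1.
have ub : (1 + 2 * u) * b <= 1 by rewrite -[leRHS]ab ler_wpM2r.
have h : u <= (1 - b) / 2 + 2 * u ^+ 2 by nra.
have := ler_wpM2l C0 h; clear; nra.
Qed.

(** Differentiation of exp(2m) formally gives 2 L exp(2m), whence the factor
    one half that makes the Picard map a contraction. *)
Lemma prim_weighted s r :
  `|prim (fun q => L q * weight s q) r - prim (fun q => L q * weight s q) s|
  <= weight s r / 2.
Proof.
have nd := prim_nd IL L0.
have h0 q : 0 <= L q * weight s q by rewrite mulr_ge0 ?weight_ge0.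
have Ih := L1_weighted s; have ndh := prim_nd Ih h0.
have w0 := weight_ge0 s s; have wr0 := weight_ge0 s r.
have K0 : 0 <= 2 * weight s r by rewrite mulr_ge0.
have [sr|/ltW rs] := leP s r.
  rewrite ger0_norm ?subr_ge0 ?ndh//.
  have E q : s <= q -> weight s q = expR (2 * (m q - m s)).
    by move=> sq; rewrite weightE ger0_norm// subr_ge0 nd.
  have wnd x y : s <= x -> x <= y -> weight s x <= weight s y.
    move=> sx xy; rewrite (E x sx) (E y (le_trans sx xy)) ler_expR ler_pM2l//.
    by rewrite lerB// nd.
  apply: (@le_trans _ _ (weight s r / 2 - weight s s / 2)); last first.
    by rewrite gerBl divr_ge0.
  apply: (@prim_comparison (weight s) (fun q => weight s q / 2) (2 * weight s r)) => //.
  move=> x y sx xy yr; have sy := le_trans sx xy.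
  exists (weight s y).
    by move=> q xq qy; apply: wnd => //; exact: le_trans xq.
  have u0 : 0 <= m y - m x by rewrite subr_ge0 nd.
  apply: le_trans (exp_convexity (weight_ge0 s y) u0) _.
  have -> : weight s y * expR (- (2 * (m y - m x))) = weight s x.
    by rewrite (E x sx) (E y sy) -expRD; congr expR; ring.
  rewrite mulrBl lerD2l ler_wpM2r ?sqr_ge0// ler_pM2l//.
  exact: wnd.
rewrite ler0_norm ?subr_le0 ?ndh// opprB.
have E q : q <= s -> weight s q = expR (2 * (m s - m q)).
  by move=> qs; rewrite weightE distrC ger0_norm// subr_ge0 nd.
have wnd x y : y <= s -> x <= y -> weight s y <= weight s x.
  move=> ys xy; rewrite (E x (le_trans xy ys)) (E y ys) ler_expR ler_pM2l//.
  by rewrite lerB// nd.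
apply: (@le_trans _ _ (- (weight s s / 2) - - (weight s r / 2))); last first.
  by rewrite opprK addrC gerBl divr_ge0.
apply: (@prim_comparison (weight s) (fun q => - (weight s q / 2)) (2 * weight s r)) => //.
move=> x y rx xy ys; have xs := le_trans xy ys.
exists (weight s x).
  by move=> q xq qy; apply: wnd => //; exact: le_trans ys.
have u0 : 0 <= m y - m x by rewrite subr_ge0 nd.
apply: le_trans (exp_convexity (weight_ge0 s x) u0) _.
have -> : weight s x * expR (- (2 * (m y - m x))) = weight s y.
  by rewrite (E x xs) (E y ys) -expRD; congr expR; ring.
rewrite opprK (addrC (- _)) mulrBl lerD2l ler_wpM2r ?sqr_ge0// ler_pM2l//.
exact: wnd.
Qed.

(** Gronwall's lemma. The integral inequality u <= A + |\int_s^r L u| enters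
    only through its halving effect on bounds by the weight, and iterating
    that effect wears down every excess over 2 A. *)
Lemma halving_bound (u : R -> R) (J : R -> Prop) s (A B : R) : 0 <= A -> 0 <= B ->
  (forall q, J q -> u q <= B) ->
  (forall K, 0 <= K -> (forall q, J q -> u q <= K * weight s q) ->
     forall r, J r -> u r <= A + K / 2 * weight s r) ->
  forall r, J r -> u r <= 2 * A * weight s r.
Proof.
move=> A0 B0 uB H.
have step n : forall r, J r -> u r <= (2 * A + B * 2^-1 ^+ n) * weight s r.
  elim: n => [|n IH] r Jr.
    rewrite expr0 mulr1 (le_trans (uB _ Jr))// -[leLHS]mulr1.
    by rewrite ler_pM// ?lerDr ?mulr_ge0// weight_ge1.
  apply: (le_trans (H _ _ IH _ Jr)); first by rewrite addr_ge0 ?mulr_ge0 ?exprn_ge0.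
  have Aw : A <= A * weight s r by rewrite ler_peMr// weight_ge1.
  rewrite exprS; move: (weight s r) (2^-1 ^+ n) Aw => w p; nra.
move=> r Jr; apply/ler_addgt0Pr => e e0.
have w0 := weight_ge1 s r; have w1 := weight_ge0 s r.
have [n Hn] : exists n, B * weight s r * 2^-1 ^+ n <= e.
  have : B * weight s r * 2^-1 ^+ n @[n --> \oo] --> B * weight s r * 0.
    by apply: cvgMr; apply: cvg_expr; rewrite ger0_norm ?invr_ge0 ?invf_lt1 ?ltr1n.
  rewrite mulr0 => /cvgrPdist_le/(_ _ e0)[n _ /(_ n (leqnn _))] Hn; exists n.
  by move: Hn; rewrite sub0r normrN; apply: le_trans; exact: ler_norm.
apply: (le_trans (step n r Jr)); rewrite mulrDl lerD2l; apply: le_trans Hn.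
by rewrite mulrAC.
Qed.
End weight.

(** * The global flow of a bounded Lipschitz field *)

Lemma subrACA (V : zmodType) (a b c e : V) : (a - b) - (c - e) = (a - c) - (b - e).
Proof. by rewrite !opprB addrACA [RHS]addrACA [- b - c]addrC. Qed.

Section ode_def.
Context {R : realType} {d : nat}.
Local Notation V := 'rV[R]_d.

Definition solves_on (f : R -> V -> V) (s : R) (x : V) (J : R -> Prop) (X : R -> V) :=
  forall r, J r -> X r = x + (vprim (fun q => f q (X q)) r - vprim (fun q => f q (X q)) s).

Definition mlip (L : R -> R) (X : R -> V) :=
  forall r r', `|X r - X r'| <= `|prim L r - prim L r'|.

(** Continuity excludes curves along which f fails to be integrable, where
    the integral would be a default value; the solution is then unique, so
    that the choice is immaterial. *)
Definition gflow (f : R -> V -> V) (s r : R) (x : V) : V :=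
  xget (cst x) [set X | continuous X /\ solves_on f s x (fun=> True) X] r.

End ode_def.

Section ode.
Context {R : realType} {d : nat}.
Local Notation V := 'rV[R]_d.
Variables (L : R -> R) (f : R -> V -> V).
Hypotheses (IL : L1 L).
Hypothesis mf : measurable_fun setT (fun p : R * V => f p.1 p.2).
Hypothesis fb : forall r x, `|f r x| <= L r.
Hypothesis fl : forall r x y, `|f r x - f r y| <= L r * `|x - y|.
Local Notation m := (prim L).
Local Notation mass := (\int[@lebesgue_measure R]_q L q).

Lemma rate_ge0 q : 0 <= L q.
Proof. exact: le_trans (fb q 0). Qed.

Lemma measurable_along (X : R -> V) : measurable_fun setT X ->
  measurable_fun setT (fun q => f q (X q)).
Proof.
move=> mX.
exact: (measurableT_comp mf (measurable_fun_pair (@measurable_id _ _ setT) mX)).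
Qed.

Lemma vL1_along (X : R -> V) : measurable_fun setT X -> vL1 (fun q => f q (X q)).
Proof. by move=> mX; apply: (vL1_dom (measurable_along mX) IL). Qed.

Lemma mlip_continuous (X : R -> V) : mlip L X -> continuous X.
Proof.
move=> HX r; apply/cvgrPdist_le => e e0.
have := prim_continuous IL; move=> /(_ r)/cvgrPdist_le/(_ e e0).
by apply: filterS => q; apply: le_trans; exact: HX.
Qed.

Lemma mlip_measurable (X : R -> V) : mlip L X -> measurable_fun setT X.
Proof. by move=> /mlip_continuous; exact: continuous_measurable_to_rV. Qed.

Lemma vprim_mlip (X : R -> V) r r' : measurable_fun setT X ->
  `|vprim (fun q => f q (X q)) r - vprim (fun q => f q (X q)) r'| <= `|m r - m r'|.
Proof.
by move=> mX; apply: vprim_norm => //; [exact: vL1_along|exact: rate_ge0].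
Qed.

Lemma vprim_contract (X Y : R -> V) K s r : measurable_fun setT X ->
  measurable_fun setT Y -> 0 <= K ->
  (forall q, btw s r q -> `|X q - Y q| <= K * weight L s q) ->
  `|(vprim (fun q => f q (X q)) r - vprim (fun q => f q (X q)) s) -
    (vprim (fun q => f q (Y q)) r - vprim (fun q => f q (Y q)) s)|
  <= K / 2 * weight L s r.
Proof.
move=> mX mY K0 H.
have IX := vL1_along mX; have IY := vL1_along mY.
rewrite subrACA.
rewrite -!vprimB//.
apply: le_trans (vprim_norm (vL1B IX IY) (L1Z K (L1_weighted IL rate_ge0 s)) _ _) _.
- by move=> q; rewrite !mulr_ge0 ?rate_ge0 ?weight_ge0.
- move=> q sq; apply: le_trans (fl _ _ _) _; rewrite mulrCA.
  by rewrite ler_wpM2l ?rate_ge0// H.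
- rewrite !primZ; try exact: L1_weighted IL rate_ge0 s.
  rewrite -mulrBr normrM ger0_norm// -mulrA ler_wpM2l//.
  by rewrite (mulrC 2^-1) prim_weighted//; exact: rate_ge0.
Qed.

(** Gronwall's lemma, which yields both uniqueness and Lipschitz dependence
    on the initial point. *)
Lemma ode_stability (X Y : R -> V) x y s a b : measurable_fun setT X ->
  measurable_fun setT Y -> a <= s -> s <= b ->
  solves_on f s x (fun r => a <= r <= b) X ->
  solves_on f s y (fun r => a <= r <= b) Y ->
  forall r, a <= r <= b -> `|X r - Y r| <= 2 * `|x - y| * weight L s r.
Proof.
move=> mX mY sa sb hX hY.
have XY r : a <= r <= b -> `|X r - Y r| <= `|x - y| +
   `|(vprim (fun q => f q (X q)) r - vprim (fun q => f q (X q)) s) -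
    (vprim (fun q => f q (Y q)) r - vprim (fun q => f q (Y q)) s)|.
  move=> rab; rewrite (hX _ rab) (hY _ rab) opprD addrACA; exact: ler_normD.
apply: (@halving_bound R L (fun r => `|X r - Y r|) (fun r => a <= r <= b) s
  `|x - y| (`|x - y| + (mass + mass))) => //.
- rewrite addr_ge0//; have := prim_le_mass IL rate_ge0 0 0.
  by rewrite subrr normr0 => ?; rewrite addr_ge0.
- move=> r rab; apply: le_trans (XY r rab) _; rewrite lerD2l.
  apply: le_trans (ler_normB _ _) _; apply: lerD.
    by apply: le_trans (vprim_mlip _ _ mX) _; exact: prim_le_mass IL rate_ge0 _ _.
  by apply: le_trans (vprim_mlip _ _ mY) _; exact: prim_le_mass IL rate_ge0 _ _.
- move=> K K0 HK r rab; apply: le_trans (XY r rab) _; rewrite lerD2l.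
  apply: vprim_contract => // q sq; apply: HK.
  by move: rab sq; rewrite /btw => /andP[h1 h2] /orP[]/andP[h3 h4]; apply/andP; split; lra.
Qed.

(** By vprim_contract successive Picard iterates from the constant curve
    approach each other by a factor one half in the weighted norm, hence
    converge geometrically at each time. *)
Lemma picard_existence s x : exists X, mlip L X /\ solves_on f s x (fun=> True) X.
Proof.
pose T (X : R -> V) r := x + (vprim (fun q => f q (X q)) r - vprim (fun q => f q (X q)) s).
pose u n := iter n T (cst x).
have TL X : measurable_fun setT X -> mlip L (T X).
  move=> mX r r'; rewrite /T opprD addrACA subrr add0r opprB addrA subrK.
  exact: vprim_mlip.
have uL n : mlip L (u n).
  elim: n => [|n IH]; first by move=> r r'; rewrite /u/= subrr normr0.
  by apply: TL; exact: mlip_measurable.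
have um n := mlip_measurable (uL n).
have ub n r : `|u n.+1 r - u n r| <= weight L s r * 2^-1 ^+ n.
  elim: n r => [|n IH] r.
    rewrite expr0 mulr1 /u /= /T [x + _]addrC addrK.
    apply: le_trans (vprim_mlip _ _ _) _; first exact: (um 0%N).
    rewrite weightE//; apply: le_trans (expR_ge1Dx _).
    by move: (`|_|) (normr_ge0 (m r - m s)) => a a0; lra.
  have -> : u n.+2 r - u n.+1 r = T (u n.+1) r - T (u n) r by [].
  rewrite /T opprD addrACA subrr add0r.
  apply: le_trans (vprim_contract (K := 2^-1 ^+ n) (um _) (um _) _ _) _.
  - exact: exprn_ge0.
  - by move=> q _; rewrite mulrC.
  - by rewrite exprS le_eqVlt; apply/orP; left; apply/eqP; field.
have Hl r : exists l, forall n, `|u n r - l| <= 2 * weight L s r * 2^-1 ^+ n.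
  exact: geometric_cauchy.
have [X HX] := choice Hl.
have small (C D : R) : (forall n, C <= D * 2^-1 ^+ n) -> C <= 0.
  move=> H; apply/ler_addgt0Pr => e e0; rewrite add0r.
  have : D * 2^-1 ^+ n @[n --> \oo] --> D * 0.
    by apply: cvgMr; apply: cvg_expr; rewrite ger0_norm ?invr_ge0 ?invf_lt1 ?ltr1n.
  rewrite mulr0 => /cvgrPdist_le/(_ _ e0)[n _ /(_ n (leqnn _))] Hn.
  apply: le_trans (H n) _; move: Hn; rewrite sub0r normrN; apply: le_trans.
  exact: ler_norm.
have XL : mlip L X.
  move=> r r'; rewrite -subr_le0.
  apply: (small _ (2 * weight L s r + 2 * weight L s r')) => n.
  have -> : X r - X r' = - (u n r - X r) + (u n r' - X r') + (u n r - u n r').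
    by apply/rowP => i; rewrite !mxE; ring.
  rewrite lerBlDr; apply: le_trans (ler_normD _ _) _; apply: lerD (uL n r r').
  apply: le_trans (ler_normD _ _) _; rewrite normrN mulrDl; exact: lerD.
exists X; split=> // r _; apply/eqP; rewrite -subr_eq0 -normr_le0.
have Xm := mlip_measurable XL.
apply: (small _ (2 * weight L s r)) => n.
have h1 := HX r n.+1.
have h2 : `|u n.+1 r - T X r| <= 2 * 2^-1 ^+ n / 2 * weight L s r.
  rewrite [u n.+1 r]/(T (u n) r) /T opprD addrACA subrr add0r.
  apply: vprim_contract => //.
  by move=> q _; apply: le_trans (HX q n) _; rewrite mulrAC.
have -> : X r - T X r = - (u n.+1 r - X r) + (u n.+1 r - T X r).
  by rewrite opprB addrA subrK.
apply: le_trans (ler_normD _ _) _; rewrite normrN; apply: le_trans (lerD h1 h2) _.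
by rewrite exprS le_eqVlt; apply/orP; left; apply/eqP; field.
Qed.

Local Notation Phi := (gflow f).
Lemma gflow_spec s x : continuous (fun r => Phi s r x) /\
  solves_on f s x (fun=> True) (fun r => Phi s r x).
Proof.
have [X [cX HX]] := picard_existence s x; move/mlip_continuous in cX.
exact: (xgetPex (cst x) (ex_intro
  [set X | continuous X /\ solves_on f s x (fun=> True) X] X (conj cX HX))).
Qed.

Lemma gflow_mlip s x : mlip L (fun r => Phi s r x).
Proof.
have [cP HP] := gflow_spec s x; move=> r r'; rewrite (HP r I) (HP r' I).
rewrite opprD addrACA subrr add0r opprB addrA subrK.
by apply: vprim_mlip; exact: continuous_measurable_to_rV.
Qed.

Lemma gflow_eq s r x : Phi s r x = x + (vprim (fun q => f q (Phi s q x)) r -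
  vprim (fun q => f q (Phi s q x)) s).
Proof. exact: (gflow_spec s x).2. Qed.

Lemma gflow_measurable s x : measurable_fun setT (fun r => Phi s r x).
Proof. by apply: mlip_measurable; exact: gflow_mlip. Qed.

Lemma gflow_refl s x : Phi s s x = x.
Proof. by rewrite gflow_eq subrr addr0. Qed.

Lemma gflow_unique s x a b X : measurable_fun setT X -> a <= s -> s <= b ->
  solves_on f s x (fun r => a <= r <= b) X ->
  forall r, a <= r <= b -> X r = Phi s r x.
Proof.
move=> mX sa sb hX r rab.
have hP : solves_on f s x (fun r => a <= r <= b) (fun r => Phi s r x).
  by move=> q _; exact: gflow_eq.
have := ode_stability mX (gflow_measurable s x) sa sb hX hP rab.
by rewrite subrr normr0 mulr0 mul0r normr_le0 subr_eq0 => /eqP.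
Qed.

Lemma gflow_trans s r t x : Phi r t (Phi s r x) = Phi s t x.
Proof.
have [a [b [ar at_ rb tb]]] : exists a b, [/\ a <= r, a <= t, r <= b & t <= b].
  exists (Num.min r t), (Num.max r t); rewrite !ge_min !le_max !lexx !orbT.
  by split.
apply/esym; apply: (@gflow_unique r (Phi s r x) a b (fun t => Phi s t x)) => //.
- exact: gflow_measurable.
- move=> q _; rewrite {1}gflow_eq (gflow_eq s r x) -addrA; congr (_ + _).
  by rewrite [RHS]addrC addrA subrK.
- by rewrite at_ tb.
Qed.

Lemma gflowK s t x : Phi t s (Phi s t x) = x.
Proof. by rewrite gflow_trans gflow_refl. Qed.

Definition flow_lip : R := 2 * expR (2 * mass).

Lemma mass_ge0 : 0 <= mass.
Proof. by have := prim_le_mass IL rate_ge0 0 0; rewrite subrr normr0. Qed.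

Lemma flow_lip_ge0 : 0 <= flow_lip.
Proof. by rewrite mulr_ge0 ?expR_ge0. Qed.

Lemma gflow_lip s r x y : `|Phi s r x - Phi s r y| <= flow_lip * `|x - y|.
Proof.
have [a [b [ar at_ rb tb]]] : exists a b, [/\ a <= s, a <= r, s <= b & r <= b].
  exists (Num.min s r), (Num.max s r); rewrite !ge_min !le_max !lexx !orbT.
  by split.
have hP z : solves_on f s z (fun r => a <= r <= b) (fun r => Phi s r z).
  by move=> q _; exact: gflow_eq.
apply: le_trans (ode_stability (gflow_measurable s x) (gflow_measurable s y) ar rb
  (hP x) (hP y) (_ : a <= r <= b)) _; first by rewrite at_.
rewrite /flow_lip mulrAC ler_wpM2r// ler_pM2l// weightE ler_expR ler_pM2l//.
exact: prim_le_mass IL rate_ge0 _ _.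
Qed.

Lemma gflow_dist s r x : `|Phi s r x - x| <= `|m r - m s|.
Proof. by have := gflow_mlip s x r s; rewrite gflow_refl. Qed.

(** In time m r - m s, points at distance delta are displaced by vectors
    that differ by a multiple of delta (m r - m s) only: this is why
    averaging in space almost commutes with the flow. *)
Lemma gflow_displacement s r x y :
  `|(Phi s r x - x) - (Phi s r y - y)| <= flow_lip * `|x - y| * `|m r - m s|.
Proof.
have E z : Phi s r z - z = vprim (fun q => f q (Phi s q z)) r -
  vprim (fun q => f q (Phi s q z)) s.
  by rewrite {1}gflow_eq [_ + (_ - _)]addrC addrK.
have Iz z := vL1_along (gflow_measurable s z).
rewrite (E x) (E y) subrACA.
rewrite -!vprimB//.
have K0 : 0 <= flow_lip * `|x - y| by rewrite mulr_ge0 ?flow_lip_ge0.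
apply: le_trans (vprim_norm (vL1B (Iz x) (Iz y)) (L1Z (flow_lip * `|x - y|) IL) _ _) _.
- by move=> q; rewrite mulr_ge0 ?rate_ge0.
- move=> q _; apply: le_trans (fl _ _ _) _; rewrite mulrC ler_wpM2r ?rate_ge0//.
  exact: gflow_lip.
- by rewrite !primZ// -mulrBr normrM ger0_norm.
Qed.

End ode.

(** * Integrable rates for the field *)

Section completed.
Context {R : realType}.
Local Notation leb := (@lebesgue_measure R).
Local Notation cleb := (@completed_lebesgue_measure R).
Local Notation RM := (measurableTypeR R).

(** Lebesgue measure is the image of its completion under the identity, seen
    as a measurable map from the completed sigma-algebra to the Borel one. *)
Lemma ge0_integral_completed (D : set RM) (f : R -> \bar R) :
  measurable D -> measurable_fun D f -> (forall x, D x -> (0 <= f x)%E) ->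
  (\int[leb]_(x in D) f x = \int[cleb]_(x in D) f x)%E.
Proof.
move=> mD mf f0.
pose T1 := caratheodory_type (mu_ext (wlength (idfun : R -> R))).
have mid : measurable_fun setT (idfun : T1 -> RM).
  by move=> _ A mA; rewrite setTI; apply: sub_caratheodory.
have := @ge0_integral_pushforward _ _ T1 RM R idfun mid cleb D f mD mf.
rewrite preimage_id => <-.
  by apply: eq_measure_integral.
by move=> x; rewrite inE; exact: f0.
Qed.

Lemma completed_negligible (P : R -> Prop) : {ae cleb, forall x, P x} ->
  {ae leb, forall x, P x}.
Proof.
move=> [N [mN N0 PN]].
have := mN; rewrite -[_ N]/(_.-cara.-measurable N).
rewrite -completed_caratheodory_measurable g_sigma_completed_algebra_genE.
move=> [A mA [M [B [mB B0 MB]] AMN]].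
exists (A `|` B); split; first exact: measurableU.
- have A0 : leb A = 0%E.
    apply/eqP; rewrite eq_le measure_ge0 andbT -N0 -AMN.
    by apply: le_outer_measure; exact: subsetUl.
  by rewrite measureU0.
- move=> x /PN; rewrite -AMN => -[Ax|Mx]; [by left|by right; exact: MB].
Qed.

Lemma measurable_along_cst d (W : measurableType d) d' (V : measurableType d') (D : set R)
   (f : R -> V -> W) (x : V) : 
   measurable_fun (D `*` [set: V]) (fun p : R * V => f p.1 p.2) ->
   measurable D ->
   measurable_fun D (fun r => f r x).
Proof.
move=> mf mD.
apply: (@measurable_comp _ _ _ _ _ _ (D `*` [set: V]) (fun p : R * V => f p.1 p.2) _ (fun r => (r, x))) => //.
- exact: measurableX.
- by move=> _ [r Dr <-].
- by apply: measurable_funTS; apply: measurable_fun_pair => //; exact: measurable_cst.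
Qed.
End completed.

Section clamp.
Context {R : realType} {d : nat}.
Local Notation V := 'rV[R]_d.

Definition clamp (k t : R) : R := Num.max (- k) (Num.min t k).

Lemma clamp_id k t : `|t| <= k -> clamp k t = t.
Proof. by rewrite ler_norml => /andP[h1 h2]; rewrite /clamp min_l// max_r. Qed.

Lemma clamp_le k t : 0 <= k -> `|clamp k t| <= k.
Proof.
move=> k0; rewrite ler_norml /clamp le_max lexx/= ge_max; apply/andP; split; first lra.
by rewrite ge_min lexx orbT.
Qed.

Lemma clamp_contract k s t : `|clamp k s - clamp k t| <= `|s - t|.
Proof.
have H a b : a <= b -> 0 <= clamp k b - clamp k a <= b - a.
  move=> ab; rewrite /clamp.
  apply/andP; split; rewrite /Order.max /Order.min;
  by case: (ltP a k) => ?; case: (ltP b k) => ?; case: ltP => ?; case: ltP => ?; lra.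
have [st|/ltW ts] := leP s t.
  rewrite distrC [leRHS]distrC; have /andP[h1 h2] := H _ _ st.
  by rewrite !ger0_norm// subr_ge0.
by have /andP[h1 h2] := H _ _ ts; rewrite !ger0_norm// subr_ge0.
Qed.

(** For the maximum norm, clamping each coordinate is a 1-Lipschitz
    retraction onto the ball of radius k. *)
Definition clampV (k : R) (x : V) : V := \row_i clamp k (x 0 i).

Lemma clampV_id k x : `|x| <= k -> clampV k x = x.
Proof.
move=> xk; apply/rowP => i; rewrite mxE clamp_id//.
by apply: le_trans xk; exact: rV_coord_le.
Qed.

Lemma clampV_le k x : 0 <= k -> `|clampV k x| <= k.
Proof. by move=> k0; apply: rV_norm_le => // i; rewrite mxE clamp_le. Qed.

Lemma clampV_contract k x y : `|clampV k x - clampV k y| <= `|x - y|.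
Proof.
apply: rV_norm_le => // i; rewrite !mxE; apply: le_trans (clamp_contract _ _ _) _.
by have := rV_coord_le (x - y) i; rewrite !mxE.
Qed.

Lemma lipschitz_continuous (W W' : normedModType R) (g : W -> W') (K : R) :
  (forall x y, `|g x - g y| <= K * `|x - y|) -> continuous g.
Proof.
move=> H x; apply/cvgrPdist_le => e e0.
have K1 : 0 < `|K| + 1 by rewrite ltr_wpDl.
have e1 : 0 < e / (`|K| + 1) by rewrite divr_gt0.
apply/nbhs_ballP; exists (e / (`|K| + 1)) => //= y.
rewrite -ball_normE /ball_/= => /ltW xy; apply: le_trans (H _ _) _.
apply: (@le_trans _ _ ((`|K| + 1) * `|x - y|)).
  by rewrite ler_wpM2r// (le_trans (ler_norm _))// lerDl.
by move: xy; rewrite ler_pdivlMr// mulrC.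
Qed.

Lemma clampV_continuous k : continuous (clampV k).
Proof. by apply: (@lipschitz_continuous _ _ _ 1) => x y; rewrite mul1r clampV_contract. Qed.

Definition rat_point (j : nat) : V :=
  if unpickle j is Some q then map_mx ratr (q : 'rV[rat]_d) else 0.

Lemma rat_point_dense (x : V) e : 0 < e -> exists j, `|x - rat_point j| < e.
Proof.
move=> e0; have Hi i : exists q : rat, x 0 i - e / 2 < ratr q < x 0 i + e / 2.
  have [|q] := @rat_in_itvoo R (x 0 i - e / 2) (x 0 i + e / 2); first lra.
  by rewrite in_itv/= => H; exists q.
have [q Hq] := choice Hi.
exists (pickle (\row_i q i)); rewrite /rat_point pickleK.
apply: (@le_lt_trans _ _ (e / 2)); last lra.
apply: rV_norm_le => [|i]; first by rewrite divr_ge0// ltW.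
by rewrite !mxE ler_norml; have /andP[] := Hq i => h1 h2; apply/andP; split; lra.
Qed.

Lemma enorm_ge_norm (x : V) : `|x| <= enorm x.
Proof.
apply: rV_norm_le; first exact: sqrtr_ge0.
move=> i; rewrite -sqrtr_sqr /enorm ler_wsqrtr// (bigD1 i)//= lerDl.
by apply: sumr_ge0 => j _; exact: sqr_ge0.
Qed.

Lemma enorm_le_norm (x : V) : enorm x <= d%:R * `|x|.
Proof.
have h : 0 <= d%:R * `|x| by rewrite mulr_ge0.
rewrite -(ger0_norm h) -sqrtr_sqr /enorm ler_wsqrtr//.
apply: (@le_trans _ _ (\sum_(i < d) `|x| ^+ 2)).
  apply: ler_sum => i _; rewrite -real_normK ?num_real// ler_sqr ?nnegrE//.
  exact: rV_coord_le.
rewrite sumr_const card_ord -[leLHS]mulr_natl exprMn ler_wpM2r ?sqr_ge0//.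
by rewrite -natrX ler_nat; case: (d) => // n; rewrite -mulnn leq_pmulr.
Qed.
End clamp.

Lemma measurable_norm_diff {R : realType} {d : nat} d' (T : measurableType d')
    (D : set T) (f g : T -> 'rV[R]_d) :
  measurable_fun D f -> measurable_fun D g -> measurable_fun D (fun t => `|f t - g t|).
Proof.
move=> mf mg.
have mc i j : measurable_fun D (fun t => `|(f t - g t) i j|).
  rewrite ord1; apply: measurableT_comp (@normr_measurable R setT) _.
  rewrite (_ : (fun _ => _) = (fun t => f t 0 j - g t 0 j)); last first.
    by apply/funext => t; rewrite !mxE.
  apply: measurable_funB.
  - exact: measurableT_comp (measurable_coord j) mf.
  - exact: measurableT_comp (measurable_coord j) mg.
rewrite (_ : (fun _ => _) = (fun t => \big[Num.max/0]_ij `|(f t - g t) ij.1 ij.2|)); last first.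
  by apply/funext => t; rewrite [LHS]/Num.norm/= mx_normrE.
elim: (index_enum _) => [|ij s IH].
  by under eq_fun do rewrite big_nil; exact: measurable_cst.
by under eq_fun do rewrite big_cons; apply: measurable_maxr.
Qed.

(** The Lipschitz constant C serves only to pass from the dense sequence to
    B, so that it may be arbitrarily bad. *)
Lemma lipschitz_dense_bounds {R : realType} (V W : normedModType R) (B : V -> Prop)
    (q : nat -> V) (g : V -> W) (C F L : R) : 0 <= C -> 0 <= L ->
  (forall j, B (q j)) ->
  (forall x e, B x -> 0 < e -> exists j, `|x - q j| < e) ->
  (forall x y, B x -> B y -> `|g x - g y| <= C * `|x - y|) ->
  (forall j, `|g (q j)| <= F) ->
  (forall i j, `|g (q i) - g (q j)| <= L * `|q i - q j|) ->
  (forall x, B x -> `|g x| <= F) /\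
  (forall x y, B x -> B y -> `|g x - g y| <= L * `|x - y|).
Proof.
move=> C0 L0 Bq dq gC gF gL.
have ap x e : B x -> 0 < e -> exists j, `|x - q j| <= e /\ `|g x - g (q j)| <= e.
  move=> Bx e0; have C1 : 0 < C + 1 by lra.
  have [j Hj] := dq x _ Bx (divr_gt0 e0 C1); exists j.
  have h1 : (C + 1) * `|x - q j| <= e by rewrite mulrC -ler_pdivlMr// ltW.
  have h2 := gC _ _ Bx (Bq j); have h3 := normr_ge0 (x - q j).
  move: h1; rewrite mulrDl mul1r => h1; split.
    by apply: le_trans h1; rewrite lerDr mulr_ge0.
  by apply: (le_trans h2); apply: le_trans h1; rewrite lerDl.
split=> [x Bx|x y Bx By].
  apply/ler_addgt0Pr => e e0; have [j [_ h]] := ap x e Bx e0.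
  have -> : g x = g (q j) + (g x - g (q j)) by rewrite addrC subrK.
  by apply: le_trans (ler_normD _ _) _; exact: lerD.
apply/ler_addgt0Pr => e e0.
have L1 : 0 < 2 + 2 * L by lra.
have e1 := divr_gt0 e0 L1.
have [i [xi gi]] := ap x _ Bx e1; have [j [yj gj]] := ap y _ By e1.
have -> : g x - g y = (g x - g (q i)) + (g (q i) - g (q j)) + - (g y - g (q j)).
  by rewrite opprB !addrA !subrK.
have qij : `|q i - q j| <= `|x - y| + (e / (2 + 2 * L) + e / (2 + 2 * L)).
  have -> : q i - q j = - (x - q i) + (x - y) + (y - q j).
    by rewrite opprB !addrA !subrK.
  apply: le_trans (ler_normD _ _) _; apply: le_trans (lerD (ler_normD _ _) yj) _.
  by rewrite normrN; move: xi; move: (`|x - q i|) (`|x - y|) (_ / _) => a b c; clear; lra.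
have h := ler_wpM2l L0 qij.
apply: le_trans (ler_normD _ _) _; rewrite normrN.
apply: le_trans (lerD (ler_normD _ _) gj) _.
have h2 := gL i j.
have Ee : e = 2 * (e / (2 + 2 * L)) + L * (e / (2 + 2 * L) + e / (2 + 2 * L)).
  by field; rewrite gt_eqF//; lra.
rewrite {2}Ee; move: h h2 gi; rewrite mulrDr; move: (_ / _) => e2.
move: (L * (e2 + e2)) (L * `|x - y|) (L * _) (`|g x - _|) (`|g (q i) - _|).
by clear; move=> *; lra.
Qed.

Section rate.
Context {R : realType} {d : nat}.
Local Notation V := 'rV[R]_d.
Local Notation leb := (@lebesgue_measure R).
Local Notation RM := (measurableTypeR R).
Variables (T : R) (v : R -> V -> V) (w : R -> V -> R).
Hypothesis hd : (1 <= d)%N.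
Hypothesis hv : measurable_fun (`[0, T] `*` [set: V]) (fun p : R * V => v p.1 p.2).
Hypothesis hw : measurable_fun (`[0, T] `*` [set: V]) (fun p : R * V => w p.1 p.2).
Hypothesis hloc : forall B : set V, compact (closure B) ->
  (@completed_lebesgue_measure R).-integrable `[0, T]
    (fun t => sup_on (@enorm R d) (v t) B + Lip (@enorm R d) (v t) B
              + sup_on Num.norm (w t) B + Lip Num.norm (w t) B)%E.

Lemma dR_gt0 : 0 < d%:R :> R.
Proof. by rewrite ltr0n. Qed.

Lemma sup_on_ge0 (U W : Type) (N : W -> R) (g : U -> W) B : (0 <= sup_on N g B)%E.
Proof. by apply: ereal_sup_ubound; left. Qed.

Lemma sup_on_ge (U W : Type) (N : W -> R) (g : U -> W) B x : B x ->
  ((N (g x))%:E <= sup_on N g B)%E.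
Proof. by move=> Bx; apply: ereal_sup_ubound; right; exists x. Qed.

Lemma Lip_ge0 (W : zmodType) (N : W -> R) (g : V -> W) B : (0 <= Lip N g B)%E.
Proof. by apply: ereal_sup_ubound; left. Qed.

Lemma Lip_ge (W : zmodType) (N : W -> R) (g : V -> W) B x y : B x -> B y ->
  (forall z, 0 <= N z) ->
  ((N (g x - g y) / (d%:R * `|x - y|))%:E <= Lip N g B)%E.
Proof.
move=> Bx By N0; have [->|xy] := eqVneq x y.
  by rewrite [y - y]subrr normr0 mulr0 invr0 mulr0 Lip_ge0.
apply: (@le_trans _ _ (N (g x - g y) / enorm (x - y))%:E); last first.
  by apply: ereal_sup_ubound; right; exists x, y.
have xy0 : 0 < `|x - y| by rewrite normr_gt0 subr_eq0.
rewrite lee_fin ler_wpM2l// lef_pV2 ?posrE ?mulr_gt0 ?dR_gt0 ?enorm_le_norm//.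
by apply: lt_le_trans xy0 _; exact: enorm_ge_norm.
Qed.

Let box n : set V := [set x | `|x| <= n%:R].

Lemma box_compact n : compact (closure (box n)).
Proof.
have cb : closed (box n).
  have -> : box n = (fun x : V => `|x|) @^-1` [set r | r <= n%:R] by [].
  apply: closed_comp; last exact: closed_le.
  by move=> x _; exact: norm_continuous.
rewrite closure_id// in cb *; rewrite -cb.
apply: bounded_closed_compact; last by rewrite closure_id.
by exists n%:R; split; [exact: num_real|move=> M nM x /= xn; rewrite (le_trans xn)// ltW].
Qed.

(** The suprema over the ball range over an uncountable set, and their sum
    is measurable only for the completed sigma-algebra. The supremum of the
    same quotients over a countable dense set of points is Borel measurable
    in t and lies below that sum; by lipschitz_dense_bounds it still
    controls the field whenever the sum is finite, that is for almost every
    t. The factor d compares the Euclidean norm with the maximum norm. *)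
Lemma rate_exists n : exists Lam : R -> R,
  [/\ L1 Lam, forall t, 0 <= Lam t &
   {ae leb, forall t, 0 <= t <= T ->
    [/\ forall x, `|x| <= n%:R -> `|v t x| <= Lam t,
        forall x, `|x| <= n%:R -> `|w t x| <= Lam t,
        forall x y, `|x| <= n%:R -> `|y| <= n%:R -> `|v t x - v t y| <= Lam t * `|x - y| &
        forall x y, `|x| <= n%:R -> `|y| <= n%:R -> `|w t x - w t y| <= Lam t * `|x - y|]}].
Proof.
pose ell t := (sup_on (@enorm R d) (v t) (box n) + Lip (@enorm R d) (v t) (box n)
              + sup_on Num.norm (w t) (box n) + Lip Num.norm (w t) (box n))%E.
have Iell := hloc (@box_compact n).
pose q j := clampV n%:R (rat_point j : V).
have qb j : box n (q j) by rewrite /box/=; apply: clampV_le.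
have qd x e : box n x -> 0 < e -> exists j, `|x - q j| < e.
  move=> xb e0; have [j Hj] := rat_point_dense x e0; exists j.
  by apply: le_lt_trans Hj; rewrite -{1}(clampV_id xb); exact: clampV_contract.
pose ij (k : nat) : nat * nat := odflt (0%N, 0%N) (unpickle k).
have ijK i j : ij (pickle (i, j)) = (i, j) by rewrite /ij pickleK.
pose a k t := `|v t (q (ij k).1)|
   + `|v t (q (ij k).1) - v t (q (ij k).2)| / (d%:R * `|q (ij k).1 - q (ij k).2|)
   + `|w t (q (ij k).1)|
   + `|w t (q (ij k).1) - w t (q (ij k).2)| / (d%:R * `|q (ij k).1 - q (ij k).2|).
have a0 k t : 0 <= a k t by rewrite !addr_ge0// divr_ge0// mulr_ge0.
have aell k t : ((a k t)%:E <= ell t)%E.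
  rewrite /a !EFinD /ell; do ![apply: leeD].
  - apply: (le_trans _ (sup_on_ge (@enorm R d) (v t) (qb (ij k).1))).
    by rewrite lee_fin; exact: enorm_ge_norm.
  - have N0 : forall z : V, 0 <= enorm z by move=> z; exact: sqrtr_ge0.
    apply: (le_trans _ (Lip_ge (v t) (qb (ij k).1) (qb (ij k).2) N0)).
    by rewrite lee_fin ler_wpM2r ?invr_ge0 ?mulr_ge0//; exact: enorm_ge_norm.
  - exact: (sup_on_ge Num.norm (w t) (qb (ij k).1)).
  - exact: (Lip_ge (w t) (qb (ij k).1) (qb (ij k).2) (@normr_ge0 _ _)).
pose Lb t := esups (fun k => (a k t)%:E) 0.
have aLb k t : ((a k t)%:E <= Lb t)%E by apply: ereal_sup_ubound; exists k.
have Lb0 t : (0 <= Lb t)%E by apply: le_trans (aLb 0%N t); rewrite lee_fin.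
have Lbell t : (Lb t <= ell t)%E.
  by apply: ge_ereal_sup => _ [k _ <-].
have mvx x : measurable_fun (`[0, T] : set RM) (fun t => v t x).
  exact: (@measurable_along_cst R _ _ _ _ _ v x hv (measurable_itv _)).
have mwx x : measurable_fun (`[0, T] : set RM) (fun t => w t x).
  exact: (@measurable_along_cst R _ _ _ _ _ w x hw (measurable_itv _)).
have mnorm : measurable_fun setT (fun x : V => `|x|).
  by apply: continuous_measurable_rV; exact: norm_continuous.
have mvb x y : measurable_fun (`[0, T] : set RM) (fun t => `|v t x - v t y|).
  exact: measurable_norm_diff.
have mLb : measurable_fun (`[0, T] : set RM) Lb.
  apply: measurable_fun_esups => k; apply/measurable_EFinP.
  apply: measurable_funD; first apply: measurable_funD; first apply: measurable_funD.
  - exact: measurableT_comp mnorm (mvx _).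
  - apply: measurable_funM; last exact: measurable_cst.
    exact: mvb.
  - exact: measurableT_comp (@normr_measurable R setT) (mwx _).
  - apply: measurable_funM; last exact: measurable_cst.
    apply: measurableT_comp (@normr_measurable R setT) _.
    exact: measurable_funB.
have ILb : (\int[leb]_(t in `[0%R, T]) Lb t < +oo)%E.
  rewrite ge0_integral_completed//.
  have /integrableP[mell] := Iell; apply: le_lt_trans.
  have mD : (mu_ext (wlength (idfun : R -> R))).-cara.-measurable (`[0, T]%classic : set R).
    by apply: sub_caratheodory; exact: (measurable_itv `[0, T] : measurable (_ : set RM)).
  have mabs := measurableT_comp (@abse_measurable R setT) mell.
  apply: (@ge0_le_integral _ _ _ (@completed_lebesgue_measure R) _ mD Lb _ _ _ mabs).
  - by move=> t _; exact: Lb0.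
  - move=> _ A mA; apply: sub_caratheodory.
    exact: (mLb (measurable_itv _) A mA).
  - by move=> t _; apply: le_trans (Lbell t) _; exact: lee_abs.
pose Lam t := if t \in (`[0, T]%classic : set R) then d%:R * fine (Lb t) else 0.
have Lb_int : leb.-integrable `[0, T] Lb.
  apply/integrableP; split=> //.
  by under eq_integral do rewrite gee0_abs//.
have Lam0 t : 0 <= Lam t.
  by rewrite /Lam; case: ifP => // _; rewrite mulr_ge0// fine_ge0.
exists Lam; split=> //.
- have LamE : EFin \o Lam = (fun t => d%:R%:E * (EFin \o (fine \o Lb)) t)%E \_ `[0, T]%classic.
    by apply/funext => t; rewrite /patch /Lam/=; case: ifP.
  rewrite /L1 LamE; apply: (@integrable_mkcond _ _ _ leb `[0, T]%classic _ (measurable_itv _)).1.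
  apply: integrableZl => //.
  apply: le_integrable Lb_int => //.
    by apply/measurable_EFinP; apply: measurableT_comp => //; exact: measurable_fine.
  move=> t _ /=; rewrite (ger0_norm (fine_ge0 (Lb0 t))).
  by case: (Lb t) (Lb0 t) => //= r _; rewrite lee_fin ler_norm.
- have mD : (mu_ext (wlength (idfun : R -> R))).-cara.-measurable (`[0, T]%classic : set R).
    by apply: sub_caratheodory; exact: (measurable_itv `[0, T] : measurable (_ : set RM)).
  have := @integrable_ae _ _ _ (@completed_lebesgue_measure R) _ mD _ Iell.
  move=> /completed_negligible; apply: ae_impl => t ellfin tT.
  have {}ellfin : ell t \is a fin_num by apply: ellfin; rewrite /= in_itv.
  have Lbfin : Lb t \is a fin_num.
    by rewrite ge0_fin_numE//; apply: le_lt_trans (Lbell t) _; rewrite -ge0_fin_numE// (le_trans (Lb0 t)).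
  have LamE : Lam t = d%:R * fine (Lb t) by rewrite /Lam mem_set//= in_itv.
  have LF : fine (Lb t) <= Lam t.
    by rewrite LamE ler_peMl ?fine_ge0// ler1n.
  have aL k : a k t <= fine (Lb t) by rewrite -lee_fin fineK.
  have Lfin : Lip (@enorm R d) (v t) (box n) \is a fin_num /\
      Lip Num.norm (w t) (box n) \is a fin_num.
    have : (ell t < +oo)%E by rewrite -ge0_fin_numE// (le_trans (Lb0 t)).
    rewrite /ell => h; split; rewrite ge0_fin_numE ?Lip_ge0//.
      apply: le_lt_trans h; rewrite -addeA.
      apply: (le_trans (leeDr _ (sup_on_ge0 (@enorm R d) (v t) (box n)))).
      by apply: leeDl; apply: adde_ge0; [exact: sup_on_ge0|exact: Lip_ge0].
    by apply: le_lt_trans h; apply: leeDr; rewrite !adde_ge0 ?sup_on_ge0 ?Lip_ge0.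
  have LipC (W : normedModType R) (N : W -> R) (g : V -> W) x y :
      Lip N g (box n) \is a fin_num -> (forall z, `|z| <= N z) -> box n x -> box n y ->
      `|g x - g y| <= d%:R * fine (Lip N g (box n)) * `|x - y|.
    move=> fL NN xb yb; have [->|xy] := eqVneq x y; first by rewrite !subrr !normr0 mulr0.
    have xy0 : 0 < d%:R * `|x - y| by rewrite mulr_gt0 ?dR_gt0// normr_gt0 subr_eq0.
    have N0 z : 0 <= N z by apply: le_trans (NN z).
    have := Lip_ge g xb yb N0; rewrite -(fineK fL) lee_fin ler_pdivrMr//.
    by move=> h; apply: le_trans (NN _) _; rewrite -mulrA mulrCA.
  have rat_lip (W : normedModType R) (g : V -> W) i j :
      `|g (q i) - g (q j)| / (d%:R * `|q i - q j|) <= fine (Lb t) ->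
      `|g (q i) - g (q j)| <= Lam t * `|q i - q j|.
    have [->|qij] := eqVneq (q i) (q j); first by move=> _; rewrite !subrr !normr0 mulr0.
    have qij0 : 0 < d%:R * `|q i - q j| by rewrite mulr_gt0 ?dR_gt0// normr_gt0 subr_eq0.
    by rewrite ler_pdivrMr// LamE mulrCA mulrA.
  have four (a1 b c e F : R) : 0 <= e -> 0 <= b -> 0 <= c -> 0 <= a1 ->
      a1 + b + c + e <= F -> [/\ a1 <= F, b <= F, c <= F & e <= F].
    by clear => *; split; lra.
  have parts i j : [/\ `|v t (q i)| <= fine (Lb t),
      `|v t (q i) - v t (q j)| / (d%:R * `|q i - q j|) <= fine (Lb t),
      `|w t (q i)| <= fine (Lb t) &
      `|w t (q i) - w t (q j)| / (d%:R * `|q i - q j|) <= fine (Lb t)].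
    have := aL (pickle (i, j)); rewrite /a ijK/=.
    have := normr_ge0 (v t (q i)); have := normr_ge0 (w t (q i)).
    have D0 : 0 <= d%:R * `|q i - q j| by rewrite mulr_ge0.
    have := divr_ge0 (normr_ge0 (v t (q i) - v t (q j))) D0.
    have := divr_ge0 (normr_ge0 (w t (q i) - w t (q j))) D0.
    move=> h1 h2 h3 h4; exact: four.
  have C0 (W : zmodType) (N : W -> R) (g : V -> W) :
      0 <= d%:R * fine (Lip N g (box n)) by rewrite mulr_ge0// fine_ge0// Lip_ge0.
  have [v1 v2] := @lipschitz_dense_bounds R V V (box n) q (v t)
    (d%:R * fine (Lip (@enorm R d) (v t) (box n))) (Lam t) (Lam t) (C0 _ _ _) (Lam0 t) qb qd
    (fun x y => LipC V (@enorm R d) (v t) x y Lfin.1 (@enorm_ge_norm R d))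
    (fun j => le_trans (let: And4 h _ _ _ := parts j j in h) LF)
    (fun i j => rat_lip V (v t) i j (let: And4 _ h _ _ := parts i j in h)).
  have [w1 w2] := @lipschitz_dense_bounds R V R^o (box n) q (w t)
    (d%:R * fine (Lip Num.norm (w t) (box n))) (Lam t) (Lam t) (C0 _ _ _) (Lam0 t) qb qd
    (fun x y => LipC R^o Num.norm (w t) x y Lfin.2 (fun z => lexx _))
    (fun j => le_trans (let: And4 _ _ h _ := parts j j in h) LF)
    (fun i j => rat_lip R^o (w t) i j (let: And4 _ _ _ h := parts i j in h)).
  by split.
Qed.
End rate.

Section local_field.
Context {R : realType} {d : nat}.
Local Notation V := 'rV[R]_d.
Local Notation leb := (@lebesgue_measure R).
Local Notation RM := (measurableTypeR R).

(** A version of the field whose bounds hold at every time, for the maximum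
    norm, with a single integrable rate L n for all bounds on the ball of
    radius n. *)
Record local_field (v : R -> V -> V) (w : R -> V -> R) (L : nat -> R -> R) : Prop := {
  lf_mv : measurable_fun setT (fun p : R * V => v p.1 p.2);
  lf_mw : measurable_fun setT (fun p : R * V => w p.1 p.2);
  lf_L1 : forall n, L1 (L n);
  lf_v : forall n t x, `|x| <= n%:R -> `|v t x| <= L n t;
  lf_w : forall n t x, `|x| <= n%:R -> `|w t x| <= L n t;
  lf_vl : forall n t x y, `|x| <= n%:R -> `|y| <= n%:R ->
    `|v t x - v t y| <= L n t * `|x - y|;
  lf_wl : forall n t x y, `|x| <= n%:R -> `|y| <= n%:R ->
    `|w t x - w t y| <= L n t * `|x - y| }.

Lemma ae_countable (P : nat -> R -> Prop) : (forall n, {ae leb, forall t, P n t}) ->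
  exists2 N : set RM, measurable N /\ leb N = 0%E & forall t, ~ N t -> forall n, P n t.
Proof.
move=> H; have [F HF] := choice H.
exists (\bigcup_n F n).
  split; first by apply: bigcupT_measurable => n; have [] := HF n.
  apply/negligibleP; first by apply: bigcupT_measurable => n; have [] := HF n.
  apply: negligible_bigcup => n; have [mF F0 _] := HF n.
  by exists (F n); split.
move=> t nt n; have [_ _ sF] := HF n; apply: contrapT => nP.
by apply: nt; exists n => //; apply: sF.
Qed.

Lemma measurable_fun_restrict_time d' (W : measurableType d') (D G : set R)
    (f : R -> V -> W) (c : W) : measurable G -> G `<=` D -> measurable D ->
  measurable_fun (D `*` [set: V]) (fun p : R * V => f p.1 p.2) ->
  measurable_fun setT (fun p : R * V => if p.1 \in G then f p.1 p.2 else c).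
Proof.
move=> mG GD mD mf.
have mG' : measurable_fun setT (fun p : R * V => p.1 \in G).
  apply: (measurable_fun_bool true).
  rewrite setTI (_ : _ @^-1` _ = G `*` [set: V]); first exact: measurableX.
  apply/seteqP; split => [[a b] /= /set_mem h|[a b] [h _]]; first by split.
  exact: mem_set.
apply: measurable_fun_if => //.
rewrite setTI; apply: measurable_funS mf; first exact: measurableX.
by move=> [a b] /= /set_mem Ga; split=> //; exact: GD.
Qed.

(** The field is replaced by 0 outside of the time interval and at the times
    where one of the bounds fails. Those times in the interval form a null
    set, hence are seen neither by integrals in time nor by absolutely
    continuous solutions. *)
Lemma local_field_exists (T : R) (v : R -> V -> V) (w : R -> V -> R) :
  (1 <= d)%N ->
  measurable_fun (`[0, T] `*` [set: V]) (fun p : R * V => v p.1 p.2) ->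
  measurable_fun (`[0, T] `*` [set: V]) (fun p : R * V => w p.1 p.2) ->
  (forall B : set V, compact (closure B) ->
    (@completed_lebesgue_measure R).-integrable `[0, T]
      (fun t => sup_on (@enorm R d) (v t) B + Lip (@enorm R d) (v t) B
                + sup_on Num.norm (w t) B + Lip Num.norm (w t) B)%E) ->
  exists vh wh L, local_field vh wh L /\
    {ae leb, forall t, 0 <= t <= T -> vh t = v t /\ wh t = w t}.
Proof.
move=> hd hv hw hloc.
have [Lam HLam] := choice (rate_exists hd hv hw hloc).
have [|N [mN N0] HN] := @ae_countable (fun n t => 0 <= t <= T ->
    [/\ forall x, `|x| <= n%:R -> `|v t x| <= Lam n t,
        forall x, `|x| <= n%:R -> `|w t x| <= Lam n t,
        forall x y, `|x| <= n%:R -> `|y| <= n%:R -> `|v t x - v t y| <= Lam n t * `|x - y| &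
        forall x y, `|x| <= n%:R -> `|y| <= n%:R -> `|w t x - w t y| <= Lam n t * `|x - y|]).
  by move=> n; have [] := HLam n.
have mT : measurable (`[0, T]%classic : set RM) by exact: measurable_itv.
pose G : set R := `[0, T]%classic `\` (N : set R).
have mG : measurable G by exact: (measurableD mT mN).
have GT : G `<=` `[0, T]%classic by move=> t [].

have G0T t : G t -> 0 <= t <= T by move=> [/=]; rewrite in_itv.
have Lam0 n t : 0 <= Lam n t by have [] := HLam n.
exists (fun t x => if t \in G then v t x else 0), (fun t x => if t \in G then w t x else 0), Lam.
split.
  split.
  - apply: (@measurable_fun_restrict_time _ _ `[0, T]%classic G v 0) => //.
  - apply: (@measurable_fun_restrict_time _ _ `[0, T]%classic G w 0) => //.
  - by move=> n; have [] := HLam n.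
  - move=> n t x xn; case: ifPn; last by rewrite normr0.
    by rewrite inE => Gt; have [H _ _ _] := HN t Gt.2 n (G0T t Gt); exact: H.
  - move=> n t x xn; case: ifPn; last by rewrite normr0.
    by rewrite inE => Gt; have [_ H _ _] := HN t Gt.2 n (G0T t Gt); exact: H.
  - move=> n t x y xn yn; case: ifPn; last by rewrite subrr normr0 mulr_ge0.
    by rewrite inE => Gt; have [_ _ H _] := HN t Gt.2 n (G0T t Gt); exact: H.
  - move=> n t x y xn yn; case: ifPn; last by rewrite subrr normr0 mulr_ge0.
    by rewrite inE => Gt; have [_ _ _ H] := HN t Gt.2 n (G0T t Gt); exact: H.
exists N; split=> // t /= nt; apply: contrapT => Nt; apply: nt => tT.
have tG : t \in G by rewrite inE; split=> //=; rewrite in_itv.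
by split; apply/funext => x; rewrite tG.
Qed.
End local_field.

(** * The maximal flow through truncated fields *)

Section truncated_flow.
Context {R : realType} {d : nat}.
Local Notation V := 'rV[R]_d.
Variables (v : R -> V -> V) (w : R -> V -> R) (L : nat -> R -> R).
Hypothesis lf : local_field v w L.

(** Outside of the ball of radius n the field is continued by its values at
    the clamped points, which preserves the Lipschitz bound and makes it
    bounded, so that its flow is global. *)
Definition trunc (n : nat) (q : R) (x : V) : V := v q (clampV n%:R x).
Definition truncw (n : nat) (q : R) (x : V) : R := w q (clampV n%:R x).

Lemma trunc_id n q x : `|x| <= n%:R -> trunc n q x = v q x.
Proof. by move=> xn; rewrite /trunc clampV_id. Qed.

Lemma measurable_clamped n d' (W : measurableType d') (g : R -> V -> W) :
  measurable_fun setT (fun p : R * V => g p.1 p.2) ->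
  measurable_fun setT (fun p : R * V => g p.1 (clampV n%:R p.2)).
Proof.
move=> mg.
have mc : measurable_fun setT (clampV n%:R : V -> V).
  by apply: continuous_measurable_rV_rV; exact: clampV_continuous.
exact: (measurableT_comp mg (measurable_fun_pair measurable_fst
  (measurableT_comp mc measurable_snd))).
Qed.

Lemma measurable_trunc n : measurable_fun setT (fun p : R * V => trunc n p.1 p.2).
Proof. exact: measurable_clamped (lf_mv lf). Qed.

Lemma lf_L0 n t : 0 <= L n t.
Proof. by apply: le_trans (lf_v lf (n := n) t (x := 0) _); rewrite ?normr0. Qed.

Lemma trunc_le n t x : `|trunc n t x| <= L n t.
Proof. by apply: (lf_v lf); exact: clampV_le. Qed.

Lemma trunc_lip n t x y : `|trunc n t x - trunc n t y| <= L n t * `|x - y|.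
Proof.
apply: le_trans (lf_vl lf _ (clampV_le x (ler0n R n)) (clampV_le y (ler0n R n))) _.
by rewrite ler_wpM2l ?lf_L0// clampV_contract.
Qed.

Lemma truncw_measurable n : measurable_fun setT (fun p : R * V => truncw n p.1 p.2).
Proof. exact: measurable_clamped (lf_mw lf). Qed.

Lemma truncw_le n t x : `|truncw n t x| <= L n t.
Proof. exact: (lf_w lf _ (clampV_le x (ler0n R n))). Qed.

Lemma truncw_lip n t x y : `|truncw n t x - truncw n t y| <= L n t * `|x - y|.
Proof.
apply: le_trans (lf_wl lf _ (clampV_le x (ler0n R n)) (clampV_le y (ler0n R n))) _.
by rewrite ler_wpM2l ?lf_L0// clampV_contract.
Qed.

Local Notation Xn n := (gflow (trunc n)).

(** Up to time r the truncated path stays where the truncation has not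
    changed the field, so that it is a path of the field itself. *)
Definition good (n : nat) (s r : R) (x : V) : Prop :=
  forall q, btw s r q -> `|Xn n s q x| < n%:R.

Lemma btw_trans (a b c q : R) : btw a b c -> btw a c q -> btw a b q.
Proof.
rewrite /btw => /orP[]/andP[h1 h2] /orP[]/andP[h3 h4]; apply/orP;
 first [left; apply/andP; split; lra | right; apply/andP; split; lra].
Qed.

Lemma btw_refr (a b : R) : btw a b b.
Proof. by rewrite /btw !lexx andbT le_total. Qed.

Lemma good_mon n s r c x : btw s r c -> good n s r x -> good n s c x.
Proof. by move=> src H q scq; apply: H; exact: btw_trans scq. Qed.

Lemma Xn_continuous n s x : continuous (fun q => Xn n s q x).
Proof.
by apply: (gflow_spec (lf_L1 lf n) (measurable_trunc n) (trunc_le n) (trunc_lip n) s x).1.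
Qed.

Lemma Xn_refl n s x : Xn n s s x = x.
Proof.
exact: (gflow_refl (lf_L1 lf n) (measurable_trunc n) (trunc_le n) (trunc_lip n)).
Qed.

Lemma Xn_eq n s r x : Xn n s r x = x + (vprim (fun q => trunc n q (Xn n s q x)) r -
  vprim (fun q => trunc n q (Xn n s q x)) s).
Proof.
exact: (gflow_eq (lf_L1 lf n) (measurable_trunc n) (trunc_le n) (trunc_lip n)).
Qed.

Lemma vL1_trunc n (X : R -> V) : continuous X -> vL1 (fun q => trunc n q (X q)).
Proof.
move=> cX.
exact: (vL1_along (lf_L1 lf n) (measurable_trunc n) (trunc_le n)
  (continuous_measurable_to_rV cX)).
Qed.

Lemma Xn_unique n s x a b X : continuous X -> a <= s -> s <= b ->
  (forall r, a <= r <= b -> X r = x + (vprim (fun q => trunc n q (X q)) r -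
      vprim (fun q => trunc n q (X q)) s)) ->
  forall r, a <= r <= b -> X r = Xn n s r x.
Proof.
move=> cX sa sb HX.
exact: (gflow_unique (lf_L1 lf n) (measurable_trunc n) (trunc_le n) (trunc_lip n)
  (continuous_measurable_to_rV cX) sa sb HX).
Qed.

(** The hypothesis is symmetric in the two levels, so that a truncation can
    be enlarged as well as shrunk. *)
Lemma Xn_agree n n' s r x q : (forall p, btw s r p ->
    `|Xn n s p x| < n%:R /\ `|Xn n s p x| < n'%:R) ->
  btw s r q -> Xn n' s q x = Xn n s q x.
Proof.
move=> gd srq; apply/esym.
apply: (@Xn_unique n' s x (Num.min s r) (Num.max s r) (fun q => Xn n s q x)).
- exact: Xn_continuous.
- by rewrite ge_min lexx.
- by rewrite le_max lexx.
- move=> p; rewrite -btwE => srp; rewrite {1}Xn_eq; congr (_ + _).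
  apply: vprim_eq; [exact/vL1_trunc/Xn_continuous|exact/vL1_trunc/Xn_continuous|].
  move=> z /(btw_trans srp) srz.
  by have [z1 z2] := gd z srz; rewrite !trunc_id ?ltW.
- by rewrite -btwE.
Qed.

Lemma Xn_stable n n' s r x q : (n <= n')%N -> good n s r x -> btw s r q ->
  Xn n' s q x = Xn n s q x.
Proof.
move=> nn' gd; apply: Xn_agree => p /gd h; split=> //.
by apply: lt_le_trans h _; rewrite ler_nat.
Qed.

Lemma good_up n n' s r x : (n <= n')%N -> good n s r x -> good n' s r x.
Proof.
move=> nn' gd q srq; rewrite (Xn_stable nn' gd srq).
by apply: lt_le_trans (gd q srq) _; rewrite ler_nat.
Qed.

Lemma good_open n s r x : good n s r x ->
  exists2 e : R, 0 < e & forall r', `|r - r'| < e -> good n s r' x.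
Proof.
move=> gd; have h := gd r (btw_refr s r).
have cN : {for r, continuous (fun q => `|Xn n s q x|)}.
  by apply: continuous_comp; [exact: Xn_continuous|exact: norm_continuous].
have : \forall q \near r, `|Xn n s q x| < n%:R by exact: (cvgr_lt _ cN).
move=> /nbhs_ballP[e /= e0 He]; exists e => // r' rr' q srq.
have [|nsrq] := boolP (btw s r q); first exact: gd.
apply: He; rewrite /ball/=; apply: le_lt_trans rr'.
move: nsrq srq; rewrite /btw negb_or !negb_and -!ltNge => /andP[/orP h1 /orP h2].
move=> /orP[]/andP[h3 h4]; case: h1 => h1; case: h2 => h2; try (exfalso; lra).
- by rewrite ler0_norm; [rewrite ler0_norm|]; lra.
- by rewrite ger0_norm; [rewrite ger0_norm|]; lra.
Qed.

Lemma good_self s x : exists n, good n s s x.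
Proof.
exists (Num.truncn `|x|).+1 => q; rewrite /btw orbb => /andP[h1 h2].
have -> : q = s by apply/eqP; rewrite eq_le h1 h2.
by rewrite Xn_refl truncnS_gt.
Qed.

(** By maximal_solution_trunc below, life is the maximal interval of
    existence and traj the maximal solution. *)
Definition life (T s : R) (x : V) : set R :=
  [set r | 0 <= r <= T /\ exists n, good n s r x].
Definition traj (s : R) (x : V) (r : R) : V :=
  Xn (xget 0%N [set n | good n s r x]) s r x.

Lemma trajE n s r x : good n s r x -> traj s x r = Xn n s r x.
Proof.
move=> gd; rewrite /traj; have := xgetPex 0%N (ex_intro [set n | good n s r x] n gd).
move: (xget _ _) => m /= gm; have [nm|/ltnW mn] := leqP n m.
  by rewrite (Xn_stable nm gd)// btw_refr.
by rewrite (Xn_stable mn gm)// btw_refr.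
Qed.

Lemma btw_itv (a b s c : R) : a <= c <= b -> btw s a c \/ btw s b c.
Proof.
move=> /andP[ac cb]; rewrite /btw; have [cs|/ltW sc] := leP c s.
  by left; rewrite ac orbT.
by right; rewrite sc cb.
Qed.

Lemma life_itv T s x a b c : life T s x a -> life T s x b -> a <= c <= b ->
  life T s x c.
Proof.
move=> [/andP[a0 aT] [n ga]] [/andP[b0 bT] [n' gb]] acb; have /andP[ac cb] := acb.
split; first by apply/andP; split; [exact: le_trans ac|exact: le_trans bT].
by have [h|h] := btw_itv s acb; [exists n; exact: good_mon ga|exists n'; exact: good_mon gb].
Qed.

Lemma life_good T s x a b : life T s x a -> life T s x b ->
  exists n, forall c, a <= c <= b -> good n s c x.
Proof.
move=> [_ [n ga]] [_ [n' gb]]; exists (maxn n n') => c acb.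
have [h|h] := btw_itv s acb.
  by apply: (good_mon h); apply: good_up ga; exact: leq_maxl.
by apply: (good_mon h); apply: good_up gb; exact: leq_maxr.
Qed.

Lemma Xn_mlip n s x r r' :
  `|Xn n s r x - Xn n s r' x| <= `|prim (L n) r - prim (L n) r'|.
Proof.
exact: (gflow_mlip (lf_L1 lf n) (measurable_trunc n) (trunc_le n) (trunc_lip n)).
Qed.

Lemma traj_abs_continuous T s x a b : life T s x a -> life T s x b ->
  abs_continuous a b (traj s x).
Proof.
move=> la lb e e0; have [n gn] := life_good la lb.
have d1 : 0 < d%:R + 1 :> R by rewrite ltr_wpDl.
have [dl dl0 H] := prim_uac (lf_L1 lf n) (divr_gt0 e0 d1).
exists dl => // k l r lr dj sd.
have lr' i : l i <= r i by have [] := lr i.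
apply: (@le_lt_trans _ _ ((d%:R + 1) * \sum_i (prim (L n) (r i) - prim (L n) (l i)))).
  rewrite mulr_sumr; apply: ler_sum => i _.
  have [al _ rb] := lr i.
  rewrite (trajE (gn (r i) _)) ?(le_trans al)//.
  rewrite (trajE (gn (l i) _)) ?al ?(le_trans _ rb)//.
  apply: le_trans (enorm_le_norm _) _; apply: ler_pM => //; first by rewrite lerDl.
  apply: le_trans (Xn_mlip _ _ _ _ _) _.
  by rewrite ger0_norm// subr_ge0 (prim_nd (lf_L1 lf n) (lf_L0 n)).
by rewrite mulrC -ltr_pdivlMr//; exact: H.
Qed.

Lemma ae_forall_nat (P : nat -> R -> Prop) :
  (forall n, {ae @lebesgue_measure R, forall t, P n t}) ->
  {ae @lebesgue_measure R, forall t, forall n, P n t}.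
Proof.
move=> /ae_countable[N [mN N0] HN]; exists N; split=> // t nt; apply: contrapT => Nt.
exact/nt/HN.
Qed.

Lemma ae_forall_ord k (P : 'I_k -> R -> Prop) :
  (forall n, {ae @lebesgue_measure R, forall t, P n t}) ->
  {ae @lebesgue_measure R, forall t, forall n, P n t}.
Proof.
move=> H; have := @ae_forall_nat (fun n t => forall i : 'I_k, n = i :> nat -> P i t).
move=> HH; have {}HH := HH _.
apply: (ae_impl _ (HH _)) => [t Ht i|n]; first exact: Ht.
have [nk|nk] := ltnP n k; last first.
  by apply: ae_all => t i ni; have := ltn_ord i; rewrite -ni ltnNge nk.
by apply: (ae_impl _ (H (Ordinal nk))) => t Pt i ni; have -> : i = Ordinal nk by exact: val_inj.
Qed.

Lemma is_derive_rV (X : R -> V) (r : R) (l : V) :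
  (forall i, is_derive r 1 (fun q => X q 0 i) (l 0 i)) -> is_derive r 1 X l.
Proof.
move=> H.
have dX : derivable X r 1.
  by apply/derivable_mxP => i j; rewrite ord1; have [] := H j.
apply: DeriveDef => //; rewrite derive_mx//; apply/rowP => i; rewrite mxE.
by have [_ <-] := H i.
Qed.

Lemma is_derive_coord (X : R -> V) (r : R) (l : V) i :
  is_derive r 1 X l -> is_derive r 1 (fun q => X q 0 i) (l 0 i).
Proof.
move=> [dX <-]; rewrite derive_mx// mxE; apply/derivableP.
by move/derivable_mxP : dX => /(_ 0 i).
Qed.

Lemma vprim_ae_is_derive (g : R -> V) : vL1 g ->
  {ae @lebesgue_measure R, forall r : R, is_derive r 1 (vprim g) (g r)}.
Proof.
move=> Ig; have := ae_forall_ord (fun i => prim_ae_is_derive (Ig i)).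
apply: ae_impl => r Hr; apply: is_derive_rV => i.
rewrite (_ : (fun q => vprim g q 0 i) = prim (fun q => g q 0 i))//.
by apply/funext => q; rewrite mxE.
Qed.

Lemma traj_is_solution T u s x : 0 <= s <= T ->
  {ae @lebesgue_measure R, forall t, 0 <= t <= T -> v t = u t} ->
  is_solution u T s x (life T s x) (traj s x).
Proof.
move=> sT vu; have [n0 gs] := good_self s x; split.
- split.
    by move=> a b /= la lb c acb; exact: (life_itv la lb acb).
  exists [set r | exists n, good n s r x].
    rewrite openE => r [n gn]; have [e e0 He] := good_open gn.
    by apply/nbhs_ballP; exists e => //= r' rr'; exists n; exact: He.
  by apply/seteqP; split=> r /=; rewrite in_itv/= => -[].
- by split=> //; exists n0.
- by rewrite (trajE gs) Xn_refl.
- by move=> a b; exact: traj_abs_continuous.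
- have := ae_forall_nat (fun n => vprim_ae_is_derive
      (vL1_trunc n (@Xn_continuous n s x))).
  move=> /ae_andP/(_ vu); apply: ae_impl => r [Hr vur] [rT [n gn]].
  have -> : u r (traj s x r) = trunc n r (Xn n s r x).
    by rewrite trunc_id ?(ltW (gn r (btw_refr s r)))// (trajE gn) vur.
  have E : \forall q \near r, Xn n s q x = traj s x q.
    have [e e0 He] := good_open gn.
    by apply/nbhs_ballP; exists e => //= q rq; rewrite (trajE (He q rq)).
  apply: (near_eq_is_derive E).
  rewrite (_ : (fun q => Xn n s q x) = (fun q => x - vprim (fun q => trunc n q (Xn n s q x)) s) +
     vprim (fun q => trunc n q (Xn n s q x))); last first.
    by apply/funext => q; rewrite Xn_eq fctE/= addrCA addrC.
  by rewrite -[X in is_derive _ _ _ X]add0r; apply: is_deriveD.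
Qed.

(** Composed with clip a b, a curve that is continuous between a and b only
    becomes a continuous curve. *)
Definition clip (a b q : R) : R := Num.max a (Num.min q b).

Lemma clip_id a b q : a <= q <= b -> clip a b q = q.
Proof. by move=> /andP[aq qb]; rewrite /clip min_l// max_r. Qed.

Lemma clip_in a b q : a <= b -> a <= clip a b q <= b.
Proof.
by move=> ab; rewrite /clip le_max lexx/= ge_max ab/= ge_min lexx orbT.
Qed.

Lemma clip_contract a b q q' : a <= b -> `|clip a b q - clip a b q'| <= `|q - q'|.
Proof.
move=> ab; wlog qq : q q' / q <= q' => [hw|].
  by have [|/ltW] := leP q q'; [exact: hw|rewrite distrC (distrC q); exact: hw].
have E : 0 <= clip a b q' - clip a b q <= q' - q.
  rewrite /clip /Order.max /Order.min.
  apply/andP; split; case: (ltP q b) => ?; case: (ltP q' b) => ?;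
    case: ltP => ?; case: ltP => ?; lra.
move/andP : E => [h1 h2].
by rewrite distrC (ger0_norm h1) distrC ger0_norm ?subr_ge0.
Qed.

Lemma abs_continuous_clip a b (X : R -> V) : a <= b -> abs_continuous a b X ->
  continuous (fun q => X (clip a b q)).
Proof.
move=> ab H q; apply/cvgrPdist_lt => e e0; have [dl dl0 Hd] := H e e0.
have key p p' : a <= p -> p <= p' -> p' <= b -> p' - p < dl -> `|X p' - X p| < e.
  move=> ap pp pb pd; have := Hd 1%N (fun=> p) (fun=> p'); rewrite !big_ord1.
  move=> /(_ _ _ pd) h; apply: le_lt_trans (enorm_ge_norm _) _; apply: h => //.
  by move=> i j; rewrite (ord1 i) (ord1 j) eqxx.
apply/nbhs_ballP; exists dl => //= q' qq'.
have h := le_lt_trans (clip_contract q q' ab) qq'.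
have /andP[a1 b1] := clip_in q ab; have /andP[a2 b2] := clip_in q' ab.
have [qle|/ltW qle] := leP (clip a b q) (clip a b q').
  rewrite distrC; apply: key => //; apply: le_lt_trans h.
  by rewrite distrC ler_norm.
by apply: key => //; apply: le_lt_trans h; rewrite ler_norm.
Qed.

Lemma bounded_on_segment a b (X : R -> V) : a <= b -> continuous X ->
  exists n : nat, forall q, a <= q <= b -> `|X q| < n%:R.
Proof.
move=> ab cX.
have [|c cab Hc] := @EVT_max R (fun q => `|X q|) a b ab.
  apply: continuous_subspaceT => q; apply: continuous_comp; first exact: cX.
  exact: norm_continuous.
exists (Num.truncn `|X c|).+1 => q qab; apply: le_lt_trans (truncnS_gt _).
by apply: Hc; rewrite in_itv.
Qed.

Lemma ac_coord a b (X : R -> V) (i : 'I_d) : abs_continuous a b X ->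
  ac_on a b (fun q => X q 0 i).
Proof.
move=> H e e0; have [dl dl0 Hd] := H e e0; exists dl => // n l r lr dj sd.
apply: le_lt_trans (Hd n l r lr dj sd); apply: ler_sum => j _.
apply: le_trans (enorm_ge_norm _).
by have := rV_coord_le (X (r j) - X (l j)) i; rewrite !mxE.
Qed.

Lemma ac_prim a b (h : R -> R) : L1 h -> ac_on a b (prim h).
Proof.
move=> Ih e e0.
have Ia : L1 (fun q => `|h q|).
  have := integrable_abse Ih; rewrite /L1; congr (_.-integrable _ _).
have [dl dl0 H] := prim_uac Ia e0; exists dl => // n l r lr dj sd.
have lr' i : l i <= r i by have [] := lr i.
apply: le_lt_trans (H n l r lr' dj sd); apply: ler_sum => i _.
by apply: prim_norm_le => //; exact: lr'.
Qed.

Lemma ac_sub a b (Y Z : R -> R) : ac_on a b Y -> ac_on a b Z ->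
  ac_on a b (fun q => Y q - Z q).
Proof.
move=> HY HZ e e0; have e2 : 0 < e / 2 by rewrite divr_gt0.
have [d1 d10 H1] := HY _ e2; have [d2 d20 H2] := HZ _ e2.
exists (Num.min d1 d2); first by rewrite lt_min d10 d20.
move=> n l r lr dj; rewrite lt_min => /andP[s1 s2].
have -> : e = e / 2 + e / 2 by rewrite -splitr.
apply: le_lt_trans (ltrD (H1 n l r lr dj s1) (H2 n l r lr dj s2)).
rewrite -big_split/=; apply: ler_sum => i _.
have -> : Y (r i) - Z (r i) - (Y (l i) - Z (l i)) =
  (Y (r i) - Y (l i)) - (Z (r i) - Z (l i)) by ring.
exact: ler_normB.
Qed.

Lemma ac_on_sub a b a' b' (Y : R -> R) : a <= a' -> b' <= b ->
  ac_on a b Y -> ac_on a' b' Y.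
Proof.
move=> aa bb H e e0; have [dl dl0 Hd] := H e e0; exists dl => // n l r lr.
apply: Hd => i; have [h1 h2 h3] := lr i.
by split=> //; [exact: le_trans h1|exact: le_trans bb].
Qed.

(** Between two times a solution is bounded, hence it follows some
    truncation of the field. Its difference with the primitive of the
    truncated field along it is absolutely continuous with derivative 0
    almost everywhere, thus constant: the solution satisfies the integral
    equation and is the truncated flow. *)
Lemma solution_in_life T u s x J X r : 0 <= s <= T ->
  {ae @lebesgue_measure R, forall t, 0 <= t <= T -> v t = u t} ->
  is_solution u T s x J X -> J r -> life T s x r /\ traj s x r = X r.
Proof.
move=> sT vu [[itvJ [U oU JE]] Js Xs acX dX] Jr.
have JT q : J q -> 0 <= q <= T by rewrite JE => -[_] /=; rewrite in_itv.
pose a := Num.min s r; pose b := Num.max s r.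
have [sa sb ra rb] : [/\ a <= s, s <= b, a <= r & r <= b].
  by rewrite !ge_min !le_max !lexx !orbT.
have ab : a <= b by exact: le_trans sb.
have Ja : J a by rewrite /a; case: leP.
have Jb : J b by rewrite /b; case: leP.
have Jab q : a <= q <= b -> J q by exact: itvJ.
have sab : a <= s <= b by rewrite sa sb.
pose Y q := X (clip a b q).
have YX q : a <= q <= b -> Y q = X q by move=> qab; rewrite /Y clip_id.
have cY : continuous Y by exact: abs_continuous_clip ab (acX a b Ja Jb).
have [n Yn] := bounded_on_segment ab cY.
have IY := vL1_trunc n cY.
have coordE i c : a <= c <= b -> X c 0 i - prim (fun q => trunc n q (Y q) 0 i) c =
    X a 0 i - prim (fun q => trunc n q (Y q) 0 i) a.
  move=> /andP[ac cb].
  pose Z q := X q 0 i - prim (fun q => trunc n q (Y q) 0 i) q.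
  apply: (@ac_zero_derive_constant R Z a c ac).
    apply: (ac_on_sub (lexx a) cb).
    by apply: ac_sub; [exact/ac_coord/acX|exact: ac_prim].
  have := prim_ae_is_derive (IY i).
  move=> /ae_andP/(_ dX) /ae_andP/(_ vu); apply: ae_impl => q [[h1 h2] h3] aq qc.
  have qab : a <= q <= b by rewrite (ltW aq) (le_trans (ltW qc)).
  have Jq := Jab q qab.
  have h4 := is_derive_coord i (h2 Jq).
  have E : trunc n q (Y q) = u q (X q).
    by rewrite trunc_id ?(ltW (Yn q qab))// (YX q qab) h3// JT.
  have := is_deriveB h4 h1; rewrite E subrr.
  by rewrite (_ : _ - _ = Z)//.
have eqX c : a <= c <= b -> Y c = x + (vprim (fun q => trunc n q (Y q)) c -
    vprim (fun q => trunc n q (Y q)) s).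
  move=> cab; rewrite YX//; apply/rowP => i; rewrite !mxE.
  by have := coordE i c cab; have := coordE i s sab; rewrite Xs; lra.
have YXn := Xn_unique cY sa sb eqX.
have gd : good n s r x.
  move=> q; rewrite btwE => qab.
  by rewrite -YXn// Yn.
have rab : a <= r <= b by rewrite ra rb.
split; first by split; [exact: JT|exists n].
by rewrite (trajE gd) -YXn// YX.
Qed.

(** Every solution is a restriction of traj by solution_in_life, so that
    traj is the largest one and the only maximal one. *)
Lemma maximal_solution_trunc T u s x : 0 <= s <= T ->
  {ae @lebesgue_measure R, forall t, 0 <= t <= T -> v t = u t} ->
  flow_itv u T s x = life T s x /\
  forall r, life T s x r -> flow u T s r x = traj s x r.
Proof.
move=> sT vu.
have solT := traj_is_solution x sT vu.
have maxT : is_maximal_solution u T s x (life T s x) (traj s x).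
  split=> // J' X' sol' sub _; apply/seteqP; split=> // r J'r.
  by have [] := solution_in_life sT vu sol' J'r.
have := xgetPex (set0, fun=> x) (ex_intro
  [set JX | is_maximal_solution u T s x JX.1 JX.2] (life T s x, traj s x) maxT).
rewrite /flow_itv /flow /maximal_solution; case: (xget _ _) => J X [/= sol mx].
have JE : life T s x = J.
  apply: (mx _ (traj s x) solT).
    by move=> r Jr; have [] := solution_in_life sT vu sol Jr.
  by move=> r Jr; have [] := solution_in_life sT vu sol Jr.
split=> // r; rewrite JE => Jr.
by have [_ ->] := solution_in_life sT vu sol Jr.
Qed.

End truncated_flow.

(** * Smooth steps and partitions of unity *)

Section smooth_real.
Context {R : realType}.
Implicit Types (f g : R -> R).

(** The derivatives are witnesses, so that closure under an operation is
    proved by exhibiting a formula for them. *)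
Fixpoint Cn (n : nat) (f : R -> R) : Prop :=
  continuous f /\
  if n is n'.+1 then exists2 f' : R -> R, forall x : R, is_derive x 1 f (f' x) & Cn n' f'
  else True.

Lemma Cn_continuous n f : Cn n f -> continuous f.
Proof. by case: n => [[]|n []]. Qed.

Lemma CnW n f : Cn n.+1 f -> Cn n f.
Proof.
elim: n f => [|n IH] f [cf [f' df Hf']]; first by split.
by split=> //; exists f' => //; exact: IH.
Qed.

Lemma Cn_cst n (c : R) : Cn n (cst c).
Proof.
elim: n c => [|n IH] c; split=> //; try (by move=> x; exact: cvg_cst).
by exists (cst 0) => // x; exact: is_derive_cst.
Qed.

Lemma CnD n f g : Cn n f -> Cn n g -> Cn n (fun x => f x + g x).
Proof.
elim: n f g => [|n IH] f g [cf Hf] [cg Hg].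
  by split=> // x; apply: cvgD; [exact: cf|exact: cg].
split; first by move=> x; apply: cvgD; [exact: cf|exact: cg].
have [f' df Hf'] := Hf; have [g' dg Hg'] := Hg.
exists (fun x => f' x + g' x); last exact: IH.
by move=> x; exact: is_deriveD.
Qed.

Lemma CnM n f g : Cn n f -> Cn n g -> Cn n (fun x => f x * g x).
Proof.
elim: n f g => [|n IH] f g Hf Hg.
  by split=> // x; apply: cvgM; [exact: Hf.1|exact: Hg.1].
split; first by move=> x; apply: cvgM; [exact: Hf.1|exact: Hg.1].
have [_ [f' df Hf']] := Hf; have [_ [g' dg Hg']] := Hg.
exists (fun x => f x * g' x + g x * f' x).
  by move=> x; exact: is_deriveM.
by apply: CnD; apply: IH => //; exact: CnW.
Qed.

Lemma is_derive_affine f (a b x l : R) : is_derive (a * x + b) 1 f l ->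
  is_derive x 1 (fun y => f (a * y + b)) (a * l).
Proof.
move=> df.
have h : is_derive x 1 (fun y => a * y + b) a.
  have : is_derive x 1 ((fun y => a * y) + cst b) (a + 0).
    apply: is_deriveD.
    have := @is_deriveZ _ _ _ id a x 1 1 (is_derive_id x 1).
    by rewrite /GRing.scale/= mulr1.
  by rewrite addr0.
rewrite mulrC; exact: (@is_derive1_comp R f (fun y => a * y + b) x l a df h).
Qed.

Lemma Cn_affine n f (a b : R) : Cn n f -> Cn n (fun x => f (a * x + b)).
Proof.
have ca (c : R -> R) : continuous c -> continuous (fun x : R => c (a * x + b)).
  move=> cc x; apply: (@continuous_comp _ _ _ (fun x => a * x + b) c); last exact: cc.
  by apply: cvgD; [apply: cvgM; [exact: cvg_cst|exact: cvg_id]|exact: cvg_cst].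
elim: n f => [|n IH] f [cf Hf]; first by split=> //; exact: ca.
split; first exact: ca.
have [f' df Hf'] := Hf; exists (fun x => a * f' (a * x + b)).
  by move=> x; apply: is_derive_affine.
by apply: CnM; [exact: Cn_cst|exact: IH].
Qed.

(** These functions p(1/x) exp(-1/x), extended by 0, form a family that is
    closed under differentiation, which makes smoothness an induction. *)
Definition flat (p : {poly R}) (x : R) : R :=
  if 0 < x then p.[x^-1] * expR (- x^-1) else 0.

Lemma exp_dominates n (y : R) : 0 <= y -> y ^+ n <= n%:R ^+ n * expR y.
Proof.
move=> y0; case: n => [|n]; first by rewrite !expr0 mul1r -expR0 ler_expR.
have n0 : 0 < n.+1%:R :> R by rewrite ltr0n.
have -> : expR y = expR (y / n.+1%:R) ^+ n.+1.
  by rewrite -expRM_natl; congr expR; field; rewrite gt_eqF.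
have h : y <= n.+1%:R * expR (y / n.+1%:R).
  rewrite -ler_pdivrMl// mulrC; apply: le_trans (expR_ge1Dx _).
  by rewrite lerDr.
by rewrite -exprMn lerXn2r ?nnegrE// mulr_ge0// expR_ge0.
Qed.

Lemma poly_exp_bounded (p : {poly R}) : exists2 C : R, 0 <= C &
  forall y, 0 <= y -> `|p.[y]| * expR (- y) <= C.
Proof.
exists (\sum_(i < size p) `|p`_i| * i%:R ^+ i).
  by apply: sumr_ge0 => i _; rewrite mulr_ge0// exprn_ge0.
move=> y y0; rewrite horner_coef.
apply: (@le_trans _ _ ((\sum_(i < size p) `|p`_i * y ^+ i|) * expR (- y))).
  by rewrite ler_wpM2r ?expR_ge0// ler_norm_sum.
rewrite mulr_suml; apply: ler_sum => i _.
rewrite normrM -mulrA ler_wpM2l// ger0_norm ?exprn_ge0//.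
rewrite expRN ler_pdivrMr ?expR_gt0//; exact: exp_dominates.
Qed.

(** The square makes the derivative at the origin exist and vanish. *)
Lemma flat_le (p : {poly R}) : exists2 C : R, 0 <= C & forall x, `|flat p x| <= C * x ^+ 2.
Proof.
have [C C0 HC] := poly_exp_bounded (p * 'X^2).
exists C => // x; rewrite /flat; case: ifPn => [x0|_]; last first.
  by rewrite normr0 mulr_ge0// sqr_ge0.
have xi0 : 0 <= x^-1 by rewrite invr_ge0 ltW.
have := HC _ xi0; rewrite hornerM hornerXn normrM (ger0_norm (exprn_ge0 _ xi0)) => h.
rewrite normrM (ger0_norm (expR_ge0 _)) -ler_pdivrMr ?exprn_gt0//.
by apply: le_trans h; rewrite exprVn mulrAC.
Qed.

Lemma flat_is_derive (p : {poly R}) (x : R) :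
  is_derive x 1 (flat p) (flat ('X^2 * (p - p^`())) x).
Proof.
have [x0|x0|->] := ltgtP x 0.
- have -> : flat ('X^2 * (p - p^`())) x = 0 by rewrite /flat ltNge (ltW x0).
  have E : \forall y \near x, cst 0 y = flat p y.
    have nx : 0 < - x by lra.
    apply/nbhs_ballP; exists (- x) => //= y; rewrite /ball/= ltr_norml => /andP[h1 h2].
    by rewrite /flat ltNge ltW//=; lra.
  apply: (near_eq_is_derive E); exact: is_derive_cst.
- have E : \forall y \near x, p.[y^-1] * expR (- y^-1) = flat p y.
    apply/nbhs_ballP; exists x => //= y; rewrite /ball/= ltr_norml => /andP[h1 h2].
    by rewrite /flat ifT//; lra.
  apply: (near_eq_is_derive E).
  have xn0 : x != 0 by rewrite gt_eqF.
  have dV : is_derive x 1 (fun y : R => y^-1) (- x ^- 2).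
    have := @is_deriveV R id x 1 1 xn0 (is_derive_id x 1).
    by rewrite /GRing.scale /= mulr1.
  have dp : is_derive (x^-1) 1 (horner p) (p^`()).[x^-1].
    rewrite derivE derive1E; apply/derivableP.
    exact: (@derivable_horner R p x^-1).
  have d1 := @is_derive1_comp R (horner p) (fun y => y^-1) x _ _ dp dV.
  have dN : is_derive x 1 (fun y : R => - y^-1) (x ^- 2).
    by have := @is_deriveN _ _ _ (fun y : R => y^-1) x 1 _ dV; rewrite opprK.
  have d2 := @is_derive1_comp R expR (fun y => - y^-1) x _ _ (is_derive_expR (- x^-1)) dN.
  have := @is_deriveM _ _ _ _ x 1 _ _ d1 d2.
  move=> /is_derive_eq; apply.
  rewrite /flat x0 !hornerE /GRing.scale /= exprVn; ring.
- have -> : flat ('X^2 * (p - p^`())) 0 = 0 by rewrite /flat ltxx.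
  have [C C0 HC] := flat_le p.
  have f0 : flat p 0 = 0 by rewrite /flat ltxx.
  have cv : h^-1 *: ((flat p \o shift 0) (h *: 1) - flat p 0) @[h --> 0^'] --> 0.
    apply/cvgrPdist_le => e e0; rewrite near_withinE; apply/nbhs_ballP.
    have C1 : 0 < C + 1 by lra.
    exists (e / (C + 1)) => /=; first by rewrite divr_gt0.
    move=> h; rewrite /ball/= sub0r normrN => hh h0.
    rewrite f0 subr0 sub0r normrN addr0 normrM normfV [h%:A]mulr1.
    rewrite ler_pdivrMl ?normr_gt0//; apply: le_trans (HC h) _.
    rewrite -real_normK ?num_real// expr2 mulrA mulrC; apply: ler_wpM2l => //.
    apply: le_trans (_ : (C + 1) * `|h| <= e); last by rewrite mulrC -ler_pdivlMr// ltW.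
    by rewrite ler_wpM2r// lerDl.
  apply: DeriveDef; first by apply/cvg_ex; exists 0.
  exact: (cvg_lim _ cv).
Qed.

Lemma flat_continuous p : continuous (flat p).
Proof.
by move=> x; apply: differentiable_continuous; apply/derivable1_diffP; have [] := flat_is_derive p x.
Qed.

Lemma flat_Cn n p : Cn n (flat p).
Proof.
elim: n p => [|n IH] p; split=> //; try exact: flat_continuous.
by exists (flat ('X^2 * (p - p^`()))) => // x; exact: flat_is_derive.
Qed.

End smooth_real.

Section step.
Context {R : realType}.

Definition bump (x : R) : R := flat 1 x * flat 1 (-1 * x + 1).

Lemma flat1_ge0 (x : R) : 0 <= flat 1 x.
Proof. by rewrite /flat; case: ifP => // _; rewrite hornerC mul1r expR_ge0. Qed.

Lemma flat1_le1 (x : R) : flat 1 x <= 1.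
Proof.
rewrite /flat; case: ifPn => // x0; rewrite hornerC mul1r -expR0 ler_expR.
by rewrite oppr_le0 invr_ge0 ltW.
Qed.

Lemma bump_ge0 x : 0 <= bump x.
Proof. by rewrite mulr_ge0 ?flat1_ge0. Qed.

Lemma bump_le1 x : bump x <= 1.
Proof. by rewrite -[leRHS]mul1r ler_pM ?flat1_ge0 ?flat1_le1. Qed.

Lemma bump_out x : ~~ (0 < x < 1) -> bump x = 0.
Proof.
rewrite negb_and -!leNgt /bump /flat => /orP[x0|x1].
  by rewrite ltNge x0 mul0r.
by rewrite [X in _ * X]ifF ?mulr0//; apply/negbTE; rewrite -leNgt; lra.
Qed.

Lemma bump_gt0 x : 0 < x -> x < 1 -> 0 < bump x.
Proof.
move=> x0 x1; rewrite /bump /flat x0 ifT; last lra.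
by rewrite !hornerC !mul1r mulr_gt0 ?expR_gt0.
Qed.

Lemma bump_Cn n : Cn n bump.
Proof. by apply: CnM; [exact: flat_Cn|apply: Cn_affine; exact: flat_Cn]. Qed.

Lemma bump_continuous : continuous bump.
Proof. exact: Cn_continuous (bump_Cn 0). Qed.

Lemma L1_bump : L1 bump.
Proof.
apply: (@L1_dom R _ (\1_(`[0, 1]%classic : set R))).
- exact: continuous_measurable_fun bump_continuous.
- by apply: integrable_indic_itv.
- move=> x; rewrite ger0_norm ?bump_ge0// indicE.
  have [|nx] := boolP (x \in _); first by rewrite bump_le1.
  rewrite bump_out//; apply: contra nx => /andP[x0 x1].
  by rewrite inE/= in_itv/= !ltW.
Qed.

Lemma prim_bump_is_derive (x : R) : is_derive x 1 (prim bump) (bump x).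
Proof. exact: prim_is_derive_continuous L1_bump bump_continuous x. Qed.

Lemma prim_bump_le0 x : x <= 0 -> prim bump x = 0.
Proof.
move=> x0; rewrite prim.unlock (@eq_Rintegral _ _ _ _ _ (cst 0)) ?Rintegral_cst ?mul0r//.
move=> q; rewrite inE/= in_itv/= => qx; rewrite bump_out//.
by rewrite negb_and -!leNgt (le_trans qx).
Qed.

Lemma prim_bump_ge1 x : 1 <= x -> prim bump x = prim bump 1.
Proof.
move=> x1; apply/eqP; rewrite -subr_eq0 primB//; last exact: L1_bump.
rewrite (@eq_Rintegral _ _ _ _ _ (cst 0)) ?Rintegral_cst ?mul0r//.
move=> q; rewrite inE/= in_itv/= => /andP[q1 _]; rewrite bump_out//.
by rewrite negb_and -!leNgt (ltW q1) orbT.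
Qed.

Lemma prim_bump_gt0 : 0 < prim bump 1.
Proof.
rewrite -(prim_bump_le0 (lexx 0)).
apply: (@gtr0_derive1_lt_cc R (prim bump) 0 1) => //; rewrite ?in_itv/= ?ltr01 ?lexx ?ler01//.
- by move=> x _; have [] := prim_bump_is_derive x.
- move=> x; rewrite in_itv/= => /andP[x0 x1]; rewrite derive1E.
  by have [_ ->] := prim_bump_is_derive x; exact: bump_gt0.
- by apply: continuous_subspaceT; exact: prim_continuous L1_bump.
Qed.

Local Notation c0 := (prim bump 1).

(** The normalised primitive of the bump rises smoothly from 0 to 1 between
    0 and 1. *)
Definition sstep (x : R) : R := prim bump x / c0.
Definition dsstep (x : R) : R := bump x / c0.

Lemma sstep_is_derive (x : R) : is_derive x 1 sstep (dsstep x).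
Proof.
have := @is_deriveZ _ _ _ (prim bump) c0^-1 x 1 _ (prim_bump_is_derive x).
rewrite /dsstep mulrC; congr is_derive.
by apply/funext => y; rewrite /sstep mulrC.
Qed.

Lemma dsstep_Cn n : Cn n dsstep.
Proof. by apply: CnM; [exact: bump_Cn|exact: (Cn_cst n)]. Qed.

Lemma sstep_continuous : continuous sstep.
Proof.
by move=> x; apply: differentiable_continuous; apply/derivable1_diffP; have [] := sstep_is_derive x.
Qed.

Lemma sstep_Cn n : Cn n sstep.
Proof.
case: n => [|n]; split; try exact: sstep_continuous; first by [].
by exists dsstep; [exact: sstep_is_derive|exact: dsstep_Cn].
Qed.

Lemma sstep_nd : {homo sstep : x y / x <= y}.
Proof.
move=> x y xy; rewrite ler_pM2r ?invr_gt0 ?prim_bump_gt0//.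
exact: (prim_nd L1_bump bump_ge0).
Qed.

Lemma sstep0 x : x <= 0 -> sstep x = 0.
Proof. by move=> x0; rewrite /sstep prim_bump_le0// mul0r. Qed.

Lemma sstep1 x : 1 <= x -> sstep x = 1.
Proof. by move=> x1; rewrite /sstep prim_bump_ge1// divff// gt_eqF// prim_bump_gt0. Qed.

Lemma sstep_ge0 x : 0 <= sstep x.
Proof.
by rewrite -(sstep0 (_ : Num.min x 0 <= 0)) ?sstep_nd ?ge_min ?lexx ?orbT.
Qed.

Lemma sstep_le1 x : sstep x <= 1.
Proof.
by rewrite -(sstep1 (_ : 1 <= Num.max x 1)) ?sstep_nd ?le_max ?lexx ?orbT.
Qed.

Lemma dsstep_ge0 x : 0 <= dsstep x.
Proof. by rewrite divr_ge0 ?bump_ge0// ltW// prim_bump_gt0. Qed.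

Lemma dsstep_out x : ~~ (0 < x < 1) -> dsstep x = 0.
Proof. by move=> h; rewrite /dsstep bump_out// mul0r. Qed.

(** Differences of shifted steps telescope, which turns the integer
    translates of hat into a partition of unity. *)
Definition hat (x : R) : R := sstep (1 * x + 1) - sstep x.
Definition dhat (x : R) : R := dsstep (1 * x + 1) - dsstep x.

Lemma hat_is_derive (x : R) : is_derive x 1 hat (dhat x).
Proof.
have h1 := is_derive_affine (sstep_is_derive (1 * x + 1)).
have := @is_deriveB _ _ _ _ _ x 1 _ _ h1 (sstep_is_derive x).
by rewrite mul1r.
Qed.

Lemma hat_Cn n : Cn n hat.
Proof.
have -> : hat = fun x => sstep (1 * x + 1) + (-1) * sstep x.
  by apply/funext => x; rewrite mulN1r.
apply: CnD; first by apply: Cn_affine; exact: sstep_Cn.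
by apply: CnM; [exact: Cn_cst|exact: sstep_Cn].
Qed.

Lemma hat_ge0 x : 0 <= hat x.
Proof. by rewrite subr_ge0 sstep_nd// mul1r lerDl. Qed.

Lemma hat_out x : 1 <= `|x| -> hat x = 0 /\ dhat x = 0.
Proof.
move=> x1; rewrite /hat /dhat mul1r.
have [x0|x0] := leP 0 x.
  rewrite ger0_norm// in x1; rewrite !sstep1 ?subrr; [|lra|lra].
  by rewrite !dsstep_out ?subrr// negb_and -!leNgt; apply/orP; right; lra.
rewrite ltr0_norm// in x1; rewrite !sstep0 ?subrr; [|lra|lra].
by rewrite !dsstep_out ?subrr// negb_and -!leNgt; apply/orP; left; lra.
Qed.

Lemma sum_hat (M N : nat) (x : R) :
  \sum_(j < M) hat (x - (j%:R - N%:R)) = sstep (x + N%:R + 1) - sstep (x + N%:R + 1 - M%:R).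
Proof.
elim: M => [|M IH]; first by rewrite big_ord0 subr0 subrr.
rewrite big_ord_recr/= IH /hat mul1r -natr1.
have -> : x - (M%:R - N%:R) + 1 = x + N%:R + 1 - M%:R by ring.
have -> : x - (M%:R - N%:R) = x + N%:R + 1 - (M%:R + 1) by ring.
ring.
Qed.

Lemma sum_hat1 (N : nat) (x : R) : `|x| <= N%:R ->
  \sum_(j < (N + N).+1) hat (x - (j%:R - N%:R)) = 1.
Proof.
rewrite ler_norml => /andP[x1 x2]; rewrite sum_hat sstep1; last lra.
by rewrite sstep0 ?subr0// -natr1 natrD; lra.
Qed.

Lemma sum_hat_le (M N : nat) (x : R) :
  \sum_(j < M) hat (x - (j%:R - N%:R)) <= 1.
Proof. by rewrite sum_hat; have := sstep_le1 (x + N%:R + 1); have := sstep_ge0 (x + N%:R + 1 - M%:R); lra. Qed.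

Lemma sum_bump_le1 (M : nat) (x : R) : \sum_(j < M) bump (x - j%:R) <= 1.
Proof.
have [[j hj]|H] := pselect (exists j : 'I_M, 0 < x - j%:R < 1); last first.
  rewrite big1// => j _; apply: bump_out; apply/negP => hj; apply: H; by exists j.
rewrite (bigD1 j)//= big1 ?addr0 ?bump_le1// => i ij; apply: bump_out.
apply/negP => hi; move/eqP : ij; apply; apply/val_inj/eqP => /=.
move: hi hj => /andP[h1 h2] /andP[h3 h4].
have h5 : i%:R < j%:R + 1 :> R by lra.
have h6 : j%:R < i%:R + 1 :> R by lra.
by rewrite !natr1 !ltr_nat !ltnS in h5 h6; rewrite eqn_leq h5 h6.
Qed.

Lemma sum_dhat (M N : nat) (x : R) :
  \sum_(j < M) `|dhat (x - (j%:R - N%:R))| <= 2 / c0.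
Proof.
have c00 := prim_bump_gt0.
have h (y : R) : \sum_(j < M) dsstep (y - j%:R) <= c0^-1.
  rewrite -mulr_suml -[leRHS]mul1r ler_wpM2r ?invr_ge0 ?(ltW c00)//.
  exact: sum_bump_le1.
apply: (@le_trans _ _ (\sum_(j < M) (dsstep (x + N%:R + 1 - j%:R) + dsstep (x + N%:R - j%:R)))).
  apply: ler_sum => j _; rewrite /dhat mul1r.
  have -> : x - (j%:R - N%:R) + 1 = x + N%:R + 1 - j%:R by ring.
  have -> : x - (j%:R - N%:R) = x + N%:R - j%:R by ring.
  by apply: le_trans (ler_normB _ _) _; rewrite !ger0_norm ?dsstep_ge0.
rewrite big_split/=; have := h (x + N%:R + 1); have := h (x + N%:R).
by rewrite mulrDl mul1r; lra.
Qed.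

Lemma sum_dhat0 (N : nat) (x : R) : `|x| < N%:R ->
  \sum_(j < (N + N).+1) dhat (x - (j%:R - N%:R)) = 0.
Proof.
move=> xN.
have d1 : is_derive x 1 (\sum_(j < (N + N).+1) (fun y : R => hat (1 * y + (N%:R - j%:R))))
   (\sum_(j < (N + N).+1) 1 * dhat (1 * x + (N%:R - j%:R))).
  apply: is_derive_sum => j; apply: is_derive_affine; exact: hat_is_derive.
have E : \forall y \near x, cst 1 y =
    (\sum_(j < (N + N).+1) (fun y : R => hat (1 * y + (N%:R - j%:R)))) y.
  have e0 : 0 < N%:R - `|x| by rewrite subr_gt0.
  apply/nbhs_ballP; exists (N%:R - `|x|) => //= y; rewrite /ball/= => xy.
  rewrite fct_sumE -[LHS](@sum_hat1 N y).
    by apply: eq_bigr => j _; congr hat; ring.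
  have -> : y = x - (x - y) by ring.
  by apply: le_trans (ler_normB _ _) _; lra.
have d2 : is_derive x 1 (cst (1:R) : R -> R) (0:R) by exact: is_derive_cst.
have d3 := near_eq_is_derive E d2.
have := @derive_val _ _ _ _ _ _ _ d1; have := @derive_val _ _ _ _ _ _ _ d3 => -> h.
rewrite [RHS]h; apply: eq_bigr => j _; rewrite mul1r; congr dhat; ring.
Qed.

End step.

(** * Smooth approximation of functions with Lipschitz gradient *)

Section Ck_closure.
Context {R : realType} (U : normedModType R).
Implicit Types (f g : U -> R).

Lemma Ck_continuous k f : Ck k f -> continuous f.
Proof. by case: k => [[]|k []]. Qed.

Lemma CkW k f : Ck k.+1 f -> Ck k f.
Proof.
elim: k f => [|k IH] f [cf Hf]; first by split.
by split=> // u; have [df Hk] := Hf u; split=> //; exact: IH.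
Qed.

Lemma Ck_ext k f g : f =1 g -> Ck k f -> Ck k g.
Proof. by move=> /funext->. Qed.

Lemma Ck_cst k (c : R) : Ck k (fun _ : U => c).
Proof.
elim: k c => [|k IH] c; split=> //; try (by move=> x; exact: cvg_cst).
move=> u; split; first by move=> p; exact: derivable_cst.
by apply: Ck_ext (IH 0) => p; rewrite derive_cst.
Qed.

Lemma CkD k f g : Ck k f -> Ck k g -> Ck k (fun x => f x + g x).
Proof.
elim: k f g => [|k IH] f g Hf Hg.
  by split=> // x; apply: cvgD; [exact: Hf.1|exact: Hg.1].
split; first by move=> x; apply: cvgD; [exact: Hf.1|exact: Hg.1].
move=> u; have [_ /(_ u)[df Hf']] := Hf; have [_ /(_ u)[dg Hg']] := Hg.
split; first by move=> p; exact: derivableD.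
by apply: Ck_ext (IH _ _ Hf' Hg') => p; rewrite -deriveD.
Qed.

Lemma CkM k f g : Ck k f -> Ck k g -> Ck k (fun x => f x * g x).
Proof.
elim: k f g => [|k IH] f g Hf Hg.
  by split=> // x; apply: cvgM; [exact: Hf.1|exact: Hg.1].
split; first by move=> x; apply: cvgM; [exact: Hf.1|exact: Hg.1].
move=> u; have [_ /(_ u)[df Hf']] := Hf; have [_ /(_ u)[dg Hg']] := Hg.
split; first by move=> p; exact: derivableM.
apply: (@Ck_ext _ (fun p => f p * 'D_u g p + g p * 'D_u f p)).
  by move=> p; rewrite -deriveM.
by apply: CkD; apply: IH => //; exact: CkW.
Qed.

Lemma Ck_sum k (I : Type) (s : seq I) (F : I -> U -> R) :
  (forall i, Ck k (F i)) -> Ck k (fun x => \sum_(i <- s) F i x).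
Proof.
move=> H; elim: s => [|i s IH].
  by apply: Ck_ext (Ck_cst k 0) => x; rewrite big_nil.
by apply: Ck_ext (CkD (H i) IH) => x; rewrite big_cons.
Qed.

Lemma Ck_prod k (I : Type) (s : seq I) (F : I -> U -> R) :
  (forall i, Ck k (F i)) -> Ck k (fun x => \prod_(i <- s) F i x).
Proof.
move=> H; elim: s => [|i s IH].
  by apply: Ck_ext (Ck_cst k 1) => x; rewrite big_nil.
by apply: Ck_ext (CkM (H i) IH) => x; rewrite big_cons.
Qed.

(** The function l is affine with linear part c. *)
Definition affine_with (l c : U -> R) : Prop :=
  continuous l /\ forall p u (h : R), l (h *: u + p) = l p + h * c u.

Lemma is_derive_comp_affine (phi : R -> R) (l c : U -> R) p u a :
  affine_with l c -> is_derive (l p) 1 phi a ->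
  is_derive p u (fun q => phi (l q)) (c u * a).
Proof.
move=> [cl Hl] dphi.
have d1 : is_derive (0 : R) 1 (fun h : R => phi (c u * h + l p)) (c u * a).
  by apply: is_derive_affine; rewrite mulr0 add0r.
have E : (fun h : R => h^-1 *: (((fun q => phi (l q)) \o shift p) (h *: u) - phi (l p))) =
   (fun h : R => h^-1 *: (((fun h : R => phi (c u * h + l p)) \o shift 0) (h *: 1) -
      phi (c u * 0 + l p))).
  apply/funext => h /=; rewrite Hl addr0 mulr0 add0r [h%:A]mulr1.
  by rewrite (addrC (l p)) (mulrC h).
have [dd vd] := d1.
apply: DeriveDef; first by rewrite /derivable E.
by rewrite /derive E.
Qed.

Lemma Ck_comp_affine k (phi : R -> R) (l c : U -> R) :
  affine_with l c -> Cn k phi -> Ck k (fun q => phi (l q)).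
Proof.
move=> Hl; elim: k phi => [|k IH] phi [cphi Hphi].
  by split=> // p; apply: continuous_comp; [exact: Hl.1|exact: cphi].
split.
  by move=> p; apply: continuous_comp; [exact: Hl.1|exact: cphi].
have [phi' dphi Hphi'] := Hphi.
have dd p u := is_derive_comp_affine u Hl (dphi (l p)).
move=> u; split; first by move=> p; have [] := dd p u.
apply: (@Ck_ext _ (fun q => c u * phi' (l q))).
  by move=> p; have [_ ->] := dd p u.
by apply: CkM; [exact: Ck_cst|exact: IH].
Qed.

Lemma is_derive_prod0 (I : eqType) (s : seq I) (F : I -> U -> R) p u :
  (forall i, i \in s -> is_derive p u (F i) 0) ->
  is_derive p u (fun x => \prod_(i <- s) F i x) 0.
Proof.
elim: s => [|i s IH] H.
  rewrite (_ : (fun _ => _) = cst 1); last by apply/funext => x; rewrite big_nil.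
  exact: is_derive_cst.
rewrite (_ : (fun _ => _) = F i * (fun x => \prod_(j <- s) F j x)); last first.
  by apply/funext => x; rewrite big_cons.
have h1 : is_derive p u (F i) 0 by apply: H; rewrite mem_head.
have h2 : is_derive p u (fun x => \prod_(j <- s) F j x) 0.
  by apply: IH => j js; apply: H; rewrite inE js orbT.
by have := is_deriveM h1 h2; rewrite !scaler0 addr0.
Qed.

(** For a tensor product, differentiation along a coordinate direction falls
    on one factor. *)
Lemma is_derive_prod1 (d : nat) (F : 'I_d -> U -> R) p u i a :
  is_derive p u (F i) a -> (forall j, j != i -> is_derive p u (F j) 0) ->
  is_derive p u (fun x => \prod_j F j x) (a * \prod_(j | j != i) F j p).
Proof.
move=> hi hj.
have h0 : is_derive p u (fun x => \prod_(j <- [seq j <- index_enum 'I_d | j != i]) F j x) 0.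
  by apply: is_derive_prod0 => j; rewrite mem_filter => /andP[ji _]; exact: hj.
have := is_deriveM hi h0; rewrite scaler0 add0r /GRing.scale/= mulrC.
rewrite big_filter; congr is_derive; last by rewrite mulrC.
by apply/funext => x; rewrite [RHS](bigD1 i)//= [RHS]mulrC -big_filter.
Qed.

End Ck_closure.

Section c11.
Context {R : realType} {d : nat}.
Local Notation V := 'rV[R]_d.

Lemma dot_le (a b : V) : `|dot a b| <= d%:R * (`|a| * `|b|).
Proof.
apply: le_trans (ler_norm_sum _ _ _) _.
apply: (@le_trans _ _ (\sum_(i < d) `|a| * `|b|)).
  by apply: ler_sum => i _; rewrite normrM ler_pM ?rV_coord_le.
by rewrite sumr_const card_ord -[leLHS]mulr_natl.
Qed.

Lemma dotDl (a b c : V) : dot (a + b) c = dot a c + dot b c.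
Proof. by rewrite /dot -big_split/=; apply: eq_bigr => i _; rewrite mxE mulrDl. Qed.

Lemma dotDr (a b c : V) : dot a (b + c) = dot a b + dot a c.
Proof. by rewrite /dot -big_split/=; apply: eq_bigr => i _; rewrite mxE mulrDr. Qed.

Lemma dotNl (a b : V) : dot (- a) b = - dot a b.
Proof. by rewrite /dot -sumrN; apply: eq_bigr => i _; rewrite mxE mulNr. Qed.

Lemma dotNr (a b : V) : dot a (- b) = - dot a b.
Proof. by rewrite /dot -sumrN; apply: eq_bigr => i _; rewrite mxE mulrN. Qed.

Lemma dotZl (k : R) (a b : V) : dot (k *: a) b = k * dot a b.
Proof. by rewrite /dot mulr_sumr; apply: eq_bigr => i _; rewrite mxE mulrA. Qed.

Lemma dot0l (a : V) : dot 0 a = 0.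
Proof. by rewrite /dot big1// => i _; rewrite mxE mul0r. Qed.

(** Functions of class C^{1,1} supported in the ball of radius rho. Taylor's
    formula with a quadratic remainder stands for differentiability with
    gradient D. *)
Record c11 (h : V -> R) (D : V -> V) (C rho : R) : Prop := {
  c11_taylor : forall x y, `|h y - h x - dot (D x) (y - x)| <= C * `|y - x| ^+ 2;
  c11_lip : forall x y, `|D x - D y| <= C * `|x - y|;
  c11_out : forall x, rho < `|x| -> h x = 0 /\ D x = 0 }.

Lemma c11_C0 h D C rho : c11 h D C rho -> (1 <= d)%N -> 0 <= C.
Proof.
move=> H d1; have := c11_lip H 0 (const_mx 1); rewrite sub0r normrN => h1.
have p : 0 < `|const_mx 1 : V|.
  rewrite normr_gt0; apply/eqP => /rowP/(_ (Ordinal d1)); rewrite !mxE.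
  by apply/eqP; rewrite oner_eq0.
by rewrite -(pmulr_lge0 _ p); apply: le_trans h1.
Qed.

Lemma is_derive_sum_seq (U : normedModType R) (I : Type) (s : seq I) (F : I -> U -> R)
    (dF : I -> R) p u : (forall i, is_derive p u (F i) (dF i)) ->
  is_derive p u (fun x => \sum_(i <- s) F i x) (\sum_(i <- s) dF i).
Proof.
move=> H; elim: s => [|i s IH].
  rewrite big_nil (_ : (fun _ => _) = cst 0); last by apply/funext => x; rewrite big_nil.
  exact: is_derive_cst.
rewrite big_cons (_ : (fun _ => _) = F i + (fun x => \sum_(j <- s) F j x)).
  exact: is_deriveD.
by apply/funext => x; rewrite big_cons.
Qed.

Section glue.
Variables (N : nat) (dl : R) (h : V -> R) (D : V -> V).
Local Notation K := ('I_(N + N).+1).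
Local Notation idx := {ffun 'I_d -> K}.

Definition node (k : idx) : V := \row_i (dl * ((k i)%:R - N%:R)).
Definition taylor (k : idx) (x : V) : R := h (node k) + dot (D (node k)) (x - node k).
Definition hatk (k : idx) (x : V) : R :=
  \prod_i hat (dl^-1 * x 0 i - ((k i)%:R - N%:R)).
Definition dhatk (i : 'I_d) (k : idx) (x : V) : R :=
  dl^-1 * \prod_j (if j == i then dhat else hat) (dl^-1 * x 0 j - ((k j)%:R - N%:R)).

(** The Taylor polynomials of h at the nodes of a grid of mesh dl, glued by
    the partition of unity made of products of hats. It is smooth because
    the polynomials and the hats are. *)
Definition glue (x : V) : R := \sum_k taylor k x * hatk k x.
Definition dglue (x : V) : V :=
  \row_i \sum_k (D (node k) 0 i * hatk k x + taylor k x * dhatk i k x).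

Definition glue_test (alpha : R -> R) (p : R * V) : R := alpha p.1 * glue p.2.

Lemma affine_fst : affine_with (fun p : R * V => p.1) (fun u : R * V => u.1).
Proof.
split; first by move=> p; exact: cvg_fst.
by move=> p u t /=; rewrite addrC.
Qed.

Lemma affine_coord (a b : R) i : affine_with (fun p : R * V => a * p.2 0 i + b)
  (fun u : R * V => a * u.2 0 i).
Proof.
split.
  move=> p; apply: cvgD; last exact: cvg_cst.
  apply: cvgM; first exact: cvg_cst.
  apply: (@continuous_comp _ _ _ (fun p : R * V => p.2) (fun x : V => x 0 i)); first exact: cvg_snd.
  exact: coord_continuous.
by move=> p u t /=; rewrite !mxE; ring.
Qed.

Lemma Cn_id n : Cn n (@idfun R).
Proof.
case: n => [|n]; split; try (by move=> x; exact: cvg_id); first by [].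
by exists (cst 1) => [x|]; [exact: is_derive_id|exact: Cn_cst].
Qed.

Lemma glue_test_Ck alpha n : (forall n, Cn n alpha) -> Ck n (glue_test alpha).
Proof.
move=> ca; apply: CkM; first exact: (Ck_comp_affine affine_fst).
apply: Ck_sum => k; apply: CkM.
  apply: CkD; first exact: Ck_cst.
  apply: Ck_sum => i; apply: CkM; first exact: Ck_cst.
  have := Ck_comp_affine (affine_coord 1 (- node k 0 i) i) (Cn_id n).
  by apply: Ck_ext => p; rewrite /= mul1r !mxE.
apply: Ck_prod => i.
have := Ck_comp_affine (affine_coord dl^-1 (N%:R - (k i)%:R) i) (hat_Cn n).
by apply: Ck_ext => p; rewrite opprB.
Qed.

Lemma glue_time_derivative (p : R * V) :
  is_derive p ((1, 0) : R * V) (fun q : R * V => glue q.2) 0.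
Proof.
have E : (fun h0 : R => h0^-1 *: (((fun q : R * V => glue q.2) \o shift p) (h0 *: ((1, 0) : R * V))
    - glue p.2)) = cst 0.
  by apply/funext => t /=; rewrite scaler0 add0r subrr scaler0.
apply: DeriveDef; first by rewrite /derivable E; exact: is_cvg_cst.
by rewrite /derive E; apply: cvg_lim => //; exact: cvg_cst.
Qed.

Lemma is_derive_coord_fun (p : R * V) i j :
  is_derive p ((0, delta_mx 0 i) : R * V) (fun q : R * V => q.2 0 j) ((j == i)%:R).
Proof.
have := is_derive_comp_affine ((0, delta_mx 0 i) : R * V) (affine_coord 1 0 j)
  (is_derive_id (1 * p.2 0 j + 0 : R) 1).
rewrite !mxE eqxx/= mulr1 mul1r; congr is_derive.
by apply/funext => q; rewrite mul1r addr0.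
Qed.

Lemma glue_space_derivative (p : R * V) i :
  is_derive p ((0, delta_mx 0 i) : R * V) (fun q : R * V => glue q.2) (dglue p.2 0 i).
Proof.
pose e : R * V := (0, delta_mx 0 i).
have dT k : is_derive p e (fun q : R * V => taylor k q.2) (D (node k) 0 i).
  have H : is_derive p e (cst (h (node k)) + \sum_(j < d) (fun q : R * V => D (node k) 0 j *: (q.2 0 j - node k 0 j)))
     (0 + \sum_(j < d) D (node k) 0 j *: ((j == i)%:R - 0)).
    apply: is_deriveD; apply: is_derive_sum => j; apply: is_deriveZ.
    by apply: is_deriveB; exact: is_derive_coord_fun.
  move: H; congr is_derive.
    apply/funext => q; rewrite /taylor /dot [LHS]/= fctE/= fct_sumE; congr (_ + _).
    by apply: eq_bigr => j _; rewrite !mxE.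
  rewrite add0r (bigD1 i)//= eqxx subr0 /GRing.scale/= mulr1 big1 ?addr0// => j /negbTE->.
  by rewrite subr0 mulr0.
have dh k : is_derive p e (fun q : R * V => hatk k q.2) (dhatk i k p.2).
  have H : is_derive p e (fun q : R * V => \prod_j hat (dl^-1 * q.2 0 j + (N%:R - (k j)%:R)))
     (dl^-1 * dhat (dl^-1 * p.2 0 i + (N%:R - (k i)%:R)) *
      \prod_(j | j != i) hat (dl^-1 * p.2 0 j + (N%:R - (k j)%:R))).
    apply: (is_derive_prod1 (F := fun j (q : R * V) => hat (dl^-1 * q.2 0 j + (N%:R - (k j)%:R)))).
      have := is_derive_comp_affine e (affine_coord dl^-1 (N%:R - (k i)%:R) i) (hat_is_derive _).
      by rewrite /e/= mxE !eqxx/= mulr1.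
    move=> j ji.
    have := is_derive_comp_affine e (affine_coord dl^-1 (N%:R - (k j)%:R) j)
      (hat_is_derive (dl^-1 * p.2 0 j + (N%:R - (k j)%:R))).
    by rewrite /e/= mxE (negbTE ji) andbF mulr0 mul0r.
  move: H; congr is_derive.
    by apply/funext => q; apply: eq_bigr => j _; rewrite opprB.
  rewrite /dhatk [in RHS](bigD1 i)//= eqxx opprB mulrA; congr (_ * _).
  by apply: eq_bigr => j /negbTE->; rewrite opprB.
have -> : (fun q : R * V => glue q.2) = (fun q : R * V => \sum_k (taylor k q.2 * hatk k q.2)) by [].
rewrite mxE.
apply: is_derive_sum_seq => k.
have := is_deriveM (dT k) (dh k).
rewrite /GRing.scale/= addrC (mulrC (hatk k p.2)); congr is_derive.
Qed.

End glue.
End c11.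

Section glue_estimates.
Context {R : realType} {d : nat}.
Local Notation V := 'rV[R]_d.
Variables (h : V -> R) (D : V -> V) (C rho : R) (N : nat) (dl : R).
Hypotheses (H : c11 h D C rho) (C0 : 0 <= C) (dl0 : 0 < dl) (Ndl : rho + dl + dl < N%:R * dl).
Local Notation K := ('I_(N + N).+1).
Local Notation idx := {ffun 'I_d -> K}.
Local Notation hatk := (@hatk R d N dl).
Local Notation dhatk := (@dhatk R d N dl).
Local Notation node := (@node R d N dl).
Local Notation taylor := (taylor dl h D).
Local Notation glue := (glue N dl h D).
Local Notation dglue := (dglue N dl h D).

Lemma hatk_ge0 k x : 0 <= hatk k x.
Proof. by apply: prodr_ge0 => i _; exact: hat_ge0. Qed.

Lemma scaled_coord (x : V) i : `|x| < N%:R * dl -> `|dl^-1 * x 0 i| < N%:R.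
Proof.
move=> xN; rewrite normrM gtr0_norm ?invr_gt0// mulrC ltr_pdivrMr//.
by apply: le_lt_trans xN; exact: rV_coord_le.
Qed.

Lemma sum_hatk (x : V) : `|x| < N%:R * dl -> \sum_k hatk k x = 1.
Proof.
move=> xN.
rewrite -(bigA_distr_bigA (fun i (m : K) => hat (dl^-1 * x 0 i - (m%:R - N%:R)))).
by rewrite big1// => i _; apply: sum_hat1; apply: ltW; exact: scaled_coord.
Qed.

Lemma sum_dhatk i (x : V) : `|x| < N%:R * dl -> \sum_k dhatk i k x = 0.
Proof.
move=> xN; rewrite -mulr_sumr.
rewrite -(bigA_distr_bigA (fun j (m : K) => (if j == i then dhat else hat) (dl^-1 * x 0 j - (m%:R - N%:R)))).
by rewrite (bigD1 i)//= eqxx sum_dhat0 ?mul0r ?mulr0//; exact: scaled_coord.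
Qed.

Lemma sum_dhatk_norm i (x : V) :
  \sum_k `|dhatk i k x| <= dl^-1 * (2 / prim bump 1).
Proof.
rewrite (eq_bigr (fun k : idx => dl^-1 * \prod_j `|(if j == i then dhat else hat)
    (dl^-1 * x 0 j - ((k j)%:R - N%:R))|)); last first.
  by move=> k _; rewrite normrM gtr0_norm ?invr_gt0// normr_prod.
rewrite -mulr_sumr ler_pM2l ?invr_gt0//.
rewrite -(bigA_distr_bigA (fun j (m : K) => `|(if j == i then dhat else hat) (dl^-1 * x 0 j - (m%:R - N%:R))|)).
rewrite (bigD1 i)//= eqxx -[leRHS]mulr1.
suff /andP[p0 p1] : 0 <= \prod_(j < d | j != i) \sum_(m < (N + N).+1)
    `|(if j == i then dhat else hat) (dl^-1 * x 0 j - (m%:R - N%:R))| <= 1.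
  by apply: ler_pM => //; [exact: sumr_ge0|exact: sum_dhat].
apply: (@big_ind _ (fun y : R => 0 <= y <= 1)) => [|y z /andP[y0 y1] /andP[z0 z1]|j /negbTE->].
- by rewrite ler01 lexx.
- by rewrite mulr_ge0//= mulr_ile1.
rewrite sumr_ge0//=; apply: le_trans (sum_hat_le (N + N).+1 N (dl^-1 * x 0 j)).
by apply: ler_sum => m _; rewrite ger0_norm// hat_ge0.
Qed.

Lemma near_node (k : idx) (x : V) : (forall i, `|dl^-1 * x 0 i - ((k i)%:R - N%:R)| < 1) ->
  `|x - node k| <= dl.
Proof.
move=> hx; apply: rV_norm_le; first exact: ltW.
move=> i; rewrite !mxE; have := hx i.
have -> : x 0 i - dl * ((k i)%:R - N%:R) = dl * (dl^-1 * x 0 i - ((k i)%:R - N%:R)).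
  by rewrite [RHS]mulrBr mulrA mulfV ?mul1r// gt_eqF.
by move=> h1; rewrite normrM gtr0_norm// -[leRHS]mulr1 ler_pM2l// ltW.
Qed.

Lemma far_coord (k : idx) (x : V) : dl < `|x - node k| ->
  exists j, 1 <= `|dl^-1 * x 0 j - ((k j)%:R - N%:R)|.
Proof.
move=> far; apply: contrapT => no; move: far; apply/negP; rewrite -leNgt; apply: near_node => j.
by rewrite ltNge; apply/negP => hj; apply: no; exists j.
Qed.

Lemma far_hatk k x : dl < `|x - node k| -> hatk k x = 0.
Proof. by move=> /far_coord[j /hat_out[h1 _]]; rewrite /hatk (bigD1 j)//= h1 mul0r. Qed.

Lemma far_dhatk i k x : dl < `|x - node k| -> dhatk i k x = 0.
Proof.
move=> /far_coord[j /hat_out[h1 h2]].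
by rewrite /dhatk (bigD1 j)//=; case: ifP => _; rewrite ?h1 ?h2 mul0r mulr0.
Qed.

Lemma taylor_out k : rho < `|node k| -> forall x, taylor k x = 0 /\ D (node k) = 0.
Proof. by move=> /(c11_out H)[h1 h2] x; rewrite /taylor h1 h2 dot0l addr0. Qed.

Lemma glue_out (x : V) : rho + dl < `|x| -> glue x = 0 /\ dglue x = 0.
Proof.
move=> hx.
have far k : rho < `|node k| \/ dl < `|x - node k|.
  have [h1|h1] := ltP dl `|x - node k|; [by right|left].
  rewrite -(ltrD2r dl); apply: (lt_le_trans hx).
  by rewrite -[X in `|X|](subrK (node k)); apply: le_trans (ler_normD _ _) _; rewrite addrC lerD2l.
split.
  apply: big1 => k _; have [/taylor_out/(_ x)[-> _]|hf] := far k; first by rewrite mul0r.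
  by rewrite (far_hatk hf) mulr0.
apply/rowP => i; rewrite !mxE big1// => k _.
have [/taylor_out/(_ x)[-> ->]|hf] := far k.
  by rewrite mxE !mul0r addr0.
by rewrite (far_hatk hf) (far_dhatk _ hf) !mulr0 addr0.
Qed.

(** The hats sum to 1 and their derivatives to 0, so that h x and D x can be
    subtracted inside of the sums. On the support of a hat the Taylor
    polynomial is within C dl^2 of h, and the derivative of the hat costs a
    factor 1 / dl. *)
Lemma glue_close (x : V) : `|x| < N%:R * dl ->
  `|glue x - h x| <= C * dl ^+ 2 /\
  `|dglue x - D x| <= C * dl * (1 + 2 / prim bump 1).
Proof.
move=> hx.
have ht k : dl < `|x - node k| \/ `|taylor k x - h x| <= C * dl ^+ 2.
  have [h1|h1] := ltP dl `|x - node k|; [by left|right].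
  rewrite -normrN /taylor opprB opprD addrA.
  apply: le_trans (c11_taylor H _ _) _; apply: ler_wpM2l => //.
  by rewrite ler_sqr ?nnegrE// ltW.
split.
  have -> : glue x - h x = \sum_k (taylor k x - h x) * hatk k x.
    rewrite -[in LHS](mulr1 (h x)) -(sum_hatk hx) mulr_sumr -sumrB.
    by apply: eq_bigr => k _; rewrite mulrBl.
  apply: le_trans (ler_norm_sum _ _ _) _.
  rewrite -[leRHS]mulr1 -(sum_hatk hx) mulr_sumr; apply: ler_sum => k _.
  rewrite normrM (ger0_norm (hatk_ge0 _ _)).
  have [hf|hl] := ht k; last by apply: ler_wpM2r => //; exact: hatk_ge0.
  by rewrite (far_hatk hf) !mulr0.
have c00 := @prim_bump_gt0 R.
apply: rV_norm_le; first by rewrite mulr_ge0 ?mulr_ge0 ?addr_ge0 ?divr_ge0 ?(ltW dl0) ?(ltW c00).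
move=> i; rewrite !mxE.
have -> : \sum_k (D (node k) 0 i * hatk k x + taylor k x * dhatk i k x) - D x 0 i =
   \sum_k (D (node k) - D x) 0 i * hatk k x + \sum_k (taylor k x - h x) * dhatk i k x.
  rewrite big_split/= [X in _ = X + _](eq_bigr (fun k => D (node k) 0 i * hatk k x - D x 0 i * hatk k x)); last first.
    by move=> k _; rewrite !mxE mulrBl.
  rewrite [X in _ = _ + X](eq_bigr (fun k => taylor k x * dhatk i k x - h x * dhatk i k x)); last first.
    by move=> k _; rewrite mulrBl.
  rewrite [in RHS]sumrB -(mulr_sumr _ _ _ (D x 0 i)) sum_hatk// mulr1.
  by rewrite [in RHS]sumrB -(mulr_sumr _ _ _ (h x)) sum_dhatk// mulr0 subr0 addrAC.
rewrite mulrDr mulr1; apply: le_trans (ler_normD _ _) _; apply: lerD.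
  apply: le_trans (ler_norm_sum _ _ _) _.
  rewrite -[leRHS]mulr1 -(sum_hatk hx) mulr_sumr; apply: ler_sum => k _.
  rewrite normrM (ger0_norm (hatk_ge0 _ _)).
  have [hf|hn] := ltP dl `|x - node k|; first by rewrite (far_hatk hf) !mulr0.
  apply: ler_wpM2r; first exact: hatk_ge0.
  apply: le_trans (rV_coord_le _ _) _; apply: le_trans (c11_lip H _ _) _.
  by apply: ler_wpM2l => //; rewrite distrC.
apply: le_trans (ler_norm_sum _ _ _) _.
apply: (@le_trans _ _ (\sum_k C * dl ^+ 2 * `|dhatk i k x|)).
  apply: ler_sum => k _; rewrite normrM.
  by have [/far_dhatk->|hl] := ht k; [rewrite normr0 !mulr0|apply: ler_wpM2r].
rewrite -mulr_sumr; apply: le_trans (ler_wpM2l _ (sum_dhatk_norm i x)) _.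
  by rewrite mulr_ge0// sqr_ge0.
by rewrite expr2 !mulrA mulfK// gt_eqF.
Qed.

End glue_estimates.

Lemma c11_smooth_approx (R : realType) (d : nat) (h : 'rV[R]_d -> R) D C rho :
  (1 <= d)%N -> c11 h D C rho -> exists2 K : R, 0 <= K & forall dl : R, 0 < dl <= 1 ->
  exists N : nat,
   [/\ forall x, `|glue N dl h D x - h x| <= K * dl,
       forall x, `|dglue N dl h D x - D x| <= K * dl &
       forall x, rho + 1 < `|x| -> [/\ glue N dl h D x = 0, dglue N dl h D x = 0, h x = 0 & D x = 0]].
Proof.
move=> d1 H; have C0 := c11_C0 H d1; have c00 := @prim_bump_gt0 R.
have e0 : 0 <= 2 / prim bump 1 :> R by rewrite divr_ge0// ltW.
exists (C * (1 + 2 / prim bump 1)); first by rewrite mulr_ge0// addr_ge0.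
move=> dl /andP[dl0 dl1].
(* the grid has to reach beyond the support by more than one mesh *)
pose N := Num.bound `|(rho + dl + dl) / dl|.
have hN : rho + dl + dl < N%:R * dl.
  by rewrite -ltr_pdivrMr//; apply: le_lt_trans (ler_norm _) (archi_boundP _).
exists N.
have far (x : 'rV[R]_d) : rho + dl < `|x| -> [/\ glue N dl h D x = 0, dglue N dl h D x = 0, h x = 0 & D x = 0].
  move=> hx; have [-> ->] := glue_out N H dl0 hx.
  by have [|-> ->] := c11_out H (x := x); [apply: lt_trans hx; rewrite ltrDl|].
have cl (x : 'rV[R]_d) : `|x| < N%:R * dl \/ rho + dl < `|x|.
  have [h1|h1] := ltP `|x| (N%:R * dl); [by left|right].
  by apply: lt_le_trans h1; apply: lt_trans hN; rewrite ltrDl.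
split=> x.
- have [hx|/far[-> _ -> _]] := cl x; last first.
    by rewrite subrr normr0 mulr_ge0 ?mulr_ge0 ?addr_ge0 ?(ltW dl0).
  apply: le_trans (glue_close H C0 dl0 hx).1 _.
  rewrite -mulrA ler_wpM2l// expr2 ler_wpM2r ?(ltW dl0)//.
  by apply: le_trans dl1 _; rewrite lerDl.
- have [hx|/far[_ -> _ ->]] := cl x; last first.
    by rewrite subrr normr0 mulr_ge0 ?mulr_ge0 ?addr_ge0 ?(ltW dl0).
  by apply: le_trans (glue_close H C0 dl0 hx).2 _; rewrite mulrAC.
- by move=> hx; apply: far; apply: le_lt_trans hx; rewrite lerD2l.
Qed.

(** * Integrals of functions of unknown measurability *)

Section squeeze.
Context {R : realType} {dp : measure_display} {S : measurableType dp}.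
Variable m : {measure set S -> \bar R}.
Local Open Scope ereal_scope.

(** The integral of a nonnegative function is a supremum over the simple
    functions below it, hence is monotone even where measurability is
    unknown. *)
Lemma ge0_le_integral_any (D : set S) (f g : S -> \bar R) :
  (forall x, D x -> 0 <= f x) -> (forall x, D x -> 0 <= g x) ->
  (forall x, D x -> f x <= g x) -> \int[m]_(x in D) f x <= \int[m]_(x in D) g x.
Proof.
move=> f0 g0 fg; rewrite !ge0_integralE//; apply: le_ereal_sup => _ [h hf <-].
exists h => // x; apply: le_trans (hf x) _; rewrite !patchE; case: ifPn => // /set_mem Dx.
exact: fg.
Qed.

(** In the weak formulation the integral over space is a function f of time
    whose measurability is not known. Its positive and negative parts can
    nevertheless be compared with those of an integrable upper bound. *)
Lemma integral0_ae_le_ge0 (D : set S) (f hi : S -> \bar R) : measurable D ->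
  \int[m]_(x in D) f x = 0 -> m.-integrable D hi ->
  {ae m, forall x, D x -> f x <= hi x} -> 0 <= \int[m]_(x in D) hi x.
Proof.
move=> mD f0 Ihi [N [mN N0 sN]].
(* raising the bound to +oo on the null set makes it valid at every point *)
pose hN x := if x \in N then +oo else hi x.
have mh : measurable_fun D hi by have /integrableP[] := Ihi.
have mhN : measurable_fun D hN.
  apply: measurable_fun_if => //; last exact: measurable_funS mh.
  by apply: (measurable_fun_bool true); rewrite (_ : _ @^-1` _ = N); [exact: measurableI|];
    apply/seteqP; split => x /=; [move/set_mem|move/mem_set].
have fh x : D x -> f x <= hN x.
  rewrite /hN; case: ifPn => [_ _|/negP xN Dx]; first by rewrite leey.
  apply: contrapT => nfh; apply: xN; apply/mem_set; apply: sN => /(_ Dx); exact: nfh.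
have eqh : ae_eq m D hN hi.
  exists N; split=> // x /= h; apply: contrapT => xN; apply: h => _.
  by rewrite /hN ifF//; apply/negP => /set_mem.
have Ip : \int[m]_(x in D) hN^\+ x < +oo.
  rewrite (_ : integral _ _ _ = \int[m]_(x in D) hi^\+ x).
    by have := integrable_pos_fin_num mD Ihi; rewrite fin_numE ltey => /andP[].
  by apply: ae_eq_integral => //; [exact: measurable_funepos|exact: measurable_funepos|exact: ((ae_eq_funeposneg _ _ _ _).1 eqh).1].
have fp : \int[m]_(x in D) f^\+ x <= \int[m]_(x in D) hN^\+ x.
  apply: ge0_le_integral_any => // x Dx; rewrite !funeposE.
  by rewrite ge_max !le_max (fh x Dx) lexx orbT.
have fn : \int[m]_(x in D) hN^\- x <= \int[m]_(x in D) f^\- x.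
  apply: ge0_le_integral_any => // x Dx; rewrite !funenegE.
  by rewrite ge_max !le_max leeN2 (fh x Dx) lexx orbT.
rewrite -(@ae_eq_integral _ _ _ m D hi hN mD mhN mh eqh) integralE.
move: f0; rewrite integralE => f0.
have fpf : \int[m]_(x in D) f^\+ x \is a fin_num.
  by rewrite ge0_fin_numE ?(le_lt_trans fp)// integral_ge0.
have hpf : \int[m]_(x in D) hN^\+ x \is a fin_num by rewrite ge0_fin_numE ?integral_ge0.
rewrite sube_ge0 ?hpf ?orbT//; apply: (le_trans fn); apply: (le_trans _ fp).
move: f0 fpf; case: (integral _ _ f^\+) => // p; case: (integral _ _ f^\-) => //= q.
by move=> [/eqP]; rewrite subr_eq0 => /eqP ->.
Qed.

End squeeze.

(** * Cutoffs in time *)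

Section ramp.
Context {R : realType}.
Implicit Types (a b t : R).

Definition ramp (a dl t : R) : R := sstep (dl^-1 * t + - (a / dl)).
Definition dramp (a dl t : R) : R := dl^-1 * dsstep (dl^-1 * t + - (a / dl)).

Lemma ramp_is_derive a dl t : is_derive t 1 (ramp a dl) (dramp a dl t).
Proof. by apply: is_derive_affine; exact: sstep_is_derive. Qed.

Lemma ramp_Cn a dl n : Cn n (ramp a dl).
Proof. by apply: Cn_affine; exact: sstep_Cn. Qed.

Lemma dramp_continuous a dl : continuous (dramp a dl).
Proof.
have : Cn 0 (dramp a dl).
  by apply: CnM; [exact: Cn_cst|apply: Cn_affine; exact: dsstep_Cn].
exact: Cn_continuous.
Qed.

Lemma ramp_arg a dl t : 0 < dl -> dl^-1 * t + - (a / dl) = (t - a) / dl.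
Proof. by move=> dl0; rewrite mulrBl mulrC. Qed.

Lemma ramp0 a dl t : 0 < dl -> t <= a -> ramp a dl t = 0.
Proof.
by move=> dl0 ta; rewrite /ramp ramp_arg// sstep0// pmulr_lle0 ?invr_gt0// subr_le0.
Qed.

Lemma ramp1 a dl t : 0 < dl -> a + dl <= t -> ramp a dl t = 1.
Proof.
move=> dl0 ta; rewrite /ramp ramp_arg// sstep1// ler_pdivlMr// mul1r; lra.
Qed.

Lemma ramp_ge0 a dl t : 0 <= ramp a dl t. Proof. exact: sstep_ge0. Qed.
Lemma ramp_le1 a dl t : ramp a dl t <= 1. Proof. exact: sstep_le1. Qed.

Lemma ramp_shift a b dl t : 0 < dl -> a <= b -> ramp b dl t <= ramp a dl t.
Proof.
by move=> dl0 ab; apply: sstep_nd; rewrite lerD2l lerN2 ler_pM2r ?invr_gt0.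
Qed.

Lemma dramp_ge0 a dl t : 0 < dl -> 0 <= dramp a dl t.
Proof. by move=> dl0; rewrite mulr_ge0 ?dsstep_ge0// invr_ge0 ltW. Qed.

Lemma dramp_out a dl t : 0 < dl -> ~~ (a < t < a + dl) -> dramp a dl t = 0.
Proof.
move=> dl0 h; rewrite /dramp ramp_arg// dsstep_out ?mulr0//; apply: contra h.
by rewrite divr_gt0E// || (move=> /andP[h1 h2]; rewrite -subr_gt0 -(pmulr_lgt0 _ (_ : 0 < dl^-1)) ?invr_gt0//; move: h1; rewrite ltr_pdivrMr// mul1r in h2; move=> ->/=; lra).
Qed.

Lemma L1_continuous_supported a b (f : R -> R) : continuous f ->
  (forall t, ~~ (a <= t <= b) -> f t = 0) -> L1 f.
Proof.
move=> cf f0.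
have If : (@lebesgue_measure R).-integrable `[a, b] (EFin \o f).
  by apply: continuous_compact_integrable; [exact: segment_compact|exact: continuous_subspaceT].
have H := @integrable_mkcond _ _ _ (@lebesgue_measure R) `[a, b]%classic (EFin \o f) (measurable_itv _).
have := H.1 If; rewrite /L1; congr (integrable _ _); apply/funext => t; rewrite patchE.
by case: ifPn => //; rewrite notin_setE/= in_itv/= => /negP/f0->.
Qed.

Lemma L1_dramp a dl (I : R -> R) : 0 < dl -> continuous I -> L1 (fun t => dramp a dl t * I t).
Proof.
move=> dl0 cI; apply: (@L1_continuous_supported a (a + dl)).
  by move=> t; apply: cvgM; [exact: dramp_continuous|exact: cI].
move=> t h; rewrite dramp_out ?mul0r//; apply: contra h => /andP[h1 h2].
by rewrite !ltW.
Qed.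

Lemma L1_dramp1 a dl : 0 < dl -> L1 (dramp a dl).
Proof.
move=> dl0; apply: (@L1_continuous_supported a (a + dl)); first exact: dramp_continuous.
by move=> t h; apply: dramp_out => //; apply: contra h => /andP[h1 h2]; rewrite !ltW.
Qed.

Lemma prim_dramp a dl x y : 0 < dl -> x < y ->
  prim (dramp a dl) y - prim (dramp a dl) x = ramp a dl y - ramp a dl x.
Proof.
move=> dl0 xy.
exact: prim_antiderivative (L1_dramp1 a dl0) (@dramp_continuous a dl)
  (ramp_is_derive a dl) xy.
Qed.

Lemma prim_dramp_mul_le T a dl u (I : R -> R) : 0 < dl -> 0 < a -> a + dl < T -> continuous I ->
  (forall t, a < t < a + dl -> I t <= u) ->
  prim (fun t => dramp a dl t * I t) T - prim (fun t => dramp a dl t * I t) 0 <= u.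
Proof.
move=> dl0 a0 aT cI Hu; have Id := L1_dramp1 a dl0.
have T0 : 0 < T by apply: lt_trans aT; rewrite addr_gt0.
apply: (@le_trans _ _ (prim (fun t => u * dramp a dl t) T - prim (fun t => u * dramp a dl t) 0)).
  apply: prim_le; [exact: L1_dramp|exact: L1Z|exact: ltW|].
  move=> t _ _; have [/Hu hu|/(dramp_out dl0)->] := boolP (a < t < a + dl).
    by rewrite mulrC ler_wpM2r// dramp_ge0.
  by rewrite mulr0 mul0r.
rewrite (primZ u T Id) (primZ u 0 Id) -(mulrBr u) prim_dramp//.
by rewrite (ramp1 dl0 (ltW aT)) (ramp0 dl0 (ltW a0)) subr0 mulr1.
Qed.

Lemma prim_dramp_mul_ge T a dl u (I : R -> R) : 0 < dl -> 0 < a -> a + dl < T -> continuous I ->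
  (forall t, a < t < a + dl -> u <= I t) ->
  u <= prim (fun t => dramp a dl t * I t) T - prim (fun t => dramp a dl t * I t) 0.
Proof.
move=> dl0 a0 aT cI Hu.
have IJ : L1 (fun t => dramp a dl t * I t) by exact: L1_dramp.
have cN : continuous (fun t => - I t) by move=> t; apply: cvgN; exact: cI.
have := @prim_dramp_mul_le T a dl (- u) (fun t => - I t) dl0 a0 aT cN.
have -> : (fun t => dramp a dl t * - I t) = (fun t => (-1) * (dramp a dl t * I t)).
  by apply/funext => t; rewrite mulN1r mulrN.
rewrite (primZ _ T IJ) (primZ _ 0 IJ) -mulrBr mulN1r lerN2; apply=> t h.
by rewrite lerN2 Hu.
Qed.

Lemma prim_zero (f : R -> R) x y : L1 f -> x <= y -> (forall t, x < t -> t <= y -> f t = 0) ->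
  prim f y = prim f x.
Proof.
move=> If xy f0; apply/eqP; rewrite -subr_eq0 primB//.
rewrite (@eq_Rintegral _ _ _ _ _ (cst 0)) ?Rintegral_cst ?mul0r//.
by move=> q; rewrite inE/= in_itv/= => /andP[q1 q2]; exact: f0.
Qed.

(** As dl tends to 0, the derivative of the cutoff concentrates with mass 1
    just after a and with mass -1 just before b, while the cutoff itself
    tends to the indicator of the interval from a to b. Continuity of I and
    of the primitives of G and |G| bounds each of the six errors by e / 6. *)
Lemma cutoff_limit (T a b : R) (I G : R -> R) : 0 < a -> a < b -> b < T ->
  continuous I -> L1 G ->
  (forall dl, 0 < dl -> a + dl <= b - dl ->
    let f t := (dramp a dl t - dramp (b - dl) dl t) * I t +
               (ramp a dl t - ramp (b - dl) dl t) * G t in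
    0 <= prim f T - prim f 0) ->
  I b - I a <= prim G b - prim G a.
Proof.
move=> a0 ab bT cI IG H; apply/ler_addgt0Pr => e e0.
pose e1 := e / 6; have e10 : 0 < e1 by rewrite divr_gt0.
have IN : L1 (fun t => `|G t|) by have := IG; rewrite /L1; exact: integrable_norm.
have PG0 : continuous (prim G) by exact: prim_continuous.
have PN0 : continuous (prim (fun t => `|G t|)) by exact: prim_continuous.
have near (f : R -> R) (c : R) : continuous f -> exists2 dl : R, 0 < dl & forall t, `|t - c| <= dl -> `|f t - f c| <= e1.
  move=> cf; have /cvgrPdist_le/(_ _ e10)/nbhs_ballP[r r0 Hr] := cf c.
  exists (r / 2); first by rewrite divr_gt0.
  move=> t ht; rewrite distrC; apply: Hr; rewrite /ball/= distrC.
  by apply: le_lt_trans ht _; rewrite ltr_pdivrMr// ltr_pMr// ltr1n.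
have [d1 d10 h1] := near I a cI; have [d2 d20 h2] := near I b cI.
have [d3 d30 h3] := near _ a PG0; have [d4 d40 h4] := near _ b PG0.
have [d5 d50 h5] := near _ a PN0; have [d6 d60 h6] := near _ b PN0.
pose dl := Num.min ((b - a) / 2) (Num.min d1 (Num.min d2 (Num.min d3 (Num.min d4 (Num.min d5 d6))))).
have dl0 : 0 < dl by rewrite /dl !lt_min d10 d20 d30 d40 d50 d60 !andbT divr_gt0// subr_gt0.
have [dlab [dl1 [dl2 [dl3 [dl4 [dl5 dl6]]]]]] : dl <= (b - a) / 2 /\ dl <= d1 /\ dl <= d2 /\ dl <= d3 /\
    dl <= d4 /\ dl <= d5 /\ dl <= d6.
  by rewrite /dl !ge_min !lexx !orbT.
have abl : a + dl <= b - dl by move: dlab; rewrite ler_pdivlMr//; lra.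
have := H dl dl0 abl; cbv zeta.
pose fa t := dramp a dl t * I t; pose fb t := dramp (b - dl) dl t * I t.
pose al t := ramp a dl t - ramp (b - dl) dl t.
have al01 t : 0 <= al t <= 1.
  have abl' : a <= b - dl by apply: le_trans abl; rewrite lerDl ltW.
  have := ramp_shift t dl0 abl'; have := ramp_le1 a dl t; have := ramp_ge0 (b - dl) dl t.
  rewrite /al; clear; lra.
have Ifa : L1 fa by exact: L1_dramp.
have Ifb : L1 fb by exact: L1_dramp.
have cal : continuous al.
  by move=> t; apply: cvgB; [exact: (Cn_continuous (ramp_Cn _ _ 0))|exact: (Cn_continuous (ramp_Cn _ _ 0))].
have Ial : L1 (fun t => al t * G t).
  apply: (L1_dom _ IN).
    by apply: measurable_funM; [exact: continuous_measurable_fun|exact: L1_meas].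
  move=> t; rewrite normrM -[leRHS]mul1r ler_wpM2r//.
  by have /andP[p0 p1] := al01 t; rewrite ger0_norm.
have E t : prim (fun t => (dramp a dl t - dramp (b - dl) dl t) * I t + al t * G t) t =
    prim fa t - prim fb t + prim (fun t => al t * G t) t.
  rewrite -primDB// -primD//; last exact: L1B.
  by congr (prim _ t); apply/funext => q; rewrite mulrBl.
rewrite !E.
have T0 : 0 < T by apply: lt_trans bT; apply: lt_trans ab.
have A1 : prim fa T - prim fa 0 <= I a + e1.
  apply: prim_dramp_mul_le => //.
    by apply: le_lt_trans abl _; apply: lt_trans bT; rewrite ltrBlDr ltrDl.
  move=> t /andP[t1 t2]; have : `|I t - I a| <= e1.
    apply: h1; rewrite gtr0_norm ?subr_gt0// (le_trans _ dl1)//.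
    by rewrite lerBlDl ltW.
  by rewrite ler_norml lerBlDl => /andP[].
have A2 : I b - e1 <= prim fb T - prim fb 0.
  apply: prim_dramp_mul_ge => //; [|by rewrite subrK|].
    by apply: lt_le_trans abl; rewrite addr_gt0.
  rewrite subrK => t /andP[t1 t2]; have : `|I t - I b| <= e1.
    apply: h2; rewrite distrC gtr0_norm ?subr_gt0// (le_trans _ dl2)//.
    by rewrite lerBlDl addrC -lerBlDl ltW.
  by rewrite ler_norml lerBrDl => /andP[].
pose P := prim (fun t => al t * G t).
have z1 : P a = P 0.
  apply: prim_zero => //; first exact: ltW.
  by move=> t _ ta; rewrite /al !ramp0 ?subrr ?mul0r//; move: (dl0) (abl) (ta); clear; lra.
have z2 : P T = P b.
  apply: prim_zero => //; first exact: ltW.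
  by move=> t tb _; rewrite /al !ramp1 ?subrr ?mul0r//; move: (dl0) (abl) (tb); clear; lra.
have z3 : P (b - dl) - P (a + dl) = prim G (b - dl) - prim G (a + dl).
  rewrite !primB//; apply: eq_Rintegral => t; rewrite inE/= in_itv/= => /andP[t1 t2].
  by rewrite /al ramp1 ?ramp0 ?subr0 ?mul1r// ltW.
have z4 x y : x <= y -> P y - P x <= prim (fun t => `|G t|) y - prim (fun t => `|G t|) x.
  move=> xy; apply: prim_le => // t _ _; apply: le_trans (ler_norm _) _.
  rewrite normrM -[leRHS]mul1r ler_wpM2r//.
  by have /andP[p0 p1] := al01 t; rewrite ger0_norm.
have z5 : P (a + dl) - P a <= e1.
  apply: le_trans (z4 _ _ _) _; first by rewrite lerDl ltW.
  by apply: le_trans (ler_norm _) _; apply: h5; rewrite addrAC subrr add0r ger0_norm// ltW.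
have z6 : P b - P (b - dl) <= e1.
  apply: le_trans (z4 _ _ _) _; first by rewrite gerBl ltW.
  apply: le_trans (ler_norm _) _; rewrite distrC; apply: h6.
  by rewrite distrC opprB addrC subrK ger0_norm// ltW.
have z7 : `|prim G (a + dl) - prim G a| <= e1.
  by apply: h3; rewrite addrAC subrr add0r ger0_norm// ltW.
have z8 : `|prim G (b - dl) - prim G b| <= e1.
  by apply: h4; rewrite distrC opprB addrC subrK ger0_norm// ltW.
move: z7 z8; rewrite !ler_norml => /andP[z7 z7'] /andP[z8 z8'].
have e6 : e = e1 * 6 by rewrite /e1 divfK// pnatr_eq0.
rewrite -/(P T) -/(P 0); move: (A1) (A2) z1 z2 z3 z5 z6 z7 z8 z7' z8' e6; clear; lra.
Qed.

Lemma continuous_nonincreasing_ends (a b : R) (k : R -> R) : continuous k -> a < b ->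
  (forall x y, a < x -> x < y -> y < b -> k y <= k x) -> k b <= k a.
Proof.
move=> ck ab H; apply/ler_addgt0Pr => e e0.
have e2 : 0 < e / 2 by rewrite divr_gt0.
have /cvgrPdist_le/(_ _ e2)/nbhs_ballP[r r0 Hr] := ck a.
have /cvgrPdist_le/(_ _ e2)/nbhs_ballP[q q0 Hq] := ck b.
pose dl := Num.min ((b - a) / 3) (Num.min (r / 2) (q / 2)).
have dl0 : 0 < dl by rewrite /dl !lt_min !divr_gt0 ?subr_gt0.
have [dab [dr dq]] : dl <= (b - a) / 3 /\ dl <= r / 2 /\ dl <= q / 2.
  by rewrite /dl !ge_min !lexx !orbT.
move: dab dr dq; rewrite !ler_pdivlMr// => dab dr dq.
have h1 : k (b - dl) <= k (a + dl) by apply: H; lra.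
have h2 : `|k a - k (a + dl)| <= e / 2.
  by apply: Hr; rewrite /ball/= opprD addrA subrr sub0r normrN ger0_norm; lra.
have h3 : `|k b - k (b - dl)| <= e / 2.
  by apply: Hq; rewrite /ball/= opprB addrC subrK ger0_norm; lra.
move: h1 h2 h3; rewrite !ler_norml => h1 /andP[h2 _] /andP[_ h3].
have : e = e / 2 + e / 2 by rewrite -splitr.
move: (e / 2) h2 h3 => u h2 h3; lra.
Qed.

End ramp.

(** * The equation tested on functions with Lipschitz gradient *)

Lemma clip_continuous (R : realType) (a b : R) : a <= b -> continuous (clip a b).
Proof.
move=> ab; apply: (@lipschitz_continuous R R R (clip a b) 1) => x y.
by rewrite mul1r; exact: clip_contract.
Qed.

Lemma within_continuous_clip (R : realType) (a b : R) (f : R -> R) : a <= b ->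
  {within `[a, b], continuous f} -> continuous (fun t => f (clip a b t)).
Proof.
move=> ab cf q W /= hW.
have ci t : `[a, b]%classic (clip a b t) by rewrite /= in_itv/=; exact: clip_in.
have := cf (clip a b q) W hW; rewrite /nbhs/= -(nbhs_subspace_in (ci q)).
move=> hn; have h := clip_continuous ab (x := q) hn.
by apply: (@filterS _ (nbhs q) _ (clip a b @^-1` _) _ _ h) => t /(_ (ci t)).
Qed.

Section test_functions.
Context {R : realType} {d : nat}.
Local Notation V := 'rV[R]_d.

(** What a function g of space, with gradient dg, has to satisfy for the
    products alpha(t) g(x) to be smooth test functions. *)
Record smooth_pair (g : V -> R) (dg : V -> V) : Prop := {
  sp_Ck : forall alpha, (forall n, Cn n alpha) ->
    forall n, Ck n (fun p : R * V => alpha p.1 * g p.2);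
  sp_t : forall p, is_derive p ((1, 0) : R * V) (fun q : R * V => g q.2) 0;
  sp_x : forall p i, is_derive p ((0, delta_mx 0 i) : R * V) (fun q : R * V => g q.2)
    (dg p.2 0 i) }.

Lemma glue_smooth_pair N dl h D : smooth_pair (glue N dl h D) (dglue N dl h D : V -> V).
Proof.
by split=> *; [exact: glue_test_Ck|exact: glue_time_derivative|exact: glue_space_derivative].
Qed.

Variables (g : V -> R) (dg : V -> V).
Hypothesis sg : smooth_pair g dg.

Lemma smooth_pair_continuous : continuous g.
Proof.
have c : continuous (fun p : R * V => (cst 1 : R -> R) p.1 * g p.2).
  by apply: Ck_continuous; exact: (sp_Ck sg (fun n => Cn_cst n (1 : R)) 0).
have pc : continuous (fun x : V => (0 : R, x)).
  by move=> x; apply: (@cvg_pair _ _ _ (nbhs x) (nbhs (0 : R)) (nbhs x)); [exact: cvg_cst|exact: cvg_id].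
move=> x; have := c (0, x); rewrite /cst/= => cx.
have -> : g = (fun p : R * V => 1 * g p.2) \o (fun x => (0 : R, x)).
  by apply/funext => y; rewrite /= mul1r.
by apply: (@continuous_comp _ _ _ (fun x : V => (0 : R, x)) _ x); [exact: pc|].
Qed.

Lemma smooth_pair_grad_continuous i : continuous (fun x => dg x 0 i).
Proof.
have [_ /(_ ((0, delta_mx 0 i) : R * V))[_ [c _]]] :=
  sp_Ck sg (fun n => Cn_cst n (1 : R)) 1.
have E : (fun p : R * V => 'D_((0, delta_mx 0 i) : R * V)
    (fun p : R * V => (cst 1 : R -> R) p.1 * g p.2) p) = (fun p => dg p.2 0 i).
  apply/funext => p; have := sp_x sg p i => -[_ <-].
  by congr ('D_ _ _ p); apply/funext => q; rewrite /cst mul1r.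
have pc : continuous (fun x : V => (0 : R, x)).
  by move=> x; apply: (@cvg_pair _ _ _ (nbhs x) (nbhs (0 : R)) (nbhs x)); [exact: cvg_cst|exact: cvg_id].
move=> x; have := c (0, x); rewrite E => cx.
have -> : (fun x => dg x 0 i) = (fun p : R * V => dg p.2 0 i) \o (fun x => (0 : R, x)) by [].
by apply: (@continuous_comp _ _ _ (fun x : V => (0 : R, x)) _ x); [exact: pc|].
Qed.

Variables (al dal : R -> R).
Hypotheses (cal : forall n, Cn n al) (hal : forall t : R, is_derive t 1 al (dal t)).
Let zeta (p : R * V) := al p.1 * g p.2.

Lemma test_time_derivative t x : time_derivative zeta t x = dal t * g x.
Proof.
have h1 := is_derive_comp_affine ((1, 0) : R * V) affine_fst (hal (t, x).1).
have := is_deriveM h1 (sp_t sg (t, x)) => -[_ E].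
rewrite /time_derivative; move: E; rewrite /= scaler0 add0r mul1r => E.
by rewrite [LHS]E /GRing.scale/= mulrC.
Qed.

Lemma test_space_gradient t x : space_gradient zeta t x = al t *: dg x.
Proof.
apply/rowP => i; rewrite !mxE.
have h1 := is_derive_comp_affine ((0, delta_mx 0 i) : R * V) affine_fst (hal (t, x).1).
have := is_deriveM h1 (sp_x sg (t, x) i) => -[_ E].
by move: E; rewrite /= mul0r scaler0 addr0 => E; rewrite [LHS]E.
Qed.

Lemma test_function_tensor T a b rho : 0 < a -> b < T ->
  (forall t, ~~ (a <= t <= b) -> al t = 0) -> (forall x, rho < `|x| -> g x = 0) ->
  is_test_function T zeta.
Proof.
move=> a0 bT al0 g0.
pose K : set (R * V) := `[a, b]%classic `*` [set x | `|x| <= rho].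
have cK : compact K.
  apply: compact_setX; first exact: segment_compact.
  apply: bounded_closed_compact.
    by exists rho; split; [exact: num_real|move=> M rM x /= hx; apply: ltW; exact: le_lt_trans rM].
  rewrite (_ : [set _ | _] = (fun x : V => `|x|) @^-1` [set r | r <= rho]) //.
  by apply: closed_comp; [move=> x _; exact: norm_continuous|exact: closed_le].
have sK : [set p | zeta p != 0] `<=` K.
  move=> [t x] /=; rewrite mulf_eq0 negb_or => /andP[at0 gx0]; split => /=.
    by rewrite in_itv/=; apply: contraNT at0 => /al0->.
  by rewrite leNgt; apply: contraNN gx0 => /g0->.
have clK : closure [set p | zeta p != 0] `<=` K.
  have cl : closed K by apply: compact_closed => //; exact: norm_hausdorff.
  by move=> p; rewrite closureE => /(_ K); apply.
split.
- by move=> n; exact: (sp_Ck sg cal).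
- by apply: subclosed_compact clK => //; exact: closed_closure.
- move=> [t x] /clK[/=]; rewrite !in_itv/= => /andP[h1 h2] _; split=> //=.
  by rewrite (lt_le_trans a0)// (le_lt_trans h2).
Qed.

End test_functions.

Lemma lerB_swap (R : realType) (x y p q : R) : y - q <= x - p -> y - x <= q - p.
Proof. lra. Qed.

Lemma sub01 (R : realType) (p q : R) : 0 <= q -> p <= 1 -> q <= p -> 0 <= p - q <= 1.
Proof. lra. Qed.

Section weak_form.
Context {R : realType} {d : nat}.
Local Notation V := 'rV[R]_d.
Local Notation leb := (@lebesgue_measure R).
Variables (T : R) (mu : R -> {finite_measure set V -> \bar R}).
Variables (v : R -> V -> V) (w : R -> V -> R) (vh : R -> V -> V) (wh : R -> V -> R).
Variable (L : nat -> R -> R).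
Hypotheses (hT : 0 < T) (hmu : narrowly_continuous T mu) (lf : local_field vh wh L).
Hypothesis heq : solves_continuity_equation T v w mu.
Hypothesis hae : {ae leb, forall t, 0 <= t <= T -> vh t = v t /\ wh t = w t}.

(** The integrand <D, v_t> + h w_t of the equation, for a function h with
    gradient D. *)
Definition field (h : V -> R) (D : V -> V) t x : R := dot (D x) (vh t x) + h x * wh t x.

Record bounded_pair (h : V -> R) (D : V -> V) (B : R) (n : nat) : Prop := {
  bp_mh : measurable_fun setT h;
  bp_mD : forall i, measurable_fun setT (fun x => D x 0 i);
  bp_h : forall x, `|h x| <= B;
  bp_D : forall x, `|D x| <= B;
  bp_out : forall x, n%:R < `|x| -> h x = 0 /\ D x = 0 }.

Lemma bp_B0 h D B n : bounded_pair h D B n -> 0 <= B.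
Proof. by move=> H; apply: le_trans (bp_h H 0). Qed.

Lemma field_le h D B n t x : bounded_pair h D B n -> `|field h D t x| <= (d%:R + 1) * B * L n t.
Proof.
move=> H; have B0 := bp_B0 H; have L0 := lf_L0 lf n t.
have [xn|/(bp_out H)[hx Dx]] := leP `|x| n%:R; last first.
  by rewrite /field hx Dx dot0l mul0r addr0 normr0 !mulr_ge0// addr_ge0.
rewrite /field mulrDl mul1r mulrDl; apply: le_trans (ler_normD _ _) _; apply: lerD.
  apply: le_trans (dot_le _ _) _; rewrite -mulrA ler_wpM2l// ler_pM//; first exact: (bp_D H).
  exact: (lf_v lf).
by rewrite normrM ler_pM//; [exact: (bp_h H)|exact: (lf_w lf)].
Qed.

Lemma field_sub h1 D1 h2 D2 t x : field h1 D1 t x - field h2 D2 t x =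
  field (fun x => h1 x - h2 x) (fun x => D1 x - D2 x) t x.
Proof. by rewrite /field dotDl dotNl; ring. Qed.

Lemma measurable_section d' (W : measurableType d') (f : R -> V -> W) t :
  measurable_fun setT (fun p : R * V => f p.1 p.2) -> measurable_fun setT (f t).
Proof.
move=> mf; apply: (@measurableT_comp _ _ _ _ _ _ (fun p : R * V => f p.1 p.2) _ (fun x => (t, x))) => //.
by apply: measurable_fun_pair => //; exact: measurable_cst.
Qed.

Lemma field_measurable h D B n t : bounded_pair h D B n -> measurable_fun setT (field h D t).
Proof.
move=> H; have mv := measurable_section t (lf_mv lf); have mw := measurable_section t (lf_mw lf).
apply: measurable_funD; last by apply: measurable_funM => //; exact: (bp_mh H).
apply: measurable_sum => i; apply: measurable_funM; first exact: (bp_mD H).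
exact: (measurableT_comp (measurable_coord i) mv).
Qed.

Lemma bounded_integrable (m : {finite_measure set V -> \bar R}) (f : V -> R) B :
  measurable_fun setT f -> (forall x, `|f x| <= B) -> m.-integrable setT (EFin \o f).
Proof.
move=> mf fB; apply: measurable_bounded_integrable => //.
  by rewrite ltey_eq fin_num_measure.
by exists B; split; [exact: num_real|move=> M BM x _; apply: le_trans (fB x) (ltW BM)].
Qed.

Lemma Rintegral_norm_le (m : {finite_measure set V -> \bar R}) (f : V -> R) B :
  measurable_fun setT f -> (forall x, `|f x| <= B) ->
  `|\int[m]_x f x| <= B * fine (m setT).
Proof.
move=> mf fB; have If := bounded_integrable m mf fB.
apply: le_trans (le_normr_Rintegral _ If) _ => //.
rewrite -(Rintegral_cst m measurableT); apply: le_Rintegral => //.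
- by have := integrable_norm If.
- by apply: (@bounded_integrable m _ `|B|) => //; exact: measurable_cst.
Qed.

Lemma mass_bounded : exists2 M : R, 0 <= M & forall t, 0 <= t <= T -> fine (mu t setT) <= M.
Proof.
pose c1 : V -> R := cst 1.
have c1c : continuous c1 by exact: cst_continuous.
have c1b : exists M : R, forall x, `|c1 x| <= M by exists 1 => x; rewrite normr1.
have cN := hmu c1c c1b.
have [c _ Hc] := EVT_max (ltW hT) cN.
exists (fine (mu c setT)); first by rewrite fine_ge0.
by move=> t tT; have := Hc t; rewrite in_itv/= => /(_ tT); rewrite !Rintegral_cst// !mul1r.
Qed.

Let I (h : V -> R) t := \int[mu t]_x h x.
Let J (h : V -> R) (D : V -> V) t := \int[mu t]_x field h D t x.

Lemma I_clip_continuous h B : continuous h -> (forall x, `|h x| <= B) ->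
  continuous (fun t => I h (clip 0 T t)).
Proof.
move=> ch hB; apply: (@within_continuous_clip R 0 T (I h)); first exact: ltW.
by apply: hmu => //; exists B.
Qed.

(** The equation is tested against alpha(t) g(x), where alpha is a
    difference of ramps. The integral J of the field over space is not known
    to be measurable in time; bounding it by an integrable G turns the
    equation into an inequality. *)
Lemma weak_cutoff g dg B n a b dl (G : R -> R) : smooth_pair g dg -> bounded_pair g dg B n ->
  0 < a -> 0 < dl -> a + dl <= b - dl -> b < T -> L1 G ->
  {ae leb, forall t, a <= t <= b -> J g dg t <= G t} ->
  let f t := (dramp a dl t - dramp (b - dl) dl t) * I g (clip 0 T t) +
             (ramp a dl t - ramp (b - dl) dl t) * G t in
  0 <= prim f T - prim f 0.
Proof.
cbv zeta.
move=> sg bg a0 dl0 ab bT IG HG.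
pose al t := ramp a dl t - ramp (b - dl) dl t.
pose dal t := dramp a dl t - dramp (b - dl) dl t.
set f := fun t : R => _.
have cal : forall n, Cn n al.
  move=> k; have -> : al = fun t => ramp a dl t + (-1) * ramp (b - dl) dl t.
    by apply/funext => t; rewrite mulN1r.
  apply: CnD; first exact: ramp_Cn.
  by apply: CnM; [exact: Cn_cst|exact: ramp_Cn].
have hal t : is_derive (t : R) 1 al (dal t).
  by have := is_deriveB (ramp_is_derive a dl t) (ramp_is_derive (b - dl) dl t).
have ab' : a <= b - dl by apply: le_trans ab; rewrite lerDl ltW.
have al01 t : 0 <= al t <= 1.
  have := ramp_shift t dl0 ab'; have := ramp_le1 a dl t; have := ramp_ge0 (b - dl) dl t.
  exact: sub01.
have out t : ~~ (a <= t <= b) -> al t = 0.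
  rewrite negb_and -!ltNge => /orP[ta|bt].
    by rewrite /al !ramp0 ?subrr// ?ltW// (lt_le_trans ta).
  rewrite /al !ramp1 ?subrr ?subrK// ?ltW//; apply: le_lt_trans bt.
  by apply: le_trans ab _; rewrite gerBl ltW.
have tf := test_function_tensor sg cal a0 bT out (fun x h => (bp_out bg h).1).
have cI := I_clip_continuous (smooth_pair_continuous sg) (bp_h bg).
have If : L1 f.
  apply: L1D.
    have -> : (fun t => (dramp a dl t - dramp (b - dl) dl t) * I g (clip 0 T t)) =
      (fun t => dramp a dl t * I g (clip 0 T t) - dramp (b - dl) dl t * I g (clip 0 T t)).
      by apply/funext => t; rewrite mulrBl.
    by apply: L1B; apply: L1_dramp.
  apply: (@L1_dom _ _ (fun t => `|G t|)); last 1 first.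
  - move=> t; rewrite normrM -[leRHS]mul1r ler_wpM2r//.
    by have /andP[p0 p1] := al01 t; rewrite ger0_norm.
  - apply: measurable_funM; last exact: L1_meas.
    by apply: continuous_measurable_fun; exact: Cn_continuous (cal 0%N).
  - by have := IG; rewrite /L1; exact: integrable_norm.
rewrite primB//; last exact: ltW.
rewrite -Rintegral_itv_bndo_bndc; last exact: L1S If.
rewrite -lee_fin Rintegral_EFin//; last exact: L1S If.
apply: (integral0_ae_le_ge0 _ (heq tf)) => //; first exact: L1S If.
have := ae_andP hae HG; apply: ae_impl => t [Hv HJ]; rewrite /= in_itv/= => /andP[t0 tT].
have t0T : 0 <= t <= T by rewrite !ltW.
have [<- <-] := Hv t0T.
have Ig : (mu t).-integrable setT (EFin \o g) := bounded_integrable (mu t) (bp_mh bg) (bp_h bg).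
have IF : (mu t).-integrable setT (EFin \o field g dg t).
  exact: bounded_integrable (field_measurable t bg) (fun x => field_le t x bg).
rewrite (_ : integral _ _ _ = (dal t * I g t + al t * J g dg t)%:E).
  rewrite lee_fin /f clip_id// lerD2l.
  rewrite -/(al t); have [abt|/out->] := boolP (a <= t <= b); last by rewrite !mul0r.
  by rewrite ler_wpM2l ?HJ//; have /andP[] := al01 t.
rewrite EFinD !EFinM !Rintegral_EFin//.
rewrite -!integralZl// -integralD//; [|exact: integrableZl|exact: integrableZl].
apply: eq_integral => x _; rewrite (test_time_derivative sg hal) (test_space_gradient sg hal).
by rewrite -!EFinM -EFinD /field dotZl; congr (_%:E); ring.
Qed.

(** Cutoffs in time exist for 0 < a and b < T only; the two ends are reached
    by narrow continuity. *)
Lemma weak_smooth g dg B n a b (G : R -> R) : smooth_pair g dg -> bounded_pair g dg B n ->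
  0 <= a -> a <= b -> b <= T -> L1 G ->
  {ae leb, forall t, a <= t <= b -> J g dg t <= G t} ->
  I g b - I g a <= prim G b - prim G a.
Proof.
move=> sg bg a0; rewrite le_eqVlt => /predU1P[->|ab] bT IG HG; first by rewrite !subrr.
have cI := I_clip_continuous (smooth_pair_continuous sg) (bp_h bg).
pose k t := I g (clip 0 T t) - prim G t.
have ck : continuous k.
  by move=> t; apply: cvgB; [exact: cI|exact: prim_continuous].
suff : k b <= k a.
  rewrite /k !clip_id; [|by rewrite a0 (le_trans (ltW ab))|by rewrite bT (le_trans a0)// ltW].
  exact: lerB_swap.
apply: (continuous_nonincreasing_ends ck ab) => x y ax xy yb.
suff : I g (clip 0 T y) - I g (clip 0 T x) <= prim G y - prim G x.
  exact: lerB_swap.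
apply: (@cutoff_limit _ T x y (fun t => I g (clip 0 T t))) => //.
- exact: le_lt_trans ax.
- exact: lt_le_trans bT.
move=> dl dl0 xyl; apply: (weak_cutoff sg bg) => //.
- exact: le_lt_trans ax.
- exact: lt_le_trans bT.
by apply: ae_impl HG => t H /andP[h1 h2]; apply: H; rewrite (le_trans (ltW ax))// (le_trans h2)// ltW.
Qed.

End weak_form.

Lemma le_of_small (R : realType) (x y c : R) :
  (forall dl, 0 < dl <= 1 -> x <= y + dl * c) -> x <= y.
Proof.
move=> H; have [c0|c0] := leP c 0.
  have := H 1; rewrite ltr01 lexx => /(_ isT); rewrite mul1r => h.
  by apply: le_trans h _; rewrite gerDl.
apply/ler_addgt0Pr => e e0; pose dl := Num.min 1 (e / c).
have dl0 : 0 < dl <= 1 by rewrite /dl lt_min ltr01 divr_gt0//= ge_min lexx.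
apply: le_trans (H dl dl0) _; rewrite lerD2l -ler_pdivlMr//.
by rewrite /dl ge_min lexx orbT.
Qed.

Section c11_facts.
Context {R : realType} {d : nat}.
Local Notation V := 'rV[R]_d.

Lemma far_point (rho : R) : (1 <= d)%N -> exists2 y : V, rho < `|y| & `|y| <= `|rho| + 1.
Proof.
move=> d1; exists (const_mx (`|rho| + 1)).
  have := rV_coord_le (const_mx (`|rho| + 1) : V) (Ordinal d1); rewrite mxE.
  apply: lt_le_trans; rewrite ger0_norm ?addr_ge0//.
  by apply: le_lt_trans (ler_norm rho) _; rewrite ltrDl.
apply: rV_norm_le; first by rewrite addr_ge0.
by move=> i; rewrite mxE ger0_norm ?addr_ge0.
Qed.

(** The bound B is the same for all functions of the class: comparing with a
    point just outside of the support bounds h and D by C and rho. *)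
Lemma c11_uniform C rho : (1 <= d)%N -> exists2 B : R, 0 <= B & forall (h : V -> R) D,
  c11 h D C rho -> [/\ C <= B, forall x, `|h x| <= B, forall x, `|D x| <= B &
    forall x y, `|h x - h y| <= B * `|x - y|].
Proof.
move=> d1.
pose m := (`|rho| + (`|rho| + 1)).
have m1 : 1 <= m by rewrite /m addrA lerDr addr_ge0.
have m0 : 0 <= m by rewrite (le_trans ler01).
pose B1 := `|C| * m ^+ 2.
have B10 : 0 <= B1 by rewrite mulr_ge0// exprn_ge0.
pose B := d%:R * B1 + `|C| + (B1 + B1).
have B1B : B1 <= B by rewrite /B addrA lerDr !addr_ge0// mulr_ge0.
exists B; first by rewrite !addr_ge0// mulr_ge0.
move=> h D H; have C0 := c11_C0 H d1; have CE : `|C| = C by rewrite ger0_norm.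
have [y ry y1] := far_point rho d1; have [hy Dy] := c11_out H ry.
have xym x : `|x| <= rho -> `|x - y| <= m.
  move=> xr; apply: le_trans (ler_normB _ _) _; apply: lerD => //.
  by apply: le_trans xr (ler_norm _).
have hB x : `|h x| <= B1.
  have [xr|/(c11_out H)[-> _]] := leP `|x| rho; last by rewrite normr0.
  have := c11_taylor H y x; rewrite hy Dy dot0l !subr0 => h1; apply: le_trans h1 _.
  by rewrite /B1 CE ler_wpM2l// ler_sqr ?nnegrE// xym.
have DB x : `|D x| <= B1.
  have [xr|/(c11_out H)[_ ->]] := leP `|x| rho; last by rewrite normr0.
  have := c11_lip H x y; rewrite Dy subr0 => h1; apply: le_trans h1 _.
  by rewrite /B1 CE ler_wpM2l// (le_trans (xym x xr))// expr2 ler_peMl.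
split.
- by rewrite /B CE addrAC lerDr !addr_ge0// mulr_ge0.
- by move=> x; apply: le_trans (hB x) B1B.
- by move=> x; apply: le_trans (DB x) B1B.
move=> x z; have [xz|xz] := leP `|x - z| 1; last first.
  apply: le_trans (ler_normB _ _) _; apply: (@le_trans _ _ (B1 + B1)); first exact: lerD.
  rewrite -[leLHS]mulr1 ler_pM//; [by rewrite addr_ge0| |exact: ltW].
  by rewrite /B lerDr addr_ge0// mulr_ge0.
have -> : h x - h z = (h x - h z - dot (D z) (x - z)) + dot (D z) (x - z) by rewrite subrK.
apply: le_trans (ler_normD _ _) _.
apply: (@le_trans _ _ (C * `|x - z| + d%:R * B1 * `|x - z|)).
  apply: lerD.
    apply: le_trans (c11_taylor H _ _) _; rewrite ler_wpM2l// expr2.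
    by rewrite ler_piMl.
  by apply: le_trans (dot_le _ _) _; rewrite -mulrA ler_wpM2l// ler_wpM2r.
by rewrite -mulrDl ler_wpM2r// /B CE (addrC C) lerDl addr_ge0.
Qed.

Lemma c11_bounded_pair (h : V -> R) D C rho n : (1 <= d)%N -> c11 h D C rho -> rho <= n%:R ->
  exists B, bounded_pair h D B n.
Proof.
move=> d1 H rn; have [B _ HB] := c11_uniform C rho d1.
have [_ hB DB hL] := HB h D H; exists B; split=> //.
- by apply: continuous_measurable_rV; apply: (@lipschitz_continuous R V R h B).
- move=> i; apply: continuous_measurable_rV.
  apply: (@lipschitz_continuous R V R (fun x => D x 0 i) C) => x y.
  have := rV_coord_le (D x - D y) i; rewrite !mxE => /le_trans; apply; exact: (c11_lip H).
- by move=> x xn; apply: (c11_out H); exact: le_lt_trans xn.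
Qed.

End c11_facts.

Lemma triangle_transfer (R : realType) (ga ha gb hb e P : R) :
  ga - ha <= e -> - e <= gb - hb -> gb - ga <= P -> hb - ha <= P + (e + e).
Proof. lra. Qed.

Section weak_c11.
Context {R : realType} {d : nat}.
Local Notation V := 'rV[R]_d.
Local Notation leb := (@lebesgue_measure R).
Variables (T : R) (mu : R -> {finite_measure set V -> \bar R}).
Variables (v : R -> V -> V) (w : R -> V -> R) (vh : R -> V -> V) (wh : R -> V -> R).
Variable (L : nat -> R -> R).
Hypotheses (hd : (1 <= d)%N) (hT : 0 < T) (hmu : narrowly_continuous T mu)
  (lf : local_field vh wh L).
Hypothesis heq : solves_continuity_equation T v w mu.
Hypothesis hae : {ae leb, forall t, 0 <= t <= T -> vh t = v t /\ wh t = w t}.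

(** The glued Taylor polynomials are within K dl of h in C^1, so that
    replacing h by them changes both sides by a multiple of dl. *)
Lemma weak_c11 h D C rho a b (G : R -> R) : c11 h D C rho ->
  0 <= a -> a <= b -> b <= T -> L1 G ->
  {ae leb, forall t, a <= t <= b -> \int[mu t]_x field vh wh h D t x <= G t} ->
  (\int[mu b]_x h x) - (\int[mu a]_x h x) <= prim G b - prim G a.
Proof.
move=> H a0 ab bT IG HG.
have [K K0 HK] := c11_smooth_approx hd H; have [M M0 HM] := mass_bounded hT hmu.
pose n := Num.bound `|rho + 1|.
have nrho : rho + 1 < n%:R by apply: le_lt_trans (ler_norm _) (archi_boundP _).
have [|B bh] := @c11_bounded_pair _ _ h D C rho n hd H.
  by rewrite ltW// (lt_trans _ nrho)// ltrDl.
pose c := (d%:R + 1) * K * M.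
have tT t : a <= t <= b -> 0 <= t <= T.
  by move=> /andP[h1 h2]; rewrite (le_trans a0)// (le_trans h2).
apply: (@le_of_small _ _ _ (K * M + K * M + c * (prim (L n) b - prim (L n) a))) => dl dl01.
have /andP[dl0 dl1] := dl01.
have [N [gh gD go]] := HK dl dl01.
set g := glue N dl h D in gh go; set dg := dglue N dl h D in gD go.
have sg : smooth_pair g dg by exact: glue_smooth_pair.
have out x : n%:R < `|x| -> [/\ g x = 0, dg x = 0, h x = 0 & D x = 0].
  by move=> nx; apply: go; exact: lt_trans nx.
have bg : bounded_pair g dg (B + K) n.
  split.
  - by apply: continuous_measurable_rV; exact: smooth_pair_continuous sg.
  - by move=> i; apply: continuous_measurable_rV; exact: smooth_pair_grad_continuous sg i.
  - move=> x; rewrite -[g x](subrK (h x)) addrC; apply: le_trans (ler_normD _ _) _.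
    by rewrite lerD ?(bp_h bh)// (le_trans (gh x))// ler_piMr.
  - move=> x; rewrite -[dg x](subrK (D x)) addrC; apply: le_trans (ler_normD _ _) _.
    by rewrite lerD ?(bp_D bh)// (le_trans (gD x))// ler_piMr.
  - by move=> x /out[-> ->].
have bd : bounded_pair (fun x => g x - h x) (fun x => dg x - D x) (K * dl) n.
  split=> //.
  - by apply: measurable_funB; [exact: (bp_mh bg)|exact: (bp_mh bh)].
  - move=> i; rewrite (_ : (fun _ => _) = (fun x => dg x 0 i - D x 0 i)).
      by apply: measurable_funB; [exact: (bp_mD bg)|exact: (bp_mD bh)].
    by apply/funext => x; rewrite !mxE.
  - by move=> x /out[-> -> -> ->]; rewrite !subrr.
have Ih t : (mu t).-integrable setT (EFin \o h) by exact: bounded_integrable (bp_mh bh) (bp_h bh).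
have Ig t : (mu t).-integrable setT (EFin \o g) by exact: bounded_integrable (bp_mh bg) (bp_h bg).
have IFh t : (mu t).-integrable setT (EFin \o field vh wh h D t).
  exact: bounded_integrable (field_measurable lf t bh) (fun x => field_le lf t x bh).
have IFg t : (mu t).-integrable setT (EFin \o field vh wh g dg t).
  exact: bounded_integrable (field_measurable lf t bg) (fun x => field_le lf t x bg).
have Igh t : 0 <= t <= T -> `|(\int[mu t]_x g x) - (\int[mu t]_x h x)| <= dl * (K * M).
  move=> /HM hM; rewrite -(RintegralB measurableT (Ig t) (Ih t)).
  apply: le_trans (Rintegral_norm_le (mu t) (bp_mh bd) (bp_h bd)) _.
  by rewrite mulrA (mulrC dl) ler_wpM2l// mulr_ge0// ltW.
have JJ t : 0 <= t <= T -> (\int[mu t]_x field vh wh g dg t x) <=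
    (\int[mu t]_x field vh wh h D t x) + (dl * c) * L n t.
  move=> /HM hM; rewrite -lerBlDl -(RintegralB measurableT (IFg t) (IFh t)).
  rewrite (_ : (\int[_]_(_ in _) _) =
    (\int[mu t]_x field vh wh (fun x => g x - h x) (fun x => dg x - D x) t x)); last first.
    by apply: eq_Rintegral => x _; rewrite field_sub.
  apply: le_trans (ler_norm _) _.
  apply: le_trans (Rintegral_norm_le (mu t) (field_measurable lf t bd) (fun x => field_le lf t x bd)) _.
  rewrite (_ : dl * c * L n t = (d%:R + 1) * (K * dl) * L n t * M); last by rewrite /c; ring.
  apply: ler_wpM2l => //; apply: mulr_ge0; last exact: lf_L0 lf _ _.
  by apply: mulr_ge0; [exact: addr_ge0|apply: mulr_ge0 => //; exact: ltW].
have IG' : L1 (fun t => G t + (dl * c) * L n t) by apply: L1D => //; apply: L1Z; exact: (lf_L1 lf).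
have := weak_smooth hT hmu lf heq hae sg bg a0 ab bT IG' => /(_ _)/wrap[].
  apply: ae_impl HG => t Ht abt; apply: le_trans (JJ _ (tT _ abt)) _.
  by rewrite lerD2r Ht.
have ILn := lf_L1 lf n.
have ILc : L1 (fun t => dl * c * L n t) by exact: L1Z.
rewrite (primD b IG ILc) (primD a IG ILc) (primZ _ b ILn) (primZ _ a ILn).
have h1 : 0 <= b <= T by apply: tT; rewrite ab lexx.
have h2 : 0 <= a <= T by apply: tT; rewrite ab lexx.
have := Igh b h1; have := Igh a h2; rewrite !ler_norml => /andP[_ q1] /andP[q2 _] q3.
have -> : prim G b - prim G a + dl * (K * M + K * M + c * (prim (L n) b - prim (L n) a)) =
  prim G b + dl * c * prim (L n) b - (prim G a + dl * c * prim (L n) a) + (dl * (K * M) + dl * (K * M)).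
  by ring.
exact: triangle_transfer q1 q2 q3.
Qed.

End weak_c11.

(** * Averages over cubes *)

Section antiderivative.
Context {R : realType}.

(** The mean value theorem, used on either side of c. *)
Lemma antiderivative_taylor (g F : R -> R) K c t :
  (forall t : R, is_derive t 1 F (g t)) -> (forall s s', `|g s - g s'| <= K * `|s - s'|) ->
  `|F (c + t) - F c - t * g c| <= K * t ^+ 2.
Proof.
move=> dF Kg.
have cF : continuous F.
  by move=> s; apply: differentiable_continuous; apply/derivable1_diffP; have [] := dF s.
have key a b q : a <= q <= b -> a = c \/ b = c -> `|(g q - g c) * (b - a)| <= K * (b - a) ^+ 2.
  move=> /andP[aq qb] abc.
  have ab0 : 0 <= b - a by rewrite subr_ge0 (le_trans aq).
  rewrite normrM (ger0_norm ab0) expr2 mulrA ler_wpM2r//; apply: le_trans (Kg _ _) _.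
  have K0 : 0 <= K by have := Kg 1 0; rewrite subr0 normr1 mulr1; exact: le_trans.
  by rewrite ler_wpM2l// ler_norml; case: abc => <-; apply/andP; split; lra.
have [t0|t0] := leP 0 t.
  have ct : c <= c + t by rewrite lerDl.
  have [q qc E] := @MVT_segment R F g c (c + t) ct (fun x _ => dF x) (continuous_subspaceT cF).
  have := key c (c + t) q; rewrite in_itv/= in qc; move=> /(_ qc (or_introl erefl)).
  by rewrite E addrAC subrr add0r; congr (`|_| <= _); ring.
have ct : c + t <= c by rewrite gerDl ltW.
have [q qc E] := @MVT_segment R F g (c + t) c ct (fun x _ => dF x) (continuous_subspaceT cF).
have := key (c + t) c q; rewrite in_itv/= in qc; move=> /(_ qc (or_intror erefl)).
have -> : c - (c + t) = - t by ring.
rewrite sqrrN -normrN; congr (`|_| <= _).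
rewrite -[F (c + t) - F c]opprB E; ring.
Qed.

End antiderivative.

Section average.
Context {R : realType} {d : nat}.
Local Notation V := 'rV[R]_d.
Local Notation e_ i := (delta_mx 0 i : V).
Variable eps : R.
Hypothesis eps0 : 0 < eps.

Definition lipc (f : V -> R) (K rho : R) : Prop :=
  (forall x y, `|f x - f y| <= K * `|x - y|) /\ (forall x, rho < `|x| -> f x = 0).

Lemma norm_delta i : `|e_ i| = 1.
Proof.
apply/eqP; rewrite eq_le; apply/andP; split.
  by apply: rV_norm_le => // j; rewrite mxE eqxx/=; case: eqP => _; rewrite ?normr1 ?normr0.
by have := rV_coord_le (e_ i) i; rewrite mxE !eqxx normr1.
Qed.

Definition line (f : V -> R) i x (s : R) : R := f (x + s *: e_ i).

Lemma line_lip f K rho i x : lipc f K rho ->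
  forall s s', `|line f i x s - line f i x s'| <= K * `|s - s'|.
Proof.
move=> [Kf _] s s'; apply: le_trans (Kf _ _) _.
by rewrite opprD addrACA subrr add0r -scalerBl normrZ norm_delta mulr1.
Qed.

Lemma line_continuous f K rho i x : lipc f K rho -> continuous (line f i x).
Proof. by move=> H; apply: (@lipschitz_continuous R R R _ K); exact: line_lip H. Qed.

Lemma L1_line f K rho i x : lipc f K rho -> L1 (line f i x).
Proof.
move=> H; apply: (@L1_continuous_supported _ (- (rho + `|x|)) (rho + `|x|)); first exact: line_continuous H.
move=> s; rewrite -ler_norml -ltNge => hs; apply: H.2.
rewrite -(ltrD2r `|x|); apply: (lt_le_trans hs).
rewrite -[`|s|]mulr1 -(norm_delta i) -normrZ -[X in `|X| <= _](addrK x) addrC.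
by rewrite addrC (addrC _ x) ; exact: ler_normB.
Qed.

(** The average of f over a segment of length eps in direction i. A single
    such average of a Lipschitz function is C^{1,1} in its own direction,
    with a difference quotient of f as derivative; going through all the
    directions gives an average over a cube that is C^{1,1}. *)
Definition avg i (f : V -> R) (x : V) : R :=
  eps^-1 * (prim (line f i x) eps - prim (line f i x) 0).

Lemma prim_indic k : let ck s := k * (\1_(`[0, eps]%classic : set R)) s in
  L1 ck /\ prim ck eps - prim ck 0 = k * eps.
Proof.
move=> ck; have Ik : L1 ck by apply: L1Z; exact: integrable_indic_itv.
split=> //; rewrite primB//; last exact: ltW.
rewrite (@eq_Rintegral _ _ _ _ _ (cst k)).
  by rewrite Rintegral_cst//= lebesgue_measure_itv/= lte_fin eps0 oppr0 addr0.
move=> s; rewrite inE/= in_itv/= => /andP[s0 se].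
by rewrite /ck indicE mem_set ?mulr1//= in_itv/= ltW.
Qed.

Lemma avg_bound (q : R -> R) a k : L1 q -> (forall s, 0 <= s <= eps -> `|q s - a| <= k) ->
  `|eps^-1 * (prim q eps - prim q 0) - a| <= k.
Proof.
move=> Iq qk; have [Ia Ea] := prim_indic a; have [Ik Ek] := prim_indic k.
set ca := (X in prim X eps - _ = a * eps) in Ia Ea.
set ck := (X in prim X eps - _ = k * eps) in Ik Ek.
have -> : eps^-1 * (prim q eps - prim q 0) - a =
    eps^-1 * (prim (fun s => q s - ca s) eps - prim (fun s => q s - ca s) 0).
  rewrite !(primDB _ Iq Ia) subrACA Ea [in RHS]mulrBr (mulrC a) mulKf// gt_eqF//.
rewrite normrM gtr0_norm ?invr_gt0// mulrC ler_pdivrMr// -Ek.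
apply: prim_norm_le => //; [exact: L1B|exact: ltW|].
move=> s s0 se; rewrite /ck /ca indicE mem_set ?mulr1; last by rewrite /= in_itv/= ltW.
by apply: qk; rewrite ltW.
Qed.

(** Averages of translates are translates of averages, so that an estimate
    between translates of f and g passes to their averages. Taking c = 0
    gives bounds on one average alone. *)
Lemma avg_compare i f g K rho K' rho' c a x y k : lipc f K rho -> lipc g K' rho' ->
  (forall s, 0 <= s <= eps -> `|line f i x s - c * line g i y s - a| <= k) ->
  `|avg i f x - c * avg i g y - a| <= k.
Proof.
move=> Hf Hg Hk; have If := L1_line i x Hf; have Ig := L1_line i y Hg.
have Icg : L1 (fun s => c * line g i y s) by exact: L1Z.
have := @avg_bound (fun s => line f i x s - c * line g i y s) a k (L1B If Icg) Hk.
rewrite !(primDB _ If Icg) (primZ _ _ Ig) (primZ _ _ Ig).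
by congr (`|_ - _| <= _); rewrite /avg; ring.
Qed.

Lemma lipc_avg i f K rho : lipc f K rho -> lipc (avg i f) K (rho + eps).
Proof.
move=> H; split.
  move=> x y; have := @avg_compare i f f K rho K rho 1 0 x y (K * `|x - y|) H H.
  rewrite mul1r subr0; apply => s _; rewrite mul1r subr0; apply: le_trans (H.1 _ _) _.
  by rewrite opprD addrACA subrr addr0.
move=> x hx; have := @avg_compare i f f K rho K rho 0 0 x x 0 H H.
rewrite mul0r !subr0 normr_le0 => h; apply/eqP; apply: h => s /andP[s0 se].
rewrite mul0r !subr0 /line H.2 ?normr0//; rewrite -(ltrD2r eps); apply: (lt_le_trans hx).
rewrite -[X in `|X| <= _](addrK (s *: e_ i)); apply: le_trans (ler_normB _ _) _.
by rewrite lerD2l normrZ norm_delta mulr1 ger0_norm.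
Qed.

Definition has_partial (f : V -> R) i (D : V -> R) C : Prop :=
  forall x t, `|f (x + t *: e_ i) - f x - t * D x| <= C * t ^+ 2.

Lemma avg_partial i f K rho : lipc f K rho ->
  has_partial (avg i f) i (fun x => eps^-1 * (f (x + eps *: e_ i) - f x)) (2 * K / eps).
Proof.
move=> H x t; pose F := prim (line f i x).
have dF := prim_is_derive_continuous (L1_line i x H) (@line_continuous f K rho i x H).
have E : line f i (x + t *: e_ i) = (fun s => line f i x (1 * s + t)).
  by apply/funext => s; rewrite /line mul1r scalerDl addrAC addrA.
have F1 : prim (line f i (x + t *: e_ i)) eps - prim (line f i (x + t *: e_ i)) 0 =
    F (eps + t) - F (0 + t).
  have := @prim_antiderivative R (line f i (x + t *: e_ i)) (fun s => F (1 * s + t)) 0 eps.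
  rewrite mulr0 mul1r; apply => //.
  - exact: L1_line H.
  - exact: line_continuous H.
  - by move=> s; rewrite E -[X in is_derive _ _ _ X]mul1r; apply: is_derive_affine; exact: dF.
have t1 := antiderivative_taylor eps t dF (line_lip i x H).
have t2 := antiderivative_taylor 0 t dF (line_lip i x H).
rewrite /avg F1 -/F.
have -> : eps^-1 * (F (eps + t) - F (0 + t)) - eps^-1 * (F eps - F 0) -
    t * (eps^-1 * (f (x + eps *: e_ i) - f x)) =
    eps^-1 * ((F (eps + t) - F eps - t * line f i x eps) - (F (0 + t) - F 0 - t * line f i x 0)).
  by rewrite /line scale0r addr0; ring.
rewrite normrM gtr0_norm ?invr_gt0//.
have -> : 2 * K / eps * t ^+ 2 = eps^-1 * (K * t ^+ 2 + K * t ^+ 2) by ring.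
rewrite ler_pM2l ?invr_gt0//; apply: le_trans (ler_normB _ _) _; exact: lerD.
Qed.

Lemma lipc_difference i f K rho : lipc f K rho ->
  lipc (fun x => eps^-1 * (f (x + eps *: e_ i) - f x)) (2 * K / eps) (rho + eps).
Proof.
move=> H; split.
  move=> x y; rewrite -mulrBr normrM gtr0_norm ?invr_gt0//.
  have -> : 2 * K / eps * `|x - y| = eps^-1 * (K * `|x - y| + K * `|x - y|) by ring.
  rewrite ler_pM2l ?invr_gt0//.
  have -> : f (x + eps *: e_ i) - f x - (f (y + eps *: e_ i) - f y) =
    (f (x + eps *: e_ i) - f (y + eps *: e_ i)) - (f x - f y) by ring.
  apply: le_trans (ler_normB _ _) _; apply: lerD; last exact: H.1.
  by apply: le_trans (H.1 _ _) _; rewrite opprD addrACA subrr addr0.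
move=> x hx; rewrite !H.2 ?subrr ?mulr0//.
  by apply: lt_trans hx; rewrite ltrDl.
rewrite -(ltrD2r eps); apply: (lt_le_trans hx).
rewrite -[X in `|X| <= _](addrK (eps *: e_ i)); apply: le_trans (ler_normB _ _) _.
by rewrite lerD2l normrZ norm_delta mulr1 gtr0_norm.
Qed.

(** Averaging in further directions preserves the derivatives that are
    already present. *)
Lemma has_partial_avg i j f D C K rho K' rho' : lipc f K rho -> lipc D K' rho' ->
  has_partial f i D C -> has_partial (avg j f) i (avg j D) C.
Proof.
move=> Hf HD H x t.
have I1 := L1_line j (x + t *: e_ i) Hf; have I2 := L1_line j x Hf.
have I3 : L1 (fun s => t * line D j x s) by apply: L1Z; exact: L1_line HD.
have hb s : 0 <= s <= eps ->
    `|line f j (x + t *: e_ i) s - line f j x s - t * line D j x s - 0| <= C * t ^+ 2.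
  by move=> _; rewrite subr0 /line (addrAC x); exact: H.
have := avg_bound (L1B (L1B I1 I2) I3) hb.
rewrite !(primDB _ (L1B I1 I2) I3) !(primDB _ I1 I2) !(primZ _ _ (L1_line j x HD)) subr0 => h.
have -> : avg j f (x + t *: e_ i) - avg j f x - t * avg j D x = eps^-1 *
  (prim (line f j (x + t *: e_ i)) eps - prim (line f j x) eps - t * prim (line D j x) eps -
   (prim (line f j (x + t *: e_ i)) 0 - prim (line f j x) 0 - t * prim (line D j x) 0)).
  by rewrite /avg; ring.
exact: h.
Qed.

Definition mollify (s : seq 'I_d) (f : V -> R) : V -> R := foldr avg f s.

Lemma lipc_mollify s f K rho : lipc f K rho ->
  lipc (mollify s f) K (rho + (size s)%:R * eps).
Proof.
move=> H; elim: s => [|i s IH] /=; first by rewrite mul0r addr0.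
have := lipc_avg i IH; congr lipc; rewrite -natr1; ring.
Qed.

Lemma mollify_partial s f K rho : lipc f K rho -> exists D : 'I_d -> V -> R,
  forall i, i \in s -> has_partial (mollify s f) i (D i) (2 * K / eps) /\
     lipc (D i) (2 * K / eps) (rho + (size s)%:R * eps).
Proof.
move=> H; elim: s => [|j s [D HD]]; first by exists (fun _ _ => 0).
have Hs := lipc_mollify s H.
exists (fun i => if i == j then fun x => eps^-1 * (mollify s f (x + eps *: e_ j) - mollify s f x)
  else avg j (D i)) => i.
have E : rho + (size (j :: s))%:R * eps = rho + (size s)%:R * eps + eps.
  by rewrite /= -natr1; ring.
rewrite inE E; case: eqP => [->|_]/=.
  by move=> _; split; [exact: (avg_partial _ Hs)|exact: lipc_difference].
move=> /HD[h1 h2]; split; first exact: (has_partial_avg _ Hs h2).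
exact: lipc_avg.
Qed.

Lemma mollify_compare s f g K rho K' rho' c a x y k : lipc f K rho -> lipc g K' rho' ->
  (forall z, `|z| <= (size s)%:R * eps -> `|f (x + z) - c * g (y + z) - a| <= k) ->
  `|mollify s f x - c * mollify s g y - a| <= k.
Proof.
move=> Hf Hg; elim: s x y => [|i s IH] x y H /=.
  by have := H 0; rewrite !addr0 normr0 mul0r lexx; apply.
apply: (avg_compare (lipc_mollify s Hf) (lipc_mollify s Hg)) => r /andP[r0 re].
apply: IH => z hz; rewrite -(addrA x) -(addrA y); apply: H.
apply: le_trans (ler_normD _ _) _; rewrite normrZ norm_delta mulr1 ger0_norm// -natr1 mulrDl mul1r addrC.
exact: lerD.
Qed.

End average.

Section partials.
Context {R : realType} {d : nat}.
Local Notation V := 'rV[R]_d.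
Local Notation e_ i := (delta_mx 0 i : V).

(** The coordinates of x are changed into those of y one after the other. *)
Lemma c11_of_partials (h : V -> R) (D : 'I_d -> V -> R) C rho : 0 <= C ->
  (forall i, has_partial h i (D i) C) ->
  (forall i x y, `|D i x - D i y| <= C * `|x - y|) ->
  (forall x, rho < `|x| -> h x = 0) -> (forall i x, rho < `|x| -> D i x = 0) ->
  c11 h (fun x => \row_i D i x) ((2 * d%:R + 1) * C) rho.
Proof.
move=> C0 Hp Hl h0 D0.
have C1 : C <= (2 * d%:R + 1) * C by rewrite mulrDl mul1r lerDr mulr_ge0// mulr_ge0.
split.
- move=> x y.
  (* z k has the first k coordinates of y and the others of x *)
  pose z k : V := \row_i (if (i < k)%N then y 0 i else x 0 i).
  have z0 : z 0%N = x by apply/rowP => i; rewrite mxE.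
  have zd : z d = y by apply/rowP => i; rewrite mxE ltn_ord.
  have zS (i : 'I_d) : z i.+1 = z i + (y - x) 0 i *: e_ i.
    apply/rowP => j; rewrite !mxE ltnS leq_eqVlt eqxx/=.
    have [->|ji] := eqVneq j i; first by rewrite eqxx/= ltnn mulr1 addrCA subrr addr0.
    by rewrite (negbTE (ji : val j != val i))/= mulr0 addr0.
  have zx k : `|z k - x| <= `|y - x|.
    apply: rV_norm_le => // i; rewrite !mxE; case: ifP => _; last by rewrite subrr normr0.
    by have := rV_coord_le (y - x) i; rewrite !mxE.
  rewrite -{1}zd -{1}z0 -(telescope_sumr (fun k => h (z k)))// big_mkord /dot -sumrB.
  apply: le_trans (ler_norm_sum _ _ _) _.
  apply: (@le_trans _ _ (\sum_(i < d) 2 * C * `|y - x| ^+ 2)).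
    apply: ler_sum => i _; rewrite mxE zS.
    have t1 : `|(y - x) 0 i| <= `|y - x| by exact: rV_coord_le.
    have := Hp i (z i) ((y - x) 0 i) => h1; have := Hl i (z i) x => h2.
    have -> : h (z i + (y - x) 0 i *: e_ i) - h (z i) - D i x * (y - x) 0 i =
      (h (z i + (y - x) 0 i *: e_ i) - h (z i) - (y - x) 0 i * D i (z i)) +
      (y - x) 0 i * (D i (z i) - D i x) by ring.
    rewrite (_ : 2 * C * _ = C * `|y - x| ^+ 2 + `|y - x| * (C * `|y - x|)); last by ring.
    apply: le_trans (ler_normD _ _) _; apply: lerD.
      by apply: le_trans h1 _; rewrite ler_wpM2l// -real_normK ?num_real// ler_sqr ?nnegrE.
    rewrite normrM ler_pM//; apply: le_trans h2 _; rewrite ler_wpM2l//; exact: zx.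
  rewrite sumr_const card_ord -[leLHS]mulr_natl.
  rewrite (_ : d%:R * _ = 2 * d%:R * C * `|y - x| ^+ 2); last by ring.
  by rewrite ler_wpM2r ?exprn_ge0// ler_wpM2r// lerDl.
- move=> x y; apply: rV_norm_le => [|i]; first by rewrite mulr_ge0// (le_trans C0).
  by rewrite !mxE; apply: le_trans (Hl _ _ _) _; rewrite ler_wpM2r.
- by move=> x hx; split; [exact: h0|apply/rowP => i; rewrite !mxE D0].
Qed.

(** The average over the cube of side eps with a corner at the argument.
    Later only these properties matter: C^{1,1} regularity, with a constant
    that blows up as eps vanishes; preservation of the Lipschitz constant,
    uniformly in eps; and the passage of estimates between translates of f
    and g to their averages. *)
Lemma mollifier_exists (eps : R) : 0 < eps ->
  exists M : (V -> R) -> V -> R,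
  [/\ forall f K rho, 0 <= K -> lipc f K rho ->
        exists D, c11 (M f) D ((2 * d%:R + 1) * (2 * K / eps)) (rho + d%:R * eps),
      forall f K rho, lipc f K rho -> lipc (M f) K (rho + d%:R * eps) &
      forall f g K rho K' rho' c a x y k, lipc f K rho -> lipc g K' rho' ->
        (forall z, `|z| <= d%:R * eps -> `|f (x + z) - c * g (y + z) - a| <= k) ->
        `|M f x - c * M g y - a| <= k].
Proof.
move=> eps0; exists (mollify eps (enum 'I_d)).
have sz : size (enum 'I_d) = d by rewrite size_enum_ord.
split.
- move=> f K rho K0 Hf; have [D HD] := mollify_partial eps0 (enum 'I_d) Hf.
  rewrite sz in HD; have ls := lipc_mollify eps0 (enum 'I_d) Hf; rewrite sz in ls.
  exists (fun x => \row_i D i x); apply: c11_of_partials.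
  + by rewrite divr_ge0 ?mulr_ge0// ltW.
  + by move=> i; have [|] := HD i; rewrite ?mem_enum.
  + by move=> i x y; have [|_ []] := HD i; rewrite ?mem_enum//.
  + exact: ls.2.
  + by move=> i x; have [|_ []] := HD i; rewrite ?mem_enum// => _; apply.
- by move=> f K rho Hf; have := lipc_mollify eps0 (enum 'I_d) Hf; rewrite sz.
- move=> f g K rho K' rho' c a x y k Hf Hg H; apply: (mollify_compare eps0 Hf Hg).
  by rewrite sz.
Qed.

End partials.

(** * The measures over a short time *)

Section exponential.
Context {R : realType}.

Lemma expR_lip (p q E : R) : `|p| <= E -> `|q| <= E ->
  `|expR p - expR q| <= expR E * `|p - q|.
Proof.
have key a b : `|a| <= E -> expR a - expR b <= expR E * `|a - b|.
  move=> aE; have -> : expR a - expR b = expR a * (1 - expR (b - a)).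
    by rewrite mulrBr mulr1 -expRD [a + _]addrC subrK.
  have := expR_ge1Dx (b - a) => h.
  apply: (@le_trans _ _ (expR a * `|a - b|)).
    rewrite ler_wpM2l ?expR_ge0//; apply: le_trans (ler_norm _); move: h; lra.
  by rewrite ler_wpM2r// ler_expR (le_trans (ler_norm _)).
move=> pE qE; rewrite ler_norml (key p q pE) andbT lerNl opprB distrC; exact: key.
Qed.

Lemma expR_taylor (p E : R) : `|p| <= E -> `|expR p - 1 - p| <= expR E * p ^+ 2.
Proof.
move=> pE; have h1 := expR_ge1Dx p; have h2 := expR_ge1Dx (- p).
rewrite ger0_norm; last by move: h1; lra.
have h3 : expR p - 1 <= expR p * p.
  have -> : expR p - 1 = expR p * (1 - expR (- p)) by rewrite mulrBr mulr1 -expRD subrr expR0.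
  by rewrite ler_wpM2l ?expR_ge0//; move: h2; lra.
have E0 : 0 <= E by apply: le_trans pE.
have h4 := expR_lip (q := 0) pE; rewrite normr0 expR0 subr0 in h4.
have {}h4 := h4 E0.
have h5 : expR E * p ^+ 2 = expR E * `|p| * `|p| by rewrite -mulrA -expr2 real_normK ?num_real.
rewrite h5; apply: (@le_trans _ _ (`|expR p - 1| * `|p|)); last by rewrite ler_wpM2r.
rewrite -normrM; apply: le_trans (ler_norm _).
have -> : (expR p - 1) * p = expR p * p - p by ring.
by rewrite lerB.
Qed.

End exponential.

Section time_regularity.
Context {R : realType} {d : nat}.
Local Notation V := 'rV[R]_d.
Local Notation leb := (@lebesgue_measure R).

Lemma c11_gradient_le (h : V -> R) D C rho K : (1 <= d)%N -> 0 <= K -> c11 h D C rho ->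
  (forall x y, `|h x - h y| <= K * `|x - y|) -> forall x, `|D x| <= K.
Proof.
move=> d1 K0 H Kh x; apply: rV_norm_le => // i.
apply: (@le_of_small _ _ _ C) => t /andP[t0 _].
have := c11_taylor H x (x + t *: delta_mx 0 i); have := Kh (x + t *: delta_mx 0 i) x.
have -> : x + t *: delta_mx 0 i - x = t *: delta_mx 0 i by rewrite addrAC subrr add0r.
rewrite normrZ norm_delta mulr1 gtr0_norm//.
have -> : dot (D x) (t *: delta_mx 0 i) = t * D x 0 i.
  rewrite /dot (bigD1 i)//= big1 ?addr0; last first.
    by move=> j ji; rewrite !mxE (negbTE ji) andbF !mulr0.
  by rewrite !mxE !eqxx mulr1 mulrC.
move=> h1 h2; rewrite -(ler_pM2l t0) -{1}(gtr0_norm t0) -normrM.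
rewrite -[t * D x 0 i](subKr (h (x + t *: delta_mx 0 i) - h x)).
apply: le_trans (ler_normB _ _) _; rewrite mulrDr (mulrC t K); apply: lerD => //.
by apply: le_trans h2 _; rewrite expr2 mulrC mulrA.
Qed.

Lemma lipc_bounded (F : V -> R) K rho : (1 <= d)%N -> 0 <= K -> lipc F K rho ->
  forall x, `|F x| <= K * (2 * `|rho| + 1).
Proof.
move=> d1 K0 [KF F0] x; have [y ry y1] := @far_point R d rho d1.
have [xr|/F0->] := leP `|x| rho; last first.
  by rewrite normr0 mulr_ge0// addr_ge0// mulr_ge0.
have := KF x y; rewrite (F0 y ry) subr0 => /le_trans; apply; rewrite ler_wpM2l//.
apply: le_trans (ler_normB _ _) _.
have -> : 2 * `|rho| + 1 = `|rho| + (`|rho| + 1) by ring.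
by apply: lerD => //; apply: le_trans xr (ler_norm _).
Qed.

Lemma lipcN (F : V -> R) K rho : lipc F K rho -> lipc (fun x => - F x) K rho.
Proof.
move=> [KF F0]; split; first by move=> x y; rewrite -opprD normrN.
by move=> x /F0->; rewrite oppr0.
Qed.

Variables (T : R) (mu : R -> {finite_measure set V -> \bar R}).
Variables (v : R -> V -> V) (w : R -> V -> R) (vh : R -> V -> V) (wh : R -> V -> R).
Variable (L : nat -> R -> R).
Hypotheses (hd : (1 <= d)%N) (hT : 0 < T) (hmu : narrowly_continuous T mu)
  (lf : local_field vh wh L).
Hypothesis heq : solves_continuity_equation T v w mu.
Hypothesis hae : {ae leb, forall t, 0 <= t <= T -> vh t = v t /\ wh t = w t}.
Variable M : R.
Hypotheses (M0 : 0 <= M) (HM : forall t, 0 <= t <= T -> fine (mu t setT) <= M).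

Lemma Rintegral_opp (m : {finite_measure set V -> \bar R}) (F : V -> R) :
  m.-integrable setT (EFin \o F) -> \int[m]_x - F x = - \int[m]_x F x.
Proof.
move=> IF; rewrite (@eq_Rintegral _ _ _ _ _ (fun x => -1 * F x)).
  by rewrite RintegralZl// mulN1r.
by move=> x _; rewrite mulN1r.
Qed.

Lemma lipc_measurable (F : V -> R) K rho : lipc F K rho -> measurable_fun setT F.
Proof.
by move=> [KF _]; apply: continuous_measurable_rV; exact: (@lipschitz_continuous R V R F K).
Qed.

Lemma lipc_integrable (m : {finite_measure set V -> \bar R}) (F : V -> R) K rho : 0 <= K ->
  lipc F K rho -> m.-integrable setT (EFin \o F).
Proof.
by move=> K0 HF; exact: bounded_integrable (lipc_measurable HF) (lipc_bounded hd K0 HF).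
Qed.

Lemma mollified_close (f g : V -> R) c t : 0 <= t <= T ->
  (mu t).-integrable setT (EFin \o f) -> (mu t).-integrable setT (EFin \o g) ->
  (forall x, `|f x - g x| <= c) -> `|(\int[mu t]_x f x) - (\int[mu t]_x g x)| <= c * M.
Proof.
move=> tT If Ig fg; rewrite -(RintegralB measurableT If Ig).
have c0 : 0 <= c := le_trans (normr_ge0 _) (fg 0).
apply: le_trans (Rintegral_norm_le (mu t) (B := c) _ fg) _; last by rewrite ler_wpM2l ?HM.
by apply: measurable_funB; apply/measurable_EFinP; [case/integrableP : If|case/integrableP : Ig].
Qed.

(** The averages of F are of class C^{1,1} and have gradients bounded by the
    Lipschitz constant of F, independently of the scale. The estimate that
    the weak form gives for them depends on no other derivative, hence
    survives as the scale vanishes. *)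
Lemma lipc_increment (F : V -> R) K rho n a b : 0 <= K -> lipc F K rho -> rho + 1 <= n%:R ->
  0 <= a -> a <= b -> b <= T ->
  `|(\int[mu b]_x F x) - (\int[mu a]_x F x)| <=
  (d%:R + 1) * (K * (2 * `|rho| + 3)) * M * (prim (L n) b - prim (L n) a).
Proof.
move=> K0 HF rn a0 ab bT.
have tT t : t = a \/ t = b -> 0 <= t <= T.
  by case=> ->; apply/andP; split=> //; [exact: le_trans bT|exact: le_trans ab].
pose c := (d%:R + 1) * (K * (2 * `|rho| + 3)).
suff key G : lipc G K rho -> (\int[mu b]_x G x) - (\int[mu a]_x G x) <=
    c * M * (prim (L n) b - prim (L n) a).
  rewrite ler_norml (key _ HF) andbT lerNl; have := key _ (lipcN HF).
  rewrite !Rintegral_opp; [|exact: lipc_integrable HF|exact: lipc_integrable HF].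
  by rewrite -opprD.
move=> {F HF} HG.
apply: (@le_of_small _ _ _ (K * M + K * M)) => dl /andP[dl0 dl1].
have d0 : 0 < d%:R + 1 :> R by rewrite ltr_wpDl.
pose eps := dl / (d%:R + 1); have eps0 : 0 < eps by rewrite divr_gt0.
have de : d%:R * eps <= dl.
  by rewrite /eps mulrCA ler_piMr ?(ltW dl0)// ler_pdivrMr// mul1r lerDl.
have [Mo [Mo1 Mo2 Mo3]] := @mollifier_exists R d eps eps0.
have [D HD] := Mo1 _ _ _ K0 HG; have HL := Mo2 _ _ _ HG.
have r1 : rho + d%:R * eps <= n%:R by apply: le_trans rn; rewrite lerD2l (le_trans de).
have r2 : `|rho + d%:R * eps| <= `|rho| + 1.
  apply: le_trans (ler_normD _ _) _; rewrite lerD2l ger0_norm ?(le_trans de)//.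
  by rewrite mulr_ge0// ltW.
set h := Mo G in HD HL.
pose B := K * (2 * `|rho| + 3).
have KB : K <= B by rewrite /B ler_peMr// -[leLHS]add0r lerD ?mulr_ge0// ler1n.
have hB x : `|h x| <= B.
  apply: le_trans (lipc_bounded hd K0 HL x) _; rewrite /B ler_wpM2l//.
  by move: r2; move: `|rho + _| `|rho| => p q; lra.
have bp : bounded_pair h D B n.
  have [B' [m1 m2 _ _ out]] := c11_bounded_pair hd HD r1.
  split=> // x; exact: le_trans (c11_gradient_le hd K0 HD HL.1 x) KB.
have close x : `|h x - G x| <= K * dl.
  have := Mo3 G G K rho K rho 0 (G x) x x (K * dl) HG HG.
  rewrite mul0r subr0; apply => z hz; rewrite mul0r subr0; apply: le_trans (HG.1 _ _) _.
  by rewrite addrAC subrr add0r ler_wpM2l// (le_trans hz).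
have IF t := bounded_integrable (mu t) (field_measurable lf t bp) (fun x => field_le lf t x bp).
have := weak_c11 hd hT hmu lf heq hae (G := fun t => c * M * L n t) HD a0 ab bT.
have ILn := lf_L1 lf n.
move=> /(_ (L1Z _ ILn)) hw.
have {}hw : (\int[mu b]_x h x) - (\int[mu a]_x h x) <= c * M * (prim (L n) b - prim (L n) a).
  rewrite mulrBr -(primZ _ b ILn) -(primZ _ a ILn); apply: hw.
  apply: ae_all => t /andP[at_ tb]; apply: le_trans (ler_norm _) _.
  apply: le_trans (Rintegral_norm_le (mu t) (field_measurable lf t bp) (fun x => field_le lf t x bp)) _.
  rewrite (_ : (d%:R + 1) * B = c)// mulrAC; apply: ler_wpM2r; first exact: lf_L0 lf _ _.
  apply: ler_wpM2l; last by apply: HM; rewrite (le_trans a0)// (le_trans tb).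
  by rewrite /c; apply: mulr_ge0; [exact: ltW|rewrite mulr_ge0// addr_ge0// mulr_ge0].
have Ih t := bounded_integrable (mu t) (bp_mh bp) hB.
have IG t := lipc_integrable (mu t) K0 HG.
have q1 := mollified_close (tT a (or_introl erefl)) (Ih a) (IG a) close.
have q2 := mollified_close (tT b (or_intror erefl)) (Ih b) (IG b) close.
move: q1 q2; rewrite !ler_norml => /andP[_ q1] /andP[q2 _].
have -> : dl * (K * M + K * M) = K * dl * M + K * dl * M by ring.
exact: triangle_transfer q1 q2 hw.
Qed.

End time_regularity.

Lemma prim_diff_indic (R : realType) (f : R -> R) a b : L1 f -> a <= b ->
  prim f b - prim f a = \int[@lebesgue_measure R]_r (f r * (\1_(`]a, b]%classic : set R)) r).
Proof.
move=> If ab; rewrite primB// Rintegral_mkcond; apply: eq_Rintegral => r _.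
by rewrite patchE indicE; case: (_ \in _); rewrite ?mulr1 ?mulr0.
Qed.

Lemma fubini_dominated (R : realType) dp (S : measurableType dp)
    (m : {finite_measure set S -> \bar R}) (J : R -> S -> R) (Lam : R -> R) :
  measurable_fun setT (fun p : R * S => J p.1 p.2) -> L1 Lam ->
  (forall r x, `|J r x| <= Lam r) ->
  [/\ L1 (fun r => \int[m]_x J r x),
      m.-integrable setT (EFin \o (fun x => \int[@lebesgue_measure R]_r J r x)) &
      \int[@lebesgue_measure R]_r (\int[m]_x J r x) = \int[m]_x (\int[@lebesgue_measure R]_r J r x)].
Proof.
move=> mJ IL JL.
pose f (p : R * S) : \bar R := (J p.1 p.2)%:E.
have mf : measurable_fun setT f by exact/measurable_EFinP.
have If : (@lebesgue_measure R \x m)%E.-integrable setT f.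
  apply: (@integrable12ltyP _ _ (measurableTypeR R) S R (@lebesgue_measure R) m f mf).2.
  have ILm : (@lebesgue_measure R).-integrable setT (EFin \o (fun r => fine (m setT) * Lam r)) by exact: L1Z.
  have /integrableP[_] := ILm; apply: le_lt_trans.
  apply: ge0_le_integral_any => [r _|r _|r _]; [exact: integral_ge0|exact: abse_ge0|].
  apply: (@le_trans _ _ (\int[m]_x (cst (Lam r)%:E) x)%E).
    by apply: ge0_le_integral_any => [x _|x _|x _]; rewrite ?abse_ge0//= lee_fin ?JL// (le_trans _ (JL r x)).
  rewrite integral_cst//= -(@fineK _ (m setT)) ?fin_num_measure// -EFinM lee_fin mulrC.
  exact: ler_norm.
have S1 r x : `|J r x| <= Lam r by exact: JL.
have mJr r : measurable_fun setT (J r).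
  apply: (@measurableT_comp _ _ _ _ _ _ (fun p : R * S => J p.1 p.2) _ (fun x => (r, x))) => //.
  by apply: measurable_fun_pair => //; exact: measurable_cst.
have Ir r : m.-integrable setT (EFin \o J r).
  apply: measurable_bounded_integrable => //; first by rewrite ltey_eq fin_num_measure.
  by exists (Lam r); split; [exact: num_real|move=> k rk x _; apply: le_trans (JL r x) (ltW rk)].
have Ix x : L1 (J^~ x).
  apply: (L1_dom _ IL) => //.
  apply: (@measurableT_comp _ _ _ _ _ _ (fun p : R * S => J p.1 p.2) _ (fun r => (r, x))) => //.
have F1 r : fubini_F m f r = (\int[m]_x J r x)%:E by rewrite /fubini_F/= Rintegral_EFin.
have F2 x : fubini_G (@lebesgue_measure R) f x = (\int[@lebesgue_measure R]_r J r x)%:E.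
  by rewrite /fubini_G/= Rintegral_EFin//; exact: Ix.
split.
- by move: (integrable_fubini_F If); congr (integrable _ _ _); apply/funext => r; exact: F1.
- apply: measurable_bounded_integrable => //; first by rewrite ltey_eq fin_num_measure.
    apply/measurable_EFinP; move: (measurable_fubini_G If).
    by congr (measurable_fun _ _); apply/funext => x; exact: F2.
  exists (\int[@lebesgue_measure R]_r Lam r); split; [exact: num_real|move=> k lk x _].
  apply: le_trans (ltW lk); apply: le_trans (le_normr_Rintegral _ (Ix x)) _ => //.
  by apply: le_Rintegral => //; apply: integrable_norm; exact: Ix.
- rewrite /Rintegral; congr fine.
  apply: (@etrans _ _ (\int[@lebesgue_measure R]_r fubini_F m f r)%E).
    by apply: eq_integral => r _; rewrite F1.
  apply: (@etrans _ _ (\int[m]_x fubini_G (@lebesgue_measure R) f x)%E).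
    exact: Fubini If.
  by apply: eq_integral => x _; rewrite F2.
Qed.

Section one_step.
Context {R : realType} {d : nat}.
Local Notation V := 'rV[R]_d.
Local Notation leb := (@lebesgue_measure R).

Variables (T : R) (mu : R -> {finite_measure set V -> \bar R}).
Variables (v : R -> V -> V) (w : R -> V -> R) (vh : R -> V -> V) (wh : R -> V -> R).
Variable (L : nat -> R -> R).
Hypotheses (hd : (1 <= d)%N) (hT : 0 < T) (hmu : narrowly_continuous T mu)
  (lf : local_field vh wh L).
Hypothesis heq : solves_continuity_equation T v w mu.
Hypothesis hae : {ae leb, forall t, 0 <= t <= T -> vh t = v t /\ wh t = w t}.
Variable M : R.
Hypotheses (M0 : 0 <= M) (HM : forall t, 0 <= t <= T -> fine (mu t setT) <= M).

Local Notation fld := (field vh wh).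

Lemma field_lipc (h : V -> R) D C rho B n t : c11 h D C rho -> 0 <= B -> C <= B ->
  (forall x, `|h x| <= B) -> (forall x, `|D x| <= B) ->
  (forall x y, `|h x - h y| <= B * `|x - y|) -> rho + 1 <= n%:R ->
  lipc (fld h D t) ((3 * d%:R + 3) * B * L n t) rho.
Proof.
move=> H B0 CB hB DB hL rn; have L0 := lf_L0 lf n t.
have bp : bounded_pair h D B n.
  have [|B' [m1 m2 _ _ out]] := @c11_bounded_pair R d h D C rho n hd H; last by split.
  by apply: le_trans rn; rewrite lerDl.
have Fo x : rho < `|x| -> fld h D t x = 0.
  by move=> /(c11_out H)[hx Dx]; rewrite /field hx Dx dot0l mul0r addr0.
have Ft x := field_le lf t x bp.
split=> //.
have K0 : 0 <= (d%:R + 1) * B * L n t by rewrite !mulr_ge0// addr_ge0.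
have KE : (3 * d%:R + 3) * B * L n t = (d%:R + 1) * B * L n t + 2 * ((d%:R + 1) * B * L n t) by ring.
(* a point of norm above n >= rho + 1 is at distance at least 1 from the
   support, so that a bound on the function suffices *)
have far x y : n%:R < `|x| -> `|fld h D t x - fld h D t y| <= (d%:R + 1) * B * L n t * `|x - y|.
  move=> xn; rewrite (Fo x) ?sub0r ?normrN; last first.
    by apply: lt_trans xn; apply: lt_le_trans rn; rewrite ltrDl.
  have [yr|/Fo->] := leP `|y| rho; last by rewrite normr0 mulr_ge0.
  apply: le_trans (Ft y) _; rewrite ler_peMr//.
  have : `|x| <= `|x - y| + `|y| by rewrite -{1}(subrK y x) ler_normD.
  move=> hx; rewrite -(lerD2r rho) addrC; apply: (le_trans rn); apply: le_trans (ltW xn) _.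
  by apply: le_trans hx _; rewrite lerD2l.
move=> x y; rewrite KE mulrDl.
have k20 : 0 <= 2 * ((d%:R + 1) * B * L n t) * `|x - y| by rewrite !mulr_ge0// addr_ge0.
have k10 : 0 <= (d%:R + 1) * B * L n t * `|x - y| by rewrite !mulr_ge0// addr_ge0.
have [xn|xn] := leP `|x| n%:R; last by apply: le_trans (far x y xn) _; rewrite lerDl.
have [yn|yn] := leP `|y| n%:R; last first.
  by rewrite distrC (distrC x); apply: le_trans (far y x yn) _; rewrite distrC lerDl.
have -> : fld h D t x - fld h D t y =
  (dot (D x - D y) (vh t x) + dot (D y) (vh t x - vh t y)) +
  ((h x - h y) * wh t x + h y * (wh t x - wh t y)).
  by rewrite /field dotDl dotDr dotNl dotNr; ring.
apply: (@le_trans _ _ (2 * ((d%:R + 1) * B * L n t) * `|x - y|)); last by rewrite lerDr.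
have -> : 2 * ((d%:R + 1) * B * L n t) * `|x - y| =
  (d%:R * (B * `|x - y| * L n t) + d%:R * (B * (L n t * `|x - y|))) +
  (B * `|x - y| * L n t + B * (L n t * `|x - y|)) by ring.
apply: le_trans (ler_normD _ _) _; apply: lerD; (apply: le_trans (ler_normD _ _) _; apply: lerD).
- apply: le_trans (dot_le _ _) _; rewrite ler_wpM2l// ler_pM//; last exact: (lf_v lf).
  by apply: le_trans (c11_lip H _ _) _; rewrite ler_wpM2r.
- apply: le_trans (dot_le _ _) _; rewrite ler_wpM2l// ler_pM//; exact: (lf_vl lf).
- by rewrite normrM ler_pM//; exact: (lf_w lf).
- by rewrite normrM ler_pM//; exact: (lf_wl lf).
Qed.

Lemma field_measurable2 (h : V -> R) D B n : bounded_pair h D B n ->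
  measurable_fun setT (fun p : R * V => fld h D p.1 p.2).
Proof.
move=> H.
have m2 (f : V -> R) : measurable_fun setT f -> measurable_fun setT (fun p : R * V => f p.2).
  by move=> mf; exact: (measurableT_comp mf (@measurable_snd _ _ _ _)).
apply: measurable_funD; last by apply: measurable_funM; [exact: m2 (bp_mh H)|exact: lf_mw lf].
apply: measurable_sum => i; apply: measurable_funM; first exact: m2 (bp_mD H i).
exact: (measurableT_comp (measurable_coord i) (lf_mv lf)).
Qed.

Lemma L1_field (h : V -> R) D B n x : bounded_pair h D B n -> L1 (fun r => fld h D r x).
Proof.
move=> H; apply: (@L1_dom _ _ (fun r => (d%:R + 1) * B * L n r)).
- have mf := field_measurable2 H.
  apply: (@measurableT_comp _ _ _ _ _ _ (fun p : R * V => fld h D p.1 p.2) _ (fun r => (r, x))) => //.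
- by apply: L1Z; exact: (lf_L1 lf).
- by move=> r; have := field_le lf r x H.
Qed.

Lemma field_fubini (h : V -> R) D B n a b (m : {finite_measure set V -> \bar R}) :
  bounded_pair h D B n -> a <= b ->
  [/\ L1 (fun r => \int[m]_x fld h D r x),
      m.-integrable setT (EFin \o (fun x => prim (fun r => fld h D r x) b - prim (fun r => fld h D r x) a)) &
  prim (fun r => \int[m]_x fld h D r x) b - prim (fun r => \int[m]_x fld h D r x) a =
  \int[m]_x (prim (fun r => fld h D r x) b - prim (fun r => fld h D r x) a)].
Proof.
move=> H ab; have mf := field_measurable2 H.
have IB : L1 (fun r => (d%:R + 1) * B * L n r) by apply: L1Z; exact: (lf_L1 lf).
have [I1 _ _] := fubini_dominated m mf IB (fun r x => field_le lf r x H).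
pose J r x := fld h D r x * (\1_(`]a, b]%classic : set R)) r.
have mJ : measurable_fun setT (fun p : R * V => J p.1 p.2).
  apply: measurable_funM => //.
  exact: (measurableT_comp (measurable_indic _) (@measurable_fst _ _ _ _)).
have JB r x : `|J r x| <= (d%:R + 1) * B * L n r.
  apply: le_trans (field_le lf r x H); rewrite normrM ler_piMr// indicE.
  by case: (_ \in _); rewrite ?normr0 ?normr1.
have [_ J2 J3] := fubini_dominated m mJ IB JB.
have E x : prim (fun r => fld h D r x) b - prim (fun r => fld h D r x) a = \int[leb]_r J r x.
  by apply: prim_diff_indic => //; exact: L1_field H.
split=> //; first by move: J2; congr (integrable _ _ _); apply/funext => x; rewrite /= E.
rewrite (prim_diff_indic I1 ab) (eq_Rintegral _ (fun x _ => E x)) -J3.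
apply: eq_Rintegral => r _; rewrite mulrC -RintegralZl//.
  by apply: eq_Rintegral => x _; rewrite /J mulrC.
exact: bounded_integrable (field_measurable lf r H) (fun x => field_le lf r x H).
Qed.

(** In the weak form the field at time r is integrated against mu_r. It is
    Lipschitz with a constant proportional to L n r, so that by
    lipc_increment replacing mu_r by mu_a costs a multiple of L n r times
    the increment of the primitive of L n, which integrates to a square.
    Fubini's theorem then brings the time integral inside. *)
Lemma one_step_estimate C rho n : rho + 1 <= n%:R -> exists2 K : R, 0 <= K &
  forall (h : V -> R) D a b, c11 h D C rho -> 0 <= a -> a <= b -> b <= T ->
  (\int[mu b]_x h x) - (\int[mu a]_x h x) <=
  (\int[mu a]_x (prim (fun r => fld h D r x) b - prim (fun r => fld h D r x) a)) +
  K * (prim (L n) b - prim (L n) a) ^+ 2.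
Proof.
move=> rn; have [B B0 HB] := c11_uniform C rho hd.
pose k := (d%:R + 1) * ((3 * d%:R + 3) * B * (2 * `|rho| + 3)) * M.
have k0 : 0 <= k by rewrite /k !mulr_ge0// !addr_ge0// !mulr_ge0.
exists k => // h D a b H a0 ab bT; have [CB hB DB hL] := HB h D H.
have bp : bounded_pair h D B n.
  have [|B' [m1 m2 _ _ out]] := @c11_bounded_pair R d h D C rho n hd H; last by split.
  by apply: le_trans rn; rewrite lerDl.
have [I1 _ E] := field_fubini (mu a) bp ab.
have ILn := lf_L1 lf n; have L0 := lf_L0 lf n.
pose del := prim (L n) b - prim (L n) a.
have ILk : L1 (fun t => k * del * L n t) by exact: L1Z.
have := weak_c11 hd hT hmu lf heq hae H a0 ab bT (L1D I1 ILk) => /(_ _)/wrap[].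
  apply: ae_all => t /andP[at_ tb].
  have Ft := field_lipc t H B0 CB hB DB hL rn.
  have K0 : 0 <= (3 * d%:R + 3) * B * L n t by rewrite !mulr_ge0// addr_ge0// mulr_ge0.
  have := lipc_increment hd hT hmu lf heq hae HM K0 Ft rn a0 at_ (le_trans tb bT).
  move=> /(le_trans (ler_norm _)); rewrite lerBlDl => /le_trans; apply; rewrite lerD2l.
  have -> : (d%:R + 1) * ((3 * d%:R + 3) * B * L n t * (2 * `|rho| + 3)) * M *
    (prim (L n) t - prim (L n) a) = k * (prim (L n) t - prim (L n) a) * L n t by rewrite /k; ring.
  by rewrite ler_wpM2r// ler_wpM2l// lerD2r; exact: (prim_nd ILn).
rewrite (primD b I1 ILk) (primD a I1 ILk) (primZ _ b ILn) (primZ _ a ILn) -E => h1.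
apply: (le_trans h1); rewrite expr2 -/del.
rewrite le_eqVlt; apply/orP; left; apply/eqP; rewrite /del; ring.
Qed.

End one_step.

(** * Test functions carried along the flow *)

Section transported.
Context {R : realType} {d : nat}.
Local Notation V := 'rV[R]_d.
Local Notation leb := (@lebesgue_measure R).
Variables (L : R -> R) (f : R -> V -> V) (om : R -> V -> R).
Hypotheses (IL : L1 L).
Hypothesis mf : measurable_fun setT (fun p : R * V => f p.1 p.2).
Hypothesis fb : forall r x, `|f r x| <= L r.
Hypothesis fl : forall r x y, `|f r x - f r y| <= L r * `|x - y|.
Hypothesis mo : measurable_fun setT (fun p : R * V => om p.1 p.2).
Hypothesis ob : forall r x, `|om r x| <= L r.
Hypothesis ol : forall r x y, `|om r x - om r y| <= L r * `|x - y|.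
Local Notation m := (prim L).
Local Notation mass := (\int[leb]_q L q).
Local Notation Phi := (gflow f).
Local Notation FL := (flow_lip L).

Let L0 q : 0 <= L q. Proof. exact: le_trans (ob q 0). Qed.

Lemma L1_weight_along (X : R -> V) : measurable_fun setT X -> L1 (fun q => om q (X q)).
Proof.
move=> mX; apply: (L1_dom _ IL) => //.
exact: (measurableT_comp mo (measurable_fun_pair (@measurable_id _ _ setT) mX)).
Qed.

Lemma m_le a b : a <= b -> m a <= m b. Proof. exact: (prim_nd IL L0). Qed.

Lemma m_norm a b : a <= b -> `|m b - m a| = m b - m a.
Proof. by move=> ab; rewrite ger0_norm// subr_ge0 m_le. Qed.

(** The logarithm of the weight W_{a -> b}(x). *)
Definition logw (a b : R) (x : V) : R :=
  prim (fun q => om q (Phi a q x)) b - prim (fun q => om q (Phi a q x)) a.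

Let Iom a x : L1 (fun q => om q (Phi a q x)).
Proof. by apply: L1_weight_along; exact: (gflow_measurable IL mf fb fl). Qed.

Lemma logw_refl a x : logw a a x = 0. Proof. exact: subrr. Qed.

Lemma logw_trans a b c x : logw a c x = logw a b x + logw b c (Phi a b x).
Proof.
rewrite /logw.
have -> : (fun q => om q (Phi b q (Phi a b x))) = (fun q => om q (Phi a q x)).
  by apply/funext => q; rewrite (gflow_trans IL mf fb fl).
by ring.
Qed.

Lemma logw_norm a b x : `|logw a b x| <= `|m b - m a|.
Proof. by apply: prim_norm_btw. Qed.

Lemma logw_mass a b x : `|logw a b x| <= mass.
Proof. by apply: le_trans (logw_norm a b x) _; exact: (prim_le_mass IL L0). Qed.

Lemma prim_diff_le (g1 g2 : R -> R) k a b : L1 g1 -> L1 g2 -> 0 <= k ->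
  (forall q, btw a b q -> `|g1 q - g2 q| <= k * L q) ->
  `|(prim g1 b - prim g1 a) - (prim g2 b - prim g2 a)| <= k * `|m b - m a|.
Proof.
move=> I1 I2 k0 H; rewrite subrACA -!primDB//.
apply: le_trans (@prim_norm_btw _ _ (fun q => k * L q) a b _ _ _ H) _.
- exact: L1B.
- exact: L1Z.
- by move=> q; rewrite mulr_ge0.
by rewrite !primZ// -mulrBr normrM ger0_norm.
Qed.

Lemma logw_lip a b x y : `|logw a b x - logw a b y| <= FL * `|x - y| * `|m b - m a|.
Proof.
apply: prim_diff_le => //; first by rewrite mulr_ge0// (flow_lip_ge0 L).
move=> q _; apply: le_trans (ol _ _ _) _; rewrite mulrC ler_wpM2r//.
exact: (gflow_lip IL mf fb fl).
Qed.

Variables (phi : V -> R) (t s : R) (K B : R) (n : nat).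
Hypotheses (K0 : 0 <= K) (B0 : 0 <= B).
Hypotheses (phiK : forall x y, `|phi x - phi y| <= K * `|x - y|) (phiB : forall x, `|phi x| <= B).
Hypothesis phi_path : forall x, phi x != 0 -> forall q, btw t s q -> `|Phi t q x| < n%:R.

(** The function phi carried back from time t to time r, a formal solution
    of the dual equation. *)
Definition psi (r : R) (x : V) : R := phi (Phi r t x) * expR (logw r t x).

Local Notation E := (expR mass).
Definition psi_lip : R := (K * FL + B * (FL * mass)) * E.

Let mass0 : 0 <= mass. Proof. exact: (mass_ge0 IL fb). Qed.
Let FL0 : 0 <= FL. Proof. exact: (flow_lip_ge0 L). Qed.

Lemma psi_lip_ge0 : 0 <= psi_lip.
Proof. rewrite /psi_lip; apply: mulr_ge0; last exact: expR_ge0.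
by apply: addr_ge0; rewrite !mulr_ge0. Qed.

Lemma psi_refl x : psi t x = phi x.
Proof. by rewrite /psi logw_refl expR0 mulr1 (gflow_refl IL mf fb fl). Qed.

Lemma psi_step a b x : psi a x = psi b (Phi a b x) * expR (logw a b x).
Proof.
by rewrite /psi (gflow_trans IL mf fb fl) -mulrA -expRD addrC -logw_trans.
Qed.

Lemma expR_logw_le a b x : expR (logw a b x) <= E.
Proof. by rewrite ler_expR; apply: le_trans (ler_norm _) (logw_mass a b x). Qed.

Lemma psi_bound r x : `|psi r x| <= B * E.
Proof. by rewrite normrM ler_pM// (ger0_norm (expR_ge0 _)) expR_logw_le. Qed.

Lemma psi_lipc r : btw t s r -> lipc (psi r) psi_lip n%:R.
Proof.
move=> rts; split.
  move=> x y; rewrite /psi /psi_lip.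
  have -> : phi (Phi r t x) * expR (logw r t x) - phi (Phi r t y) * expR (logw r t y) =
    (phi (Phi r t x) - phi (Phi r t y)) * expR (logw r t x) +
    phi (Phi r t y) * (expR (logw r t x) - expR (logw r t y)) by ring.
  have -> : (K * FL + B * (FL * mass)) * E * `|x - y| =
     K * (FL * `|x - y|) * E + B * (E * (FL * `|x - y| * mass)) by ring.
  apply: le_trans (ler_normD _ _) _; apply: lerD; rewrite normrM ler_pM//.
  - apply: le_trans (phiK _ _) _; rewrite ler_wpM2l//; exact: (gflow_lip IL mf fb fl).
  - by rewrite (ger0_norm (expR_ge0 _)) expR_logw_le.
  - apply: le_trans (expR_lip (logw_mass r t x) (logw_mass r t y)) _.
    rewrite ler_wpM2l ?expR_ge0//; apply: le_trans (logw_lip r t x y) _.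
    by rewrite ler_wpM2l ?mulr_ge0//; exact: (prim_le_mass IL L0).
move=> x nx; rewrite /psi; have [->|/phi_path/(_ r rts)] := eqVneq (phi (Phi r t x)) 0; first by rewrite mul0r.
by rewrite (gflowK IL mf fb fl) => /ltW; rewrite leNgt nx.
Qed.

(** The displacement of x under the field frozen at x, a first-order
    approximation of the flow. *)
Definition drift (a b : R) (x : V) : V :=
  vprim (fun q => f q x) b - vprim (fun q => f q x) a.
Definition logw_drift (a b : R) (x : V) : R :=
  prim (fun q => om q x) b - prim (fun q => om q x) a.

Lemma drift_norm a b x : `|drift a b x| <= `|m b - m a|.
Proof.
apply: vprim_norm => //.
by apply: (vL1_along IL mf fb); exact: measurable_cst.
Qed.

Lemma logw_drift_norm a b x : `|logw_drift a b x| <= `|m b - m a|.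
Proof. by apply: prim_norm_btw => //; apply: L1_weight_along; exact: measurable_cst. Qed.

Lemma btw_m a b q : btw a b q -> `|m q - m a| <= `|m b - m a|.
Proof.
rewrite /btw => /orP[]/andP[h1 h2].
  by rewrite !m_norm ?lerD2r ?m_le// (le_trans h1).
by rewrite distrC (distrC (m b)) !m_norm ?lerD2l ?lerN2 ?m_le// (le_trans h1).
Qed.

Lemma flow_drift a b x : `|Phi a b x - x - drift a b x| <= `|m b - m a| * `|m b - m a|.
Proof.
rewrite {1}(gflow_eq IL mf fb fl) (addrC x) addrK.
have h (X : R -> V) : measurable_fun setT X -> vL1 (fun q => f q (X q)).
  by move=> mX; exact: (vL1_along IL mf fb).
have h1 := h _ (gflow_measurable IL mf fb fl a x).
have h2 := h _ (@measurable_cst _ _ _ _ setT x).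
apply: rV_norm_le => [|i]; first exact: mulr_ge0.
rewrite !mxE; apply: prim_diff_le => // q abq.
have := rV_coord_le (f q (Phi a q x) - f q x) i; rewrite !mxE => /le_trans; apply.
apply: le_trans (fl _ _ _) _; rewrite mulrC ler_wpM2r//.
by apply: le_trans (gflow_dist IL mf fb fl _ _ _) _; exact: btw_m.
Qed.

Lemma logw_near_drift a b x z : `|logw a b (x + z) - logw_drift a b x| <=
  (`|m b - m a| + `|z|) * `|m b - m a|.
Proof.
apply: prim_diff_le => //.
  by apply: L1_weight_along; exact: measurable_cst.
move=> q abq; apply: le_trans (ol _ _ _) _; rewrite mulrC ler_wpM2r//.
have -> : Phi a q (x + z) - x = (Phi a q (x + z) - (x + z)) + z by rewrite opprD addrA subrK.
apply: le_trans (ler_normD _ _) _; rewrite lerD2r.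
by apply: le_trans (gflow_dist IL mf fb fl _ _ _) _; exact: btw_m.
Qed.

Definition psi_step_const : R := psi_lip * E * (FL + 1) + B * E * E.

(** To first order in the time step, the flow translates all points x + z
    near x by the same vector and multiplies by the same weight. As the
    field is Lipschitz, the error is the time step times the sum of e and
    the time step. *)
Lemma psi_short_time a b x z e : btw t s b -> `|z| <= e ->
  `|psi a (x + z) - expR (logw_drift a b x) * psi b (x + drift a b x + z)| <=
  psi_step_const * (e * `|m b - m a| + `|m b - m a| ^+ 2).
Proof.
move=> tsb ze; set del := `|m b - m a|.
have e0 : 0 <= e := le_trans (normr_ge0 _) ze.
have del0 : 0 <= del := normr_ge0 _.
have [psiK _] := psi_lipc tsb.
rewrite (psi_step a b) /psi_step_const.
set u := expR (logw a b (x + z)); set c := expR (logw_drift a b x).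
have -> : psi b (Phi a b (x + z)) * u - c * psi b (x + drift a b x + z) =
  (psi b (Phi a b (x + z)) - psi b (x + drift a b x + z)) * u +
  psi b (x + drift a b x + z) * (u - c) by ring.
have h1 : `|Phi a b (x + z) - (x + drift a b x + z)| <= FL * e * del + del ^+ 2.
  have -> : Phi a b (x + z) - (x + drift a b x + z) =
    ((Phi a b (x + z) - (x + z)) - (Phi a b x - x)) + (Phi a b x - x - drift a b x).
    by apply/rowP => i; rewrite !mxE; ring.
  apply: le_trans (ler_normD _ _) _; apply: lerD; last by rewrite expr2; exact: flow_drift.
  apply: le_trans (gflow_displacement IL mf fb fl _ _ _ _) _.
  by rewrite ler_wpM2r// ler_wpM2l// addrAC subrr add0r.
have h2 : `|u - c| <= E * ((del + e) * del).
  apply: le_trans (expR_lip (logw_mass _ _ _) (_ : _ <= mass)) _.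
    by apply: le_trans (logw_drift_norm a b x) _; exact: (prim_le_mass IL L0).
  rewrite ler_wpM2l ?expR_ge0//; apply: le_trans (logw_near_drift a b x z) _.
  by rewrite ler_wpM2r// lerD2l.
apply: (@le_trans _ _ (psi_lip * (FL * e * del + del ^+ 2) * E + B * E * (E * ((del + e) * del)))).
  apply: le_trans (ler_normD _ _) _; apply: lerD; rewrite normrM ler_pM//.
  - by apply: le_trans (psiK _ _) _; rewrite ler_wpM2l// psi_lip_ge0.
  - by rewrite (ger0_norm (expR_ge0 _)) expR_logw_le.
  - exact: psi_bound.
have p0 := psi_lip_ge0; have E0 : 0 <= E := expR_ge0 _.
rewrite -subr_ge0.
have -> : (psi_lip * E * (FL + 1) + B * E * E) * (e * del + del ^+ 2) -
  (psi_lip * (FL * e * del + del ^+ 2) * E + B * E * (E * ((del + e) * del))) =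
  psi_lip * E * (e * del) + psi_lip * E * (FL * del ^+ 2) by ring.
have q0 : 0 <= psi_lip * E := mulr_ge0 p0 E0.
apply: addr_ge0; apply: mulr_ge0 => //; first exact: mulr_ge0.
by apply: mulr_ge0 => //; exact: exprn_ge0.
Qed.

End transported.

(** * Conservation along the flow *)

Section prim_linear.
Context {R : realType} {d : nat}.
Local Notation V := 'rV[R]_d.

Lemma prim_sum (I : Type) (s : seq I) (F : I -> R -> R) : (forall i, L1 (F i)) ->
  L1 (fun q => \sum_(i <- s) F i q) /\
  forall r, prim (fun q => \sum_(i <- s) F i q) r = \sum_(i <- s) prim (F i) r.
Proof.
move=> IF; elim: s => [|i s [IH E]].
  have E0 : (fun q => \sum_(i <- [::]) F i q) = cst 0 :> (R -> R).
    by apply/funext => q; rewrite big_nil.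
  have I0 : L1 (cst 0 : R -> R) by exact: integrable0.
  rewrite E0; split=> // r; rewrite big_nil.
  have -> : cst 0 = (fun q => 0 * (cst 0 : R -> R) q) by apply/funext => q; rewrite mul0r.
  by rewrite primZ// mul0r.
have E1 : (fun q => \sum_(j <- i :: s) F j q) = (fun q => F i q + \sum_(j <- s) F j q).
  by apply/funext => q; rewrite big_cons.
rewrite E1; split; first exact: L1D.
by move=> r; rewrite primD// E big_cons.
Qed.

Lemma prim_dot (a : V) (g : R -> V) : vL1 g ->
  L1 (fun q => dot a (g q)) /\ forall r, prim (fun q => dot a (g q)) r = dot a (vprim g r).
Proof.
move=> Ig.
have [I1 E1] := @prim_sum _ (index_enum 'I_d) (fun i q => a 0 i * g q 0 i) (fun i => L1Z _ (Ig i)).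
split=> // r; rewrite /dot E1; apply: eq_bigr => i _.
by rewrite primZ ?mxE//; exact: Ig.
Qed.

End prim_linear.

Lemma chain_transfer (R : realType) (gb ga pb pa p q p' q' : R) :
  gb - ga <= p -> - q <= gb - pb -> ga - pa <= q -> q <= q' -> p <= p' ->
  pb <= pa + (p' + (q' + q')).
Proof. lra. Qed.

Lemma step_transfer (R : realType) (I1 I2 I3 I4 p1 p2 : R) :
  I1 - I3 <= I4 + p2 -> I4 + (I3 - I2) <= p1 -> I1 - I2 <= p2 + p1.
Proof. lra. Qed.

Section transport.
Context {R : realType} {d : nat}.
Local Notation V := 'rV[R]_d.
Local Notation leb := (@lebesgue_measure R).
Variables (T : R) (mu : R -> {finite_measure set V -> \bar R}).
Variables (v : R -> V -> V) (w : R -> V -> R) (vh : R -> V -> V) (wh : R -> V -> R).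
Variable (L : nat -> R -> R).
Hypotheses (hd : (1 <= d)%N) (hT : 0 < T) (hmu : narrowly_continuous T mu)
  (lf : local_field vh wh L).
Hypothesis heq : solves_continuity_equation T v w mu.
Hypothesis hae : {ae leb, forall t, 0 <= t <= T -> vh t = v t /\ wh t = w t}.

Variable n : nat.
(* psi lives on the ball of radius n, its averages on that of radius n + 1
   at most, and one_step_estimate wants a further margin of 1 *)
Local Notation N := n.+2.
Local Notation f := (trunc vh N).
Local Notation om := (truncw wh N).
Local Notation m := (prim (L N)).
Local Notation Phi := (gflow f).
Local Notation mass := (\int[leb]_q L N q).

Let IL : L1 (L N) := lf_L1 lf N.
Let mf := measurable_trunc lf N.
Let fb := trunc_le lf N.
Let fl := trunc_lip lf N.
Let mo := truncw_measurable lf N.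
Let ob := truncw_le lf N.
Let ol := truncw_lip lf N.

Variables (t s : R) (K B : R).
Hypotheses (K0 : 0 <= K) (B0 : 0 <= B).

Definition compatible (phi : V -> R) : Prop :=
  [/\ forall x y, `|phi x - phi y| <= K * `|x - y|, forall x, `|phi x| <= B &
      forall x, phi x != 0 -> forall q, btw t s q -> `|Phi t q x| < n%:R].

Local Notation Kp := (psi_lip (L N) K B).
Local Notation Kq := (psi_step_const (L N) K B).
Local Notation E := (expR mass).
Local Notation field := (field vh wh).

Lemma field_integral (h : V -> R) D C rho a b x : c11 h D C rho -> rho <= N%:R ->
  prim (fun r => field h D r x) b - prim (fun r => field h D r x) a =
  dot (D x) (drift f a b x) + h x * logw_drift om a b x.
Proof.
move=> H rN.
have Iv : vL1 (fun r => f r x) by apply: (vL1_along IL mf fb); exact: measurable_cst.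
have Iw : L1 (fun r => om r x) by apply: (L1_weight_along IL mo ob); exact: measurable_cst.
have [I1 E1] := prim_dot (D x) Iv.
have -> : (fun r => field h D r x) = (fun r => dot (D x) (f r x) + h x * om r x).
  apply/funext => r; rewrite /field.
  have [xN|xN] := leP `|x| N%:R; first by rewrite trunc_id// /truncw clampV_id.
  by have [-> ->] := c11_out H (le_lt_trans rN xN); rewrite !dot0l !mul0r.
have I2 : L1 (fun r => h x * om r x) by exact: L1Z.
rewrite (primD b I1 I2) (primD a I1 I2) !E1 (primZ _ b Iw) (primZ _ a Iw).
by rewrite /drift /logw_drift dotDr dotNr; ring.
Qed.

Section fixed_phi.
Variables (phi : V -> R).
Hypothesis Hphi : compatible phi.
Local Notation psi := (psi f om phi t).

Let phiK x y : `|phi x - phi y| <= K * `|x - y|. Proof. by case: Hphi. Qed.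
Let phiB x : `|phi x| <= B. Proof. by case: Hphi. Qed.
Let phiP x : phi x != 0 -> forall q, btw t s q -> `|Phi t q x| < n%:R.
Proof. by case: Hphi => _ _; apply. Qed.

Lemma psiL r : btw t s r -> lipc (psi r) Kp n%:R.
Proof. exact: (psi_lipc IL mf fb fl mo ob ol K0 phiK phiB phiP). Qed.

(** Write y and o for the displacement and the log-weight of the field
    frozen at x, and h for the average of psi b. The time integral of the
    field is the first-order part <D x, y> + h x o of exp(o) h (x + y) - h
    x, while the average of psi a at x is exp(o) h (x + y) up to the error
    of psi_short_time. Thus the sum vanishes to first order. *)
Lemma mollified_step (Mo : (V -> R) -> V -> R) (e C : R) a b D x :
  0 <= e -> e <= 1 -> a <= b -> btw t s a -> btw t s b ->
  c11 (Mo (psi b)) D C (n%:R + e) ->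
  (forall x y, `|Mo (psi b) x - Mo (psi b) y| <= Kp * `|x - y|) ->
  (forall c a1 y1 y2 k, btw t s a1 ->
     (forall z, `|z| <= e -> `|psi a1 (y1 + z) - c * psi b (y2 + z) - 0| <= k) ->
     `|Mo (psi a1) y1 - c * Mo (psi b) y2 - 0| <= k) ->
  prim (fun r => field (Mo (psi b)) D r x) b - prim (fun r => field (Mo (psi b)) D r x) a +
    (Mo (psi b) x - Mo (psi a) x) <=
  (C + Kp + B * E * E + Kq) * (m b - m a) ^+ 2 + Kq * e * (m b - m a).
Proof.
move=> e0 e1 ab tsa tsb HD HL Hcmp; set h := Mo (psi b) in HD HL *.
have L0 := lf_L0 lf N; have mE := m_norm IL ob ab; set del := m b - m a in mE *.
have del0 : 0 <= del by rewrite -mE.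
have rN : n%:R + e <= N%:R.
  by rewrite -[X in _ <= X%:R]addn2 natrD lerD2l (le_trans e1)// ler1n.
rewrite (field_integral a b x HD rN).
set y := drift f a b x; set o := logw_drift om a b x; set c := expR o.
have yd : `|y| <= del by rewrite -mE; exact: (drift_norm IL mf fb).
have od : `|o| <= del by rewrite -mE; exact: (logw_drift_norm IL mo ob).
have oM : `|o| <= mass by apply: le_trans od _; rewrite -mE; exact: (prim_le_mass IL L0).
have h1 : `|Mo (psi a) x - c * h (x + y)| <= Kq * (e * del + del ^+ 2).
  have := Hcmp c a x (x + y) (Kq * (e * del + del ^+ 2)) tsa; rewrite subr0; apply => z ze.
  rewrite subr0 -mE.
  exact: (psi_short_time IL mf fb fl mo ob ol K0 B0 phiK phiB phiP a x tsb ze).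
have h2 : h x + dot (D x) y - h (x + y) <= C * del ^+ 2.
  have := c11_taylor HD x (x + y); rewrite (addrC x) addrK => T1.
  have C0 := c11_C0 HD hd.
  have : - (h (y + x) - h x - dot (D x) y) <= C * `|y| ^+ 2.
    by apply: le_trans T1; rewrite -normrN ler_norm.
  have : C * `|y| ^+ 2 <= C * del ^+ 2 by rewrite ler_wpM2l// ler_sqr ?nnegrE.
  move: (C * _) (C * _) (dot _ _) (h x) (h (y + x)) => p1 p2 p3 p4 p5; lra.
have h3 : (h x - h (x + y)) * o <= Kp * del ^+ 2.
  apply: le_trans (ler_norm _) _; rewrite normrM expr2 mulrA ler_pM//.
  apply: le_trans (HL _ _) _; rewrite opprD addrA subrr sub0r normrN ler_wpM2l//.
  exact: (psi_lip_ge0 IL fb K0 B0).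
have hB : `|h (x + y)| <= B * E.
  have := Hcmp 0 b (x + y) 0 (B * E) tsb; rewrite mul0r !subr0; apply => z _.
  by rewrite mul0r !subr0; exact: (psi_bound IL mf fb fl mo ob t phiB).
have h4 : - (h (x + y) * (c - 1 - o)) <= B * E * E * del ^+ 2.
  apply: le_trans (ler_norm _) _; rewrite normrN normrM -(mulrA (B * E)) ler_pM//.
  apply: le_trans (expR_taylor oM) _; rewrite ler_wpM2l ?expR_ge0//.
  by rewrite -real_normK ?num_real// ler_sqr ?nnegrE.
have h5 : - (Mo (psi a) x - c * h (x + y)) <= Kq * (e * del + del ^+ 2).
  by apply: le_trans h1; rewrite -normrN ler_norm.
have -> : dot (D x) y + h x * o + (h x - Mo (psi a) x) =
  (h x + dot (D x) y - h (x + y)) + (h x - h (x + y)) * o - h (x + y) * (c - 1 - o)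
  - (Mo (psi a) x - c * h (x + y)) by ring.
have -> : (C + Kp + B * E * E + Kq) * del ^+ 2 + Kq * e * del =
  C * del ^+ 2 + Kp * del ^+ 2 + B * E * E * del ^+ 2 + Kq * (e * del + del ^+ 2) by ring.
by apply: lerD => //; apply: lerD => //; exact: lerD.
Qed.

Let Kp0 : 0 <= Kp. Proof. exact: (psi_lip_ge0 IL fb K0 B0). Qed.
Let BE0 : 0 <= B * E * E.
Proof. exact: mulr_ge0 (mulr_ge0 B0 (expR_ge0 _)) (expR_ge0 _). Qed.
Let Kq0 : 0 <= Kq.
Proof.
exact: addr_ge0 (mulr_ge0 (mulr_ge0 Kp0 (expR_ge0 _)) (addr_ge0 (flow_lip_ge0 _) ler01)) BE0.
Qed.

(** For a fixed scale e, the integral g r of the average of psi r against mu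
    r has increments bounded by a square of the time step, with a constant
    that depends on e, plus a multiple of e times the time step. Subdivision
    removes the first term by sum_quadratic_errors, and letting e tend to 0
    removes the second. *)
Lemma integral_psi_nonincreasing a b : 0 <= a -> a <= b -> b <= T ->
  (forall r, a <= r <= b -> btw t s r) ->
  \int[mu b]_x psi b x <= \int[mu a]_x psi a x.
Proof.
move=> a0 ab bT tsr; have [M M0 HM] := mass_bounded hT hmu.
have tT r : a <= r <= b -> 0 <= r <= T.
  by move=> /andP[h1 h2]; rewrite (le_trans a0)// (le_trans h2).
have Ip r r' : a <= r <= b -> (mu r').-integrable setT (EFin \o psi r).
  by move=> /tsr tr; exact: (lipc_integrable hd (mu r') Kp0 (psiL tr)).
have d0 : 0 < d%:R + 1 :> R by rewrite ltr_wpDl.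
apply: (@le_of_small _ _ _ (Kq * M * (m b - m a) + (Kp * M + Kp * M))) => e0 /andP[e00 e01].
pose eps := e0 / (d%:R + 1); have eps0 : 0 < eps by rewrite divr_gt0.
pose e := d%:R * eps.
have e_ge0 : 0 <= e by rewrite mulr_ge0// ltW.
have ee0 : e <= e0.
  by rewrite /e /eps mulrCA ler_piMr ?(ltW e00)// ler_pdivrMr// mul1r lerDl.
have e1 : e <= 1 := le_trans ee0 e01.
have [Mo [Mo1 Mo2 Mo3]] := @mollifier_exists R d eps eps0.
pose C := (2 * d%:R + 1) * (2 * Kp / eps).
have C0 : 0 <= C.
  apply: mulr_ge0; first by rewrite addr_ge0// mulr_ge0.
  by apply: divr_ge0; [exact: mulr_ge0|exact: ltW].
have CK0 : 0 <= C + Kp + B * E * E + Kq by exact: addr_ge0 (addr_ge0 (addr_ge0 C0 Kp0) BE0) Kq0.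
have rN : n%:R + e + 1 <= N%:R.
  rewrite -[X in _ <= X%:R]addn2 natrD -addrA lerD2l; move: e1; lra.
have [K1 K10 HK1] := one_step_estimate hd hT hmu lf heq hae M0 HM C rN.
pose g r := \int[mu r]_x Mo (psi r) x.
have HL r : a <= r <= b -> lipc (Mo (psi r)) Kp (n%:R + e) by move=> /tsr /psiL /Mo2.
have Ig r r' : a <= r <= b -> (mu r').-integrable setT (EFin \o Mo (psi r)).
  by move=> /HL h; exact: (lipc_integrable hd (mu r') Kp0 h).
have close r : a <= r <= b -> `|g r - \int[mu r]_x psi r x| <= Kp * e * M.
  move=> rab; apply: (mollified_close HM (tT r rab) (Ig r r rab) (Ip r r rab)) => x.
  have pL := psiL (tsr r rab).
  have := Mo3 _ _ _ _ _ _ 0 (psi r x) x x (Kp * e) pL pL.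
  rewrite mul0r subr0; apply => z hz; rewrite mul0r subr0; apply: le_trans (pL.1 _ _) _.
  by rewrite addrAC subrr add0r ler_wpM2l.
have step a1 b1 : a <= a1 -> a1 <= b1 -> b1 <= b ->
    g b1 - g a1 <= (K1 + (C + Kp + B * E * E + Kq) * M) * (m b1 - m a1) ^+ 2 +
      Kq * e * M * (m b1 - m a1).
  move=> aa1 ab1 bb1.
  have ra : a <= a1 <= b by rewrite aa1 (le_trans ab1).
  have rb : a <= b1 <= b by rewrite bb1 (le_trans aa1).
  have [D HD] := Mo1 _ _ _ Kp0 (psiL (tsr _ rb)).
  have /andP[a10 _] := tT _ ra; have /andP[_ b1T] := tT _ rb.
  have St := HK1 _ _ _ _ HD a10 ab1 b1T.
  set S := (fun x => prim (fun r => field (Mo (psi b1)) D r x) b1 - prim (fun r => field (Mo (psi b1)) D r x) a1) in St.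
  have bp : bounded_pair (Mo (psi b1)) D (Kp * (2 * `|n%:R + e| + 1) + Kp) N.
    have [|B' [m1 m2 _ _ out]] := @c11_bounded_pair R d _ D C (n%:R + e) N hd HD.
      by apply: le_trans rN; rewrite lerDl.
    split=> // x.
      by apply: le_trans (lipc_bounded hd Kp0 (HL _ rb) x) _; rewrite lerDl.
    apply: le_trans (c11_gradient_le hd Kp0 HD (HL _ rb).1 x) _.
    by rewrite lerDr mulr_ge0// addr_ge0// mulr_ge0.
  have [_ IS _] := field_fubini lf (mu a1) bp ab1.
  have Ib := Ig b1 a1 rb; have Ia := Ig a1 a1 ra.
  pose kap := (C + Kp + B * E * E + Kq) * (m b1 - m a1) ^+ 2 + Kq * e * (m b1 - m a1).
  have pw x : S x + (Mo (psi b1) x - Mo (psi a1) x) <= kap.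
    apply: (@mollified_step Mo e C a1 b1 D x) => //; [exact: tsr|exact: tsr|exact: (HL _ rb).1|].
    move=> c a2 y1 y2 k ta2 Hk.
    exact: (Mo3 _ _ _ _ _ _ c 0 y1 y2 k (psiL ta2) (psiL (tsr _ rb)) Hk).
  have mM : fine (mu a1 setT) <= M by apply: HM; exact: tT.
  have IB : (mu a1).-integrable setT (EFin \o (fun x => Mo (psi b1) x - Mo (psi a1) x)).
    exact: (integrableB measurableT Ib Ia).
  have tot : (\int[mu a1]_x S x) + ((\int[mu a1]_x Mo (psi b1) x) - (\int[mu a1]_x Mo (psi a1) x)) <=
     kap * M.
    rewrite -(RintegralB measurableT Ib Ia) -(RintegralD measurableT IS IB).
    apply: (@le_trans _ _ (\int[mu a1]_x (cst kap) x)).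
      apply: le_Rintegral => //.
      - exact: (integrableD measurableT IS IB).
      - by apply: (@bounded_integrable _ _ _ _ `|kap|).
      - by move=> x _; exact: pw.
    rewrite Rintegral_cst// ler_wpM2l//.
    have L0 := lf_L0 lf N; have del0 : 0 <= m b1 - m a1 by rewrite subr_ge0 prim_nd.
    exact: addr_ge0 (mulr_ge0 CK0 (exprn_ge0 _ del0)) (mulr_ge0 (mulr_ge0 Kq0 e_ge0) del0).
  have -> : (K1 + (C + Kp + B * E * E + Kq) * M) * (m b1 - m a1) ^+ 2 +
      Kq * e * M * (m b1 - m a1) = K1 * (m b1 - m a1) ^+ 2 + kap * M by rewrite /kap; ring.
  move: St tot; rewrite /g; set I1 := \int[mu b1]_x _; set I2 := \int[mu a1]_x _.
  set I3 := \int[mu a1]_x _; set I4 := \int[mu a1]_x _; move: (kap * M) (K1 * _) => p1 p2 h1 h2.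
  exact: (step_transfer h1 h2).
have cm : continuous m by exact: prim_continuous.
have hm : {homo m : x y / x <= y} by exact: (prim_nd IL (lf_L0 lf N)).
have Kbig : 0 <= K1 + (C + Kp + B * E * E + Kq) * M.
  by apply: addr_ge0 => //; exact: mulr_ge0.
have tot := sum_quadratic_errors ab cm hm Kbig step.
have ca : a <= a <= b by rewrite lexx.
have cb : a <= b <= b by rewrite lexx ab.
have := close a ca; have := close b cb; rewrite !ler_norml => /andP[q1 _] /andP[_ q2].
have q3 : Kp * e * M <= Kp * e0 * M by rewrite ler_wpM2r// ler_wpM2l.
have q4 : Kq * e * M * (m b - m a) <= Kq * e0 * M * (m b - m a).
  apply: ler_wpM2r; first by rewrite subr_ge0 hm.
  by apply: ler_wpM2r => //; exact: ler_wpM2l.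
have -> : e0 * (Kq * M * (m b - m a) + (Kp * M + Kp * M)) =
  Kq * e0 * M * (m b - m a) + (Kp * e0 * M + Kp * e0 * M) by ring.
move: tot q1 q2 q3 q4.
exact: chain_transfer.
Qed.

End fixed_phi.

Lemma compatibleN phi : compatible phi -> compatible (fun x => - phi x).
Proof.
move=> [h1 h2 h3]; split.
- by move=> x y; rewrite -opprD normrN.
- by move=> x; rewrite normrN.
- by move=> x; rewrite oppr_eq0; exact: h3.
Qed.

(** The integral of psi r does not increase in time, neither for phi nor for
    - phi, and its values at r = t and r = s are the two sides. *)
Theorem transport_identity phi : compatible phi -> 0 <= s <= T -> 0 <= t <= T ->
  \int[mu t]_x phi x = \int[mu s]_x (phi (Phi s t x) * expR (logw f om s t x)).
Proof.
move=> Hphi /andP[s0 sT] /andP[t0 tT].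
have key ph a b : compatible ph -> 0 <= a -> a <= b -> b <= T ->
    (forall r, a <= r <= b -> btw t s r) ->
    \int[mu b]_x psi f om ph t b x = \int[mu a]_x psi f om ph t a x.
  move=> Hp a0 ab bT tsr; apply/eqP; rewrite eq_le integral_psi_nonincreasing//=.
  have Hn := compatibleN Hp; have := integral_psi_nonincreasing Hn a0 ab bT tsr.
  have E1 r : (fun x => psi f om (fun x => - ph x) t r x) = (fun x => - psi f om ph t r x).
    by apply/funext => x; rewrite /psi mulNr.
  have Ip r : a <= r <= b -> (mu r).-integrable setT (EFin \o psi f om ph t r).
    move=> /tsr tr; apply: (lipc_integrable hd (mu r) _ (psiL Hp tr)).
    exact: (psi_lip_ge0 IL fb K0 B0).
  rewrite !E1 !Rintegral_opp ?lerN2//; apply: Ip; first by rewrite lexx.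
  by rewrite lexx ab.
have E0 : \int[mu t]_x phi x = \int[mu t]_x psi f om phi t t x.
  by apply: eq_Rintegral => x _; rewrite (psi_refl om IL mf fb fl).
rewrite E0; have [ts|/ltW st] := leP t s.
  by apply/esym; apply: key => // r /andP[h1 h2]; rewrite /btw h1 h2.
by apply: key => // r /andP[h1 h2]; rewrite /btw h1 h2 orbT.
Qed.

End transport.

(** * From functions to Borel sets *)

Section lipschitz_approximation.
Context {R : realType} {d : nat}.
Local Notation V := 'rV[R]_d.
Variable O : set V.
Hypothesis oO : open O.

Definition lower_values (k : R) (x : V) : set R :=
  [set (\1_O y + k * `|x - y|) | y in [set: V]].

(** The infimal convolution of the indicator of O with k |.|, which is the
    largest k-Lipschitz function below the indicator. *)
Definition lip_below (k : R) (x : V) : R := inf (lower_values k x).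

Lemma lower_values_lb k x : 0 <= k -> lbound (lower_values k x) 0.
Proof.
by move=> k0 _ [y _ <-]; rewrite addr_ge0 ?mulr_ge0// indicE ler0n.
Qed.

Lemma lip_below_le k x y : 0 <= k -> lip_below k x <= \1_O y + k * `|x - y|.
Proof.
move=> k0; apply: ge_inf; first by exists 0; exact: lower_values_lb.
by exists y.
Qed.

Lemma le_lip_below k x c : (forall y, c <= \1_O y + k * `|x - y|) -> c <= lip_below k x.
Proof.
move=> H; apply: lb_le_inf; first by exists (\1_O x + k * `|x - x|); exists x.
by move=> _ [y _ <-].
Qed.

Lemma lip_below_ge0 k x : 0 <= k -> 0 <= lip_below k x.
Proof. by move=> k0; apply: le_lip_below => y; rewrite addr_ge0 ?mulr_ge0// indicE ler0n. Qed.

Lemma lip_below_indic k x : 0 <= k -> lip_below k x <= \1_O x.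
Proof. by move=> k0; have := lip_below_le x x k0; rewrite subrr normr0 mulr0 addr0. Qed.

Lemma lip_below_norm k x : 0 <= k -> `|lip_below k x| <= 1.
Proof.
move=> k0; rewrite ger0_norm ?lip_below_ge0//; apply: le_trans (lip_below_indic x k0) _.
by rewrite indicE lern1 leq_b1.
Qed.

Lemma lip_below_out k x : 0 <= k -> lip_below k x != 0 -> O x.
Proof.
move=> k0; apply: contraNP => nO; rewrite eq_le lip_below_ge0// andbT.
by apply: le_trans (lip_below_indic x k0) _; rewrite indicE memNset.
Qed.

Lemma lip_below_lip k x x' : 0 <= k -> `|lip_below k x - lip_below k x'| <= k * `|x - x'|.
Proof.
move=> k0.
have key a b : lip_below k a - lip_below k b <= k * `|a - b|.
  rewrite lerBlDr -lerBlDl; apply: le_lip_below => y; rewrite lerBlDl.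
  apply: le_trans (lip_below_le a y k0) _; rewrite addrCA lerD2l -mulrDr ler_wpM2l//.
  by rewrite -{1}(subrK b a) -addrA ler_normD.
by rewrite ler_norml key andbT lerNl opprB distrC key.
Qed.

Lemma lip_below_mono k k' x : 0 <= k -> k <= k' -> lip_below k x <= lip_below k' x.
Proof.
move=> k0 kk; apply: le_lip_below => y; apply: le_trans (lip_below_le x y k0) _.
by rewrite lerD2l ler_wpM2r.
Qed.

Lemma lip_below_cvg x : (lip_below n%:R x) @[n --> \oo] --> (\1_O x : R).
Proof.
have [Ox|nO] := pselect (O x); last first.
  have -> : (fun n : nat => lip_below n%:R x) = cst (\1_O x).
    apply/funext => n; apply/eqP; rewrite eq_le lip_below_indic//=.
    by rewrite indicE memNset// lip_below_ge0.
  exact: cvg_cst.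
have /nbhs_ballP[r r0 Hr] : nbhs x O by exact: open_nbhs_nbhs.
apply: cvg_near_cst.
have : \forall n \near \oo, r^-1 <= n%:R :> R.
  by near=> n; near: n; exact: nbhs_infty_ger.
apply: filterS => n rn; apply/eqP; rewrite eq_le lip_below_indic//=.
rewrite indicE mem_set//; apply: le_lip_below => y.
have [yr|yr] := ltP `|x - y| r.
  have Oy : O y by apply: Hr; rewrite -ball_normE.
  by rewrite [\1_O y]indicE mem_set// lerDl mulr_ge0.
apply: (@le_trans _ _ (n%:R * `|x - y|)); last by rewrite lerDr indicE ler0n.
have -> : true%:R = r^-1 * r :> R by rewrite mulVf// lt0r_neq0.
by rewrite ler_pM// ?invr_ge0 ltW.
Unshelve. all: by end_near. Qed.

End lipschitz_approximation.

Section image_of_weighted.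
Context {R : realType} {d : nat}.
Local Notation V := 'rV[R]_d.
Variables (m1 m2 : {finite_measure set V -> \bar R}) (Psi : V -> V) (U : V -> R) (E : set V).
Hypotheses (cPsi : continuous Psi) (cU : continuous U) (U0 : forall x, 0 <= U x) (oE : open E).

Lemma open_measurable_rV (A : set V) : open A -> measurable A.
Proof. by move=> oA; exact: sub_sigma_algebra. Qed.

Lemma measurable_preimage (A : set V) : measurable A -> measurable (Psi @^-1` A).
Proof. by move=> mA; rewrite -[_ @^-1` _]setTI; exact: continuous_measurable_rV_rV. Qed.

Let mU : measurable_fun setT (fun x => (U x)%:E).
Proof. by apply/measurable_EFinP; exact: continuous_measurable_rV. Qed.

Lemma open_image_of_weighted (B : R) (O : set V) : (forall x, U x <= B) -> open O ->
  (forall k : nat, \int[m1]_x lip_below O k%:R x = \int[m2]_x (lip_below O k%:R (Psi x) * U x)) ->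
  m1 O = (\int[m2]_(x in Psi @^-1` O) (U x)%:E)%E.
Proof.
move=> UB oO H; have mO := open_measurable_rV oO.
have ml (k : nat) : measurable_fun setT (lip_below O k%:R).
  apply: continuous_measurable_rV.
  by apply: (@lipschitz_continuous R V R _ k%:R) => x y; exact: lip_below_lip.
have mlP (k : nat) : measurable_fun setT (fun x => lip_below O k%:R (Psi x) * U x).
  apply: measurable_funM; last exact: continuous_measurable_rV.
  by apply: measurableT_comp (ml k) _; exact: continuous_measurable_rV_rV.
have l0 (k : nat) x : 0 <= lip_below O k%:R x by exact: lip_below_ge0.
have Ek k : (\int[m1]_x (lip_below O k%:R x)%:E = \int[m2]_x (lip_below O k%:R (Psi x) * U x)%:E)%E.
  rewrite -!Rintegral_EFin//; first by rewrite H.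
    apply: (@bounded_integrable _ _ _ _ B) => // x.
    rewrite normrM (ger0_norm (U0 x)) -[leRHS]mul1r ler_pM//.
    exact: lip_below_norm.
  apply: (@bounded_integrable _ _ _ _ 1) => // x; exact: lip_below_norm.
have c1 : (\int[m1]_x (lip_below O k%:R x)%:E @[k --> \oo] --> \int[m1]_x (\1_O x)%:E)%E.
  have := @cvg_monotone_convergence _ _ _ m1 setT measurableT
     (fun (k : nat) x => (lip_below O k%:R x)%:E).
  have -> : (fun x => limn ((fun (k : nat) => (lip_below O k%:R x)%:E))) = (fun x => (\1_O x)%:E).
    by apply/funext => x; apply/cvg_lim => //; apply: cvg_EFin; [exact: nearW|exact: lip_below_cvg].
  apply.
  - by move=> k; exact/measurable_EFinP.
  - by move=> k x _; rewrite lee_fin.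
  - by move=> x _ k k' kk; rewrite lee_fin lip_below_mono// ler_nat.
have c2 : (\int[m2]_x (lip_below O k%:R (Psi x) * U x)%:E @[k --> \oo] --> \int[m2]_x (\1_O (Psi x) * U x)%:E)%E.
  have := @cvg_monotone_convergence _ _ _ m2 setT measurableT
     (fun (k : nat) x => (lip_below O k%:R (Psi x) * U x)%:E).
  have -> : (fun x => limn ((fun (k : nat) => (lip_below O k%:R (Psi x) * U x)%:E))) = (fun x => (\1_O (Psi x) * U x)%:E).
    apply/funext => x; apply/cvg_lim => //; apply: cvg_EFin; first exact: nearW.
    by apply: cvgM; [exact: lip_below_cvg|exact: cvg_cst].
  apply.
  - by move=> k; exact/measurable_EFinP.
  - by move=> k x _; rewrite lee_fin mulr_ge0.
  - by move=> x _ k k' kk; rewrite lee_fin ler_wpM2r// lip_below_mono// ler_nat.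
have -> : m1 O = (\int[m1]_x (\1_O x)%:E)%E by rewrite integral_indic// setIT.
rewrite [RHS]integral_mkcond.
have -> : (\int[m2]_x ((fun x => (U x)%:E) \_ (Psi @^-1` O)) x = \int[m2]_x (\1_O (Psi x) * U x)%:E)%E.
  apply: eq_integral => x _; rewrite patchE indicE.
  have -> : (x \in Psi @^-1` O) = (Psi x \in O) by apply/idP/idP; rewrite !inE.
  by case: (_ \in _); rewrite ?mul1r ?mul0r.
have E12 : (fun k : nat => \int[m1]_x (lip_below O k%:R x)%:E)%E = (fun k : nat => \int[m2]_x (lip_below O k%:R (Psi x) * U x)%:E)%E.
  by apply/funext.
by rewrite E12 in c1; exact: (cvg_unique _ c1 c2).
Qed.

(** Open sets are stable under intersection and generate the Borel sets, and
    m1 is finite, which allows complements: Dynkin's lemma applies. *)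
Lemma borel_image_of_weighted :
  (forall O, open O -> O `<=` E -> m1 O = (\int[m2]_(x in Psi @^-1` O) (U x)%:E)%E) ->
  forall A, measurable A -> m1 (A `&` E) = (\int[m2]_(x in Psi @^-1` (A `&` E)) (U x)%:E)%E.
Proof.
move=> HO; have mE := open_measurable_rV oE.
apply: (@dynkin_induction _ _ (@open V)) => //.
- exact: openI.
- by rewrite setTI; exact: HO.
- by move=> O oO; apply: HO; [exact: openI|exact: subIsetr].
- move=> S mS HS.
  have mSE : measurable (S `&` E) by exact: measurableI.
  have mSCE : measurable (~` S `&` E) by apply: measurableI => //; exact: measurableC.
  have EU : E = (~` S `&` E) `|` (S `&` E) by rewrite -setIUl setvU setTI.
  have dj : [disjoint (~` S `&` E) & (S `&` E)].
    by apply/disj_setPS => x [[nS _] [Sx _]].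
  have e1 : m1 E = (m1 (~` S `&` E) + m1 (S `&` E))%E.
    by rewrite {1}EU measureU//; apply/disj_set2P.
  have e2 : (\int[m2]_(x in Psi @^-1` E) (U x)%:E = \int[m2]_(x in Psi @^-1` (~` S `&` E)) (U x)%:E +
     \int[m2]_(x in Psi @^-1` (S `&` E)) (U x)%:E)%E.
    rewrite {1}EU preimage_setU ge0_integral_setU//.
    + exact: measurable_preimage.
    + exact: measurable_preimage.
    + exact: measurable_funS mU.
    + by move=> x _; rewrite lee_fin.
    + by apply/disj_setPS => x [[nS _] [Sx _]].
  have := HO E oE (@subset_refl _ E); rewrite e1 e2 -HS => e3.
  have fz : m1 (S `&` E) \is a fin_num by exact: fin_num_measure.
  by rewrite -[LHS](addeK _ fz) e3 addeK.
- move=> F mF tF HF.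
  have mFE k : measurable (F k `&` E) by exact: measurableI.
  have tFE : trivIset setT (fun k => F k `&` E) by apply: trivIset_setIr.
  rewrite setI_bigcupl measure_semi_bigcup//; last exact: bigcupT_measurable.
  rewrite preimage_bigcup ge0_integral_bigcup//.
  + by apply: eq_eseriesr => k _; exact: HF.
  + by move=> k; exact: measurable_preimage.
  + exact: measurable_funS mU.
  + by move=> x _; rewrite lee_fin.
  + apply/trivIsetP => i j _ _ ij; rewrite -preimage_setI.
    by have /trivIsetP -> := tFE; rewrite ?preimage_set0.
Qed.

End image_of_weighted.

(** * The maximal flow transports the measures *)

Section conclusion.
Context {R : realType} {d : nat}.
Local Notation V := 'rV[R]_d.
Local Notation leb := (@lebesgue_measure R).
Variables (T : R) (mu : R -> {finite_measure set V -> \bar R}).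
Variables (v : R -> V -> V) (w : R -> V -> R) (vh : R -> V -> V) (wh : R -> V -> R).
Variable (L : nat -> R -> R).
Hypotheses (hd : (1 <= d)%N) (hT : 0 < T) (hmu : narrowly_continuous T mu)
  (lf : local_field vh wh L).
Hypothesis heq : solves_continuity_equation T v w mu.
Hypothesis hae : {ae leb, forall t, 0 <= t <= T -> vh t = v t /\ wh t = w t}.
Hypothesis hw : measurable_fun (`[0, T] `*` [set: V]) (fun p : R * V => w p.1 p.2).

Let vv : {ae leb, forall t, 0 <= t <= T -> vh t = v t}.
Proof. by apply: ae_impl hae => t h /h[]. Qed.

Lemma flow_dom_good s t x : 0 <= s <= T -> 0 <= t <= T ->
  flow_dom v T s t x <-> exists n, good vh n s t x.
Proof.
move=> sT tT; have [E _] := maximal_solution_trunc lf x sT vv.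
rewrite /flow_dom/= E; split; first by case.
by move=> h; split.
Qed.

Lemma flow_good n s t q x : 0 <= s <= T -> 0 <= t <= T -> good vh n s t x -> btw s t q ->
  flow v T s q x = gflow (trunc vh n) s q x.
Proof.
move=> sT tT g stq; have [_ E] := maximal_solution_trunc lf x sT vv.
have gq := good_mon stq g.
rewrite E ?(trajE lf gq)//; split; last by exists n.
move: stq sT tT; rewrite /btw => /orP[]/andP[h1 h2] /andP[h3 h4] /andP[h5 h6]; apply/andP; split.
- exact: le_trans h1.
- exact: le_trans h6.
- exact: le_trans h1.
- exact: le_trans h4.
Qed.

Lemma good_goodS n s t x : good vh n s t x -> forall q, btw s t q ->
  gflow (trunc vh n.+2) s q x = gflow (trunc vh n) s q x.
Proof. by move=> g q stq; apply: (Xn_stable lf _ g stq); exact: leqW. Qed.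

(** Reading the level n off the flow of the single truncation n + 2 makes
    the sets of good points open and lets that flow exchange those at the
    two ends of the path. *)
Lemma goodP n s t x : good vh n s t x <->
  forall q, btw s t q -> `|gflow (trunc vh n.+2) s q x| < n%:R.
Proof.
split=> [g q stq|g q stq]; first by rewrite (good_goodS g stq) g.
rewrite (@Xn_agree _ _ _ _ _ lf n.+2 n s t x q)//; first exact: g.
move=> p /g h; split=> //; apply: lt_le_trans h _.
by rewrite ler_nat; exact: leqW.
Qed.

Let IL N := lf_L1 lf N.
Let mf N := measurable_trunc lf N.
Let fb N := trunc_le lf N.
Let fl N := trunc_lip lf N.
Let mo N := truncw_measurable lf N.
Let ob N := truncw_le lf N.
Let ol N := truncw_lip lf N.

Lemma good_transport n s t x : good vh n s t x <-> good vh n t s (gflow (trunc vh n.+2) s t x).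
Proof.
by split=> /goodP g; apply/goodP => q; rewrite btwC => /g;
  rewrite (gflow_trans (@IL _) (@mf _) (@fb _) (@fl _)).
Qed.

Lemma good_open_set n s t : open [set x | good vh n s t x].
Proof.
rewrite openE => x /goodP gx.
pose a := Num.min s t; pose b := Num.max s t.
have abE p : btw s t p = (a <= p <= b) by exact: btwE.
have ab0 : a <= b by rewrite /a /b ge_min le_max lexx.
pose X q y := gflow (trunc vh n.+2) s q y.
have cX : {within `[a, b], continuous (fun q => `|X q x|)}.
  apply: continuous_subspaceT => q; apply: continuous_comp; last exact: norm_continuous.
  exact: (Xn_continuous lf).
have [c cab Hc] := EVT_max ab0 cX.
have gap : 0 < n%:R - `|X c x| by rewrite subr_gt0; apply: gx; rewrite abE; rewrite in_itv in cab.
pose FL := flow_lip (L n.+2); have FL0 : 0 <= FL := flow_lip_ge0 _.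
have FL1 : 0 < FL + 1 by rewrite ltr_wpDl.
apply/nbhs_ballP; exists ((n%:R - `|X c x|) / (FL + 1)); first exact: divr_gt0.
move=> y; rewrite -ball_normE /ball_/= ltr_pdivlMr// => xy; apply/goodP => q stq.
have h1 : `|X q x| <= `|X c x| by apply: Hc; rewrite in_itv/= -abE.
have h2 : `|X q x - X q y| <= FL * `|x - y| by exact: (gflow_lip (@IL _) (@mf _) (@fb _) (@fl _)).
have h3 : `|X q y| <= `|X q x| + `|X q x - X q y|.
  by rewrite -{1}(subKr (X q x) (X q y)); exact: ler_normB.
have h4 : FL * `|x - y| <= `|x - y| * (FL + 1) by rewrite mulrDr mulr1 mulrC lerDl.
apply: (le_lt_trans h3); rewrite -ltrBrDl; apply: (le_lt_trans h2); apply: (le_lt_trans h4).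
by apply: (lt_le_trans xy); rewrite lerD2l lerN2.
Qed.

Lemma flow_weight_good n s t x : 0 <= s <= T -> 0 <= t <= T -> good vh n s t x ->
  flow_weight v w T s t x = expR (logw (trunc vh n.+2) (truncw wh n.+2) s t x).
Proof.
move=> sT tT g; congr expR.
pose X q := gflow (trunc vh n.+2) s q x.
have mX : measurable_fun setT X by exact: (gflow_measurable (@IL _) (@mf _) (@fb _) (@fl _)).
pose om q := truncw wh n.+2 q (X q).
have Iom : L1 om by apply: (L1_weight_along (@IL _) (@mo _) (@ob _)).
have st q : btw s t q -> 0 <= q <= T.
  move: sT tT; rewrite /btw => /andP[h1 h2] /andP[h3 h4] /orP[]/andP[h5 h6]; apply/andP; split.
  - exact: le_trans h5.
  - exact: le_trans h4.
  - exact: le_trans h5.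
  - exact: le_trans h2.
have key a b : (forall q, a <= q <= b -> btw s t q) -> a <= b ->
    \int[leb]_(r in `[a, b]) w r (flow v T s r x) = prim om b - prim om a.
  move=> abst ab; rewrite primB// /Rintegral integral_itv_obnd_cbnd; last first.
    by apply: measurable_int (L1S _ Iom); exact: measurable_itv.
  congr fine.
  have E q : q \in (`[a, b]%classic : set R) -> (w q (flow v T s q x))%:E = (w q (X q))%:E.
    rewrite inE/= in_itv/= => /abst stq.
    by rewrite (flow_good sT tT g stq) /X (good_goodS g stq).
  apply: (@etrans _ _ (\int[leb]_(q in `[a, b]) (w q (X q))%:E)%E); first exact: eq_integral.
  apply: ae_eq_integral => //.
  - apply/measurable_EFinP.
    apply: (@measurable_comp _ _ _ _ _ _ (`[0, T]%classic `*` [set: V]) (fun p : R * V => w p.1 p.2) _ (fun r => (r, X r))) => //.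
    + exact: measurableX.
    + by move=> _ [r /= rab <-]; split=> //=; rewrite in_itv/=; apply/st/abst; rewrite in_itv/= in rab.
    + by apply: measurable_funTS; apply: measurable_fun_pair.
  - by apply: measurable_int (L1S _ Iom); exact: measurable_itv.
  apply: ae_impl hae => q Hq; rewrite /= in_itv/= => /abst stq.
  have [_ <-] := Hq (st q stq).
  rewrite /om /truncw clampV_id//; have /goodP/(_ q stq)/ltW h := g.
  by apply: le_trans h _; rewrite ler_nat; exact: leqW.
rewrite /oriented_int /logw; have [hst|/ltW hts] := leP s t.
  by rewrite key// => q h; rewrite /btw h.
by rewrite key ?opprB// => q h; rewrite /btw h orbT.
Qed.

(** Subsets of the good points of level n carry the functions for which
    transport_identity holds, and Lipschitz functions increase to the
    indicator of every open one. *)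
Lemma transport_level n s t A : 0 <= s <= T -> 0 <= t <= T -> measurable A ->
  mu t (A `&` [set x | good vh n t s x]) =
  (\int[mu s]_(x in [set x | good vh n s t x] `&` gflow (trunc vh n.+2) s t @^-1` A)
    (expR (logw (trunc vh n.+2) (truncw wh n.+2) s t x))%:E)%E.
Proof.
move=> sT tT mA.
set Psi := gflow (trunc vh n.+2) s t.
pose U x := expR (logw (trunc vh n.+2) (truncw wh n.+2) s t x).
have cPsi : continuous Psi.
  apply: (@lipschitz_continuous R V V Psi (flow_lip (L n.+2))) => x y.
  exact: (gflow_lip (@IL _) (@mf _) (@fb _) (@fl _)).
have UB x : U x <= expR (\int[leb]_q L n.+2 q).
  by apply: (expR_logw_le (@IL _) (@mf _) (@fb _) (@fl _) (@mo _) (@ob _)).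
have cU : continuous U.
  move=> x; apply: continuous_comp; last exact: continuous_expR.
  move: x; apply: (@lipschitz_continuous R V R _
    (flow_lip (L n.+2) * `|prim (L n.+2) t - prim (L n.+2) s|)) => x y.
  rewrite mulrAC.
  exact: (logw_lip (@IL _) (@mf _) (@fb _) (@fl _) (@mo _) (@ob _) (@ol _)).
have U0 x : 0 <= U x by exact: expR_ge0.
have oE := @good_open_set n t s.
rewrite (@borel_image_of_weighted _ _ (mu t) (mu s) Psi U _ cPsi cU U0 oE _ A mA).
  congr (integral _ _ _); apply/seteqP; split => x /=.
    by move=> [Ax gx]; split=> //; apply/good_transport.
  by move=> [/good_transport gx Ax].
move=> O oO OE; apply: (open_image_of_weighted cPsi cU U0 UB oO) => k.
have k0 : 0 <= k%:R :> R by [].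
apply: (transport_identity hd hT hmu lf heq hae k0 ler01 _ sT tT); split.
- by move=> x y; exact: lip_below_lip.
- by move=> x; exact: lip_below_norm.
- by move=> x /(lip_below_out k0)/OE/goodP.
Qed.

(** The good points of level n increase with n to the domains of the flow. *)
Theorem transport_of_measures s t A : 0 <= s <= T -> 0 <= t <= T -> measurable A ->
  pushforward
    (weighted_restricted (mu s) (flow_weight v w T s t) (flow_dom v T s t))
    (flow v T s t) A
  = restricted (mu t) (flow_dom v T t s) A.
Proof.
move=> sT tT mA; rewrite /pushforward /weighted_restricted /restricted.
pose F n := [set x | good vh n s t x] `&` gflow (trunc vh n.+2) s t @^-1` A.
have EF : flow v T s t @^-1` A `&` flow_dom v T s t = \bigcup_n F n.
  apply/seteqP; split => x.
    move=> [Ax /(flow_dom_good x sT tT)[n gx]]; exists n => //; split=> //=.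
    by rewrite (good_goodS gx) ?btw_refr// -(flow_good sT tT gx) ?btw_refr.
  move=> [n _ [gx Ax]]; split; last by apply/flow_dom_good => //; exists n.
  by rewrite /= (flow_good sT tT gx) ?btw_refr// -(good_goodS gx) ?btw_refr.
have mF n : measurable (F n).
  apply: measurableI; first by apply: open_measurable_rV; exact: good_open_set.
  apply: measurable_preimage mA.
  apply: (@lipschitz_continuous R V V _ (flow_lip (L n.+2))) => x y.
  exact: (gflow_lip (@IL _) (@mf _) (@fb _) (@fl _)).
have ndF : nondecreasing_seq F.
  move=> m n mn; apply/subsetPset => x [gx Ax]; have gx' := good_up lf mn gx; split=> //=.
  by rewrite (good_goodS gx') ?btw_refr// -(flow_good sT tT gx') ?btw_refr//
    (flow_good sT tT gx) ?btw_refr// -(good_goodS gx) ?btw_refr.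
rewrite EF.
have EW n x : F n x -> (flow_weight v w T s t x)%:E =
    (expR (logw (trunc vh n.+2) (truncw wh n.+2) s t x))%:E.
  by move=> [gx _]; rewrite (flow_weight_good sT tT gx).
have mW n : measurable_fun (F n) (fun x => (flow_weight v w T s t x)%:E).
  apply: (eq_measurable_fun (fun x => (expR (logw (trunc vh n.+2) (truncw wh n.+2) s t x))%:E)).
    by move=> x /set_mem /EW.
  apply: measurable_funTS; apply/measurable_EFinP; apply: continuous_measurable_rV.
  move=> x; apply: continuous_comp; last exact: continuous_expR.
  move: x; apply: (@lipschitz_continuous R V R _
    (flow_lip (L n.+2) * `|prim (L n.+2) t - prim (L n.+2) s|)) => x y.
  rewrite mulrAC.
  exact: (logw_lip (@IL _) (@mf _) (@fb _) (@fl _) (@mo _) (@ob _) (@ol _)).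
have W0 n x : F n x -> (0 <= (flow_weight v w T s t x)%:E)%E.
  by move=> _; rewrite lee_fin expR_ge0.
have c1 := ge0_nondecreasing_set_cvg_integral ndF mF mW W0 (mu := mu s).
pose G n := A `&` [set x | good vh n t s x].
have mG n : measurable (G n).
  by apply: measurableI => //; apply: open_measurable_rV; exact: good_open_set.
have ndG : nondecreasing_seq G.
  by move=> m n mn; apply/subsetPset => x [Ax gx]; split=> //; exact: (good_up lf mn gx).
have EG : A `&` flow_dom v T t s = \bigcup_n G n.
  apply/seteqP; split => x.
    by move=> [Ax /(flow_dom_good x tT sT)[n gx]]; exists n.
  by move=> [n _ [Ax gx]]; split=> //; apply/flow_dom_good => //; exists n.
rewrite EG.
have c2 := nondecreasing_cvg_mu mG (bigcupT_measurable _ mG) ndG (mu := mu t).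
have E12 : (fun n => \int[mu s]_(x in F n) (flow_weight v w T s t x)%:E)%E = mu t \o G.
  apply/funext => n; rewrite /= (transport_level _ sT tT mA).
  by apply: eq_integral => x /set_mem /EW.
by rewrite E12 in c1; exact: (cvg_unique _ c1 c2).
Qed.

End conclusion.

Theorem lemma4p5 (R : realType) (d : nat) (hd : (1 <= d)%N)
    (T : R) (hT : 0 < T)
    (v : R -> 'rV[R]_d -> 'rV[R]_d) (w : R -> 'rV[R]_d -> R)
    (mu : R -> {finite_measure set 'rV[R]_d -> \bar R})
    (hv : measurable_fun (`[0, T] `*` [set: 'rV[R]_d])
            (fun p : R * 'rV[R]_d => v p.1 p.2))
    (hw : measurable_fun (`[0, T] `*` [set: 'rV[R]_d])
            (fun p : R * 'rV[R]_d => w p.1 p.2))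
    (hmu : narrowly_continuous T mu)
    (hloc : forall B : set 'rV[R]_d, compact (closure B) ->
      (@completed_lebesgue_measure R).-integrable `[0, T]
        (fun t => sup_on (@enorm R d) (v t) B + Lip (@enorm R d) (v t) B
                  + sup_on Num.norm (w t) B + Lip Num.norm (w t) B)%E)
    (heq : solves_continuity_equation T v w mu)
    (hint : (\int[@lebesgue_measure R]_(t in `[0%R, T]) \int[mu t]_x
               (enorm (v t x) + `|w t x|)%:E < +oo)%E) :
  forall s t : R, 0 <= s <= T -> 0 <= t <= T ->
    forall A : set 'rV[R]_d, measurable A ->
      pushforward
        (weighted_restricted (mu s) (flow_weight v w T s t) (flow_dom v T s t))
        (flow v T s t) A
      = restricted (mu t) (flow_dom v T t s) A.
Proof.
have [vh [wh [L [lf hae]]]] := local_field_exists hd hv hw hloc.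
move=> s t sT tT A mA.
exact: (transport_of_measures hd hT hmu lf heq hae hw sT tT mA).
Qed.
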